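(* Let $K$ be a local field, let $w$ be a $\Lambda$-periodic weight function on $K$, and let $1<p<\infty$. Then the following statements are equivalent. (a) There is a positive constant $C$ such that $$\Bigl(\frac{1}{|B|}\int_{B}w(x)\,dx\Bigr)\Bigl(\frac{1}{|B|}\int_{B}w(x)^{-\frac{1}{p-1}}\,dx\Bigr)^{p-1}\leq C$$ for every ball $B$ in $K$. (b) There is a positive constant $C_{p,w}$, depending only on $w$ and $p$, such that for every $f\in L^p(\mathfrak{D},w)$ we have $f\in L^1(\mathfrak{D})$ and $$\int_{\mathfrak{D}}|S_{n}f(x)|^p w(x)\,dx\leq C_{p,w}\int_{\mathfrak{D}}|f(x)|^pw(x)\,dx\qquad\text{for } n=0,1,2,\dots.$$ (c) For every $\Lambda$-periodic function $f\in L^p(\mathfrak{D},w)$, we have $f\in L^1(\mathfrak{D})$ and $S_nf\rightarrow f$ in $L^p(\mathfrak{D},w)$ as $n\rightarrow\infty$.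
   Context: A local field $K$ is a topological field that is locally compact, non-discrete and totally disconnected. Let $dx$ be the Haar measure on the additive group $K^+$, and let $|\cdot|$ be the absolute value on $K$ determined by $d(\alpha x)=|\alpha|\,dx$ for $\alpha\neq 0$ and $|0|=0$. Put $\mathfrak{D}=\{x\in K:|x|\le 1\}$ (ring of integers) and $\mathfrak{P}=\{x\in K:|x|<1\}$ (prime ideal); Haar measure is normalized so that $\mathfrak{D}$ has measure $1$, and $|E|$ denotes the Haar measure of a measurable set $E\subseteq K$. The residue field $\mathfrak{D}/\mathfrak{P}$ is isomorphic to the finite field $\mathbb{F}_q$ with $q=\ell^c$, $\ell$ prime, $c\ge1$. Fix a prime element $\mathfrak{p}$, i.e. an element of maximal absolute value in $\mathfrak{P}$; then $|\mathfrak{p}|=q^{-1}$. Put $\mathfrak{P}^k=\mathfrak{p}^k\mathfrak{D}=\{x:|x|\le q^{-k}\}$ for $k\in\mathbb{Z}$. A ball is a set of the form $h+\mathfrak{P}^k$, $h\in K$, $k\in\mathbb{Z}$. The elements $u(n)$, $n\ge 0$: choose $1=\epsilon_0,\epsilon_1,\dots,\epsilon_{c-1}\in\mathfrak{D}\setminus\mathfrak{P}$ whose images in $\mathfrak{D}/\mathfrak{P}\cong\mathbb{F}_q$ form a basis over $\mathbb{F}_\ell$. For $0\le n<q$ with $n=a_0+a_1\ell+\dots+a_{c-1}\ell^{c-1}$, $0\le a_k<\ell$, put $u(n)=(a_0+a_1\epsilon_1+\dots+a_{c-1}\epsilon_{c-1})\mathfrak{p}^{-1}$. For general $n=b_0+b_1q+\dots+b_sq^s$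 with $0\le b_k<q$, put $u(n)=u(b_0)+u(b_1)\mathfrak{p}^{-1}+\dots+u(b_s)\mathfrak{p}^{-s}$. Then $\Lambda=\{u(n):n\ge0\}$ is a complete set of distinct coset representatives of $\mathfrak{D}$ in $K^+$. A function $f$ on $K$ is $\Lambda$-periodic if $f(x+u(n))=f(x)$ for all $n\ge0$ and a.e. $x\in K$. Fix a character $\chi$ of $K^+$ that is trivial on $\mathfrak{D}$ but non-trivial on $\mathfrak{P}^{-1}$, and write $\chi_y(x)=\chi(yx)$. For $f\in L^1(\mathfrak{D})$ set $\hat f(u(n))=\int_{\mathfrak{D}}f(x)\overline{\chi_{u(n)}(x)}\,dx$ and $S_nf(x)=\sum_{k=0}^{n-1}\hat f(u(k))\chi_{u(k)}(x)$ (with $S_0f=0$). A weight on $K$ is a locally integrable function on $K$ that is positive a.e. $L^p(\mathfrak{D},w)$ is the space of functions on $\mathfrak{D}$ that are $p$-integrable with respect to $w(x)\,dx$; a $\Lambda$-periodic function on $K$ is regarded as an element of this space via its restriction to $\mathfrak{D}$. *)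

(* Defs.v *)
From HB Require Import structures.
From mathcomp Require Import all_boot all_order all_algebra.
From mathcomp Require Import finfield.
From mathcomp Require Import complex.
From mathcomp Require Import all_classical all_reals all_analysis.

Set Implicit Arguments.
Unset Strict Implicit.
Unset Printing Implicit Defensive.

Import Order.TTheory GRing.Theory Num.Theory.
Import numFieldNormedType.Exports.

Local Open Scope classical_set_scope.
Local Open Scope ring_scope.

HB.mixin Record isTopologicalField K
    & GRing.Field K & TopologicalZmodule K := {
  mul_continuous_subproof : continuous (fun x : K * K => x.1 * x.2);
  inv_continuous_subproof :
    forall x : K, x != 0 -> {for x, continuous (@GRing.inv K)}
}.

#[short(type="topologicalFieldType")]
HB.structure Definition TopologicalField :=
  {K of GRing.Field K & TopologicalZmodule K
      & isTopologicalField K}.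

HB.mixin Record isLocalField K & TopologicalField K := {
  locally_compact_subproof : locally_compact [set: K];
  nondiscrete_subproof : ~ (forall A : set K, open A);
  totally_disconnected_subproof : totally_disconnected [set: K]
}.

#[short(type="localFieldType")]
HB.structure Definition LocalField := {K of TopologicalField K & isLocalField K}.

(* g_sigma_algebraType needs a pointed type. *)
#[non_forgetful_inheritance]
HB.instance Definition _ (K : localFieldType) := isPointed.Build K 0.

Notation borel K := (g_sigma_algebraType (@open K)).

Section LocalFieldMeasure.
Variables (R : realType) (K : localFieldType).
Variable mu : {measure set (borel K) -> \bar R}.

(* A nonzero translation invariant Radon measure on the Borel sets of K. *)
Record haar_measure : Prop := HaarMeasure {
  haar_translation : forall (h : K) (A : set (borel K)), measurable A ->
    mu [set h + x | x in (A : set K)] = mu A;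
  haar_nonzero : mu [set: borel K] != 0%E;
  haar_compact : forall A : set K, compact A -> (mu A < +oo)%E;
  haar_outer_regular : forall A : set (borel K), measurable A ->
    mu A = ereal_inf [set mu (U : set (borel K))
                     | U in [set U : set K | open U /\ A `<=` U]];
  haar_inner_regular : forall U : set K, open U ->
    mu U = ereal_sup [set mu (A : set (borel K))
                     | A in [set A : set K | compact A /\ A `<=` U]]
}.

(* abs is the module of K: d(a x) = abs a dx for a != 0. *)
Definition haar_absolute_value (abs : K -> R) : Prop :=
  abs 0 = 0 /\
  forall a : K, a != 0 -> forall A : set (borel K), measurable A ->
    mu [set a * x | x in (A : set K)] = ((abs a)%:E * mu A)%E.

(* Complex integrals are taken componentwise. *)
Definition cmeasurable_fun (D : set K) (f : K -> R[i]) : Prop :=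
  measurable_fun (D : set (borel K)) (fun x : borel K => complex.Re (f x)) /\
  measurable_fun (D : set (borel K)) (fun x : borel K => complex.Im (f x)).

Definition cintegrable (D : set K) (f : K -> R[i]) : Prop :=
  mu.-integrable D (fun x => (complex.Re (f x))%:E) /\
  mu.-integrable D (fun x => (complex.Im (f x))%:E).

Definition cintegral (D : set K) (f : K -> R[i]) : R[i] :=
  Complex (\int[mu]_(x in D) complex.Re (f x))%R
          (\int[mu]_(x in D) complex.Im (f x))%R.

(* A representative of a weight may fail to be positive on a null set. *)
Definition weight (w : K -> R) : Prop :=
  [/\ measurable_fun [set: borel K] (w : borel K -> R),
      (forall A : set K, compact A -> mu.-integrable A (EFin \o w)) &
      {ae mu, forall x, 0 < w x}].

Definition weighted_pintegral (D : set K) (w : K -> R) (p : R)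
    (f : K -> R[i]) : \bar R :=
  \int[mu]_(x in D) ((Normc.normc (f x)) `^ p * w x)%:E.

Definition weighted_Lp (D : set K) (w : K -> R) (p : R) (f : K -> R[i]) : Prop :=
  cmeasurable_fun D f /\ (weighted_pintegral D w p f < +oo)%E.

Definition weighted_Lp_norm (D : set K) (w : K -> R) (p : R)
    (f : K -> R[i]) : \bar R :=
  poweR (weighted_pintegral D w p f) p^-1.

Definition periodic_ae (T : Type) (u : nat -> K) (f : K -> T) : Prop :=
  forall n, {ae mu, forall x, f (x + u n) = f x}.

Definition average (B : set K) (g : K -> R) : \bar R :=
  ((fine (mu B))^-1%:E * \int[mu]_(x in B) (g x)%:E)%E.

End LocalFieldMeasure.

Section LocalFieldArithmetic.
Variables (R : realType) (K : localFieldType) (abs : K -> R).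

Definition integers : set K := [set x | abs x <= 1].
Definition prime_ideal : set K := [set x | abs x < 1].

Definition prime_element (varpi : K) : Prop :=
  prime_ideal varpi /\ forall x, prime_ideal x -> abs x <= abs varpi.

(* red induces a ring isomorphism from integers / prime_ideal onto F; its values
   outside integers are irrelevant. *)
Record residue_map (F : fieldType) (red : K -> F) : Prop := ResidueMap {
  residue_map1 : red 1 = 1;
  residue_mapD : {in integers &, {morph red : x y / x + y}};
  residue_mapM : {in integers &, {morph red : x y / x * y}};
  residue_map_ker : forall x, integers x -> (red x = 0 <-> prime_ideal x);
  residue_map_surj : forall z, exists2 x, integers x & red x = z
}.

(* pPrimeCharType charF is F with its vector space structure over the prime
   field. *)
Definition residue_basis (F : finFieldType) (red : K -> F) (l c : nat)
    (charF : l \in [pchar F]) (eps : 'I_c -> K) : Prop :=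
  [/\ forall i : 'I_c, i = 0%N :> nat -> eps i = 1,
      forall i, (integers `\` prime_ideal) (eps i) &
      basis_of (fullv : {vspace pPrimeCharType charF})
               [seq red (eps i) | i : 'I_c]].

(* The fractional ideal P^k. *)
Definition prime_ideal_pow (varpi : K) (k : int) : set K :=
  [set varpi ^ k * x | x in integers].

Definition field_ball (varpi : K) (B : set K) : Prop :=
  exists h k, B = [set h + x | x in prime_ideal_pow varpi k].

Definition character (chi : K -> R[i]) : Prop :=
  [/\ forall x y, chi (x + y) = chi x * chi y,
      forall x, Normc.normc (chi x) = 1 &
      continuous (chi : K -> (R[i] : numFieldType))].

End LocalFieldArithmetic.

Section CosetRepresentatives.
Variables (K : localFieldType) (l c : nat) (eps : 'I_c -> K) (varpi : K).

Definition digit (b n k : nat) : nat := ((n %/ b ^ k) %% b)%N.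

Definition u_digit (n : nat) : K :=
  (\sum_(k < c) (digit l n k)%:R * eps k) * varpi^-1.

(* trunc_log q n is the index of the leading base q digit of n. *)
Definition u_rep (n : nat) : K :=
  let q := (l ^ c)%N in
  \sum_(k < (trunc_log q n).+1) u_digit (digit q n k) * varpi ^- k.

End CosetRepresentatives.

Section FourierSeries.
Variables (R : realType) (K : localFieldType).
Variables (mu : {measure set (borel K) -> \bar R}) (D : set K).
Variables (chi : K -> R[i]) (u : nat -> K).

Definition fourier_coef (f : K -> R[i]) (y : K) : R[i] :=
  cintegral mu D (fun x => f x * conjc (chi (y * x))).

Definition fourier_sum (n : nat) (f : K -> R[i]) (x : K) : R[i] :=
  \sum_(k < n) fourier_coef f (u k) * chi (u k * x).

End FourierSeries.

(* Main.v *)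
Require Import Defs.
From mathcomp Require Import all_boot all_order all_algebra.
From mathcomp Require Import finfield.
From mathcomp Require Import complex.
From mathcomp Require Import ring lra.
From mathcomp Require Import all_classical all_reals all_analysis.
From mathcomp Require Import measurable_realfun.

Set Implicit Arguments.
Unset Strict Implicit.
Unset Printing Implicit Defensive.

Import Order.TTheory GRing.Theory Num.Theory.
Import numFieldNormedType.Exports.

Local Open Scope classical_set_scope.
Local Open Scope ring_scope.

(** The proof goes round the cycle formed by the ball condition, the norm bound
    and the norm convergence.

    On the ring of integers [D] the partial sums of length [q ^ j] are the
    averages over the balls of radius [q ^- j] ([fourier_sum_average]), so the
    whole problem lives on the [q]-ary tree of balls in [D], where an integrable
    function is a martingale of averages.  For a general length [n] one modulates
    by the character of frequency [u n]: a frequency below [n] then differs from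
    [0] first at some highest digit, and so it is a character that is constant on
    the children of a ball and has mean zero over the ball.  It only sees the
    oscillation of the averages, and the bilinear form of [S n] is at most a
    constant times the sum over all balls of the product of two mean oscillations
    ([fourier_sum_osc]).

    The ball condition implies the norm bound because this oscillation form obeys
    a weighted estimate on any homogeneous tree ([osc_form_weighted]).  One stops
    at the balls on which the average of one of the two functions has quadrupled.
    Between stopping balls the averages are essentially constant and a quadratic
    potential pays for the oscillation ([osc_form_le_stop_sum]); a stopping ball
    keeps at least half of its measure outside the stopping balls below it, so by
    the ball condition it also keeps a fixed part of its weight ([unstopped_Ap]),
    and the Carleson embedding ([stop_sum_carleson]) sums what is left.  A duality
    argument that absorbs a term gives the norm bound ([fourier_sum_weighted]).

    The norm bound implies convergence because the averages of an integrable
    function converge to it in [L ^ 1] ([cond_exp_cvg]), hence in the weighted norm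
    for bounded functions, and because [S n] fixes [S m f] for [m <= n]
    ([fourier_sum_sum]).

    For the converse there are two cases.  If the residue characteristic is
    nonzero in [K], the coset representatives generate a dense subgroup, so a
    periodic weight is constant ([ball_invariant_dense], [invariant_muckenhoupt]).
    Otherwise the representatives form a group and every function on [D] has a
    periodic extension; convergence makes the orbit [S n f] of each [f] bounded,
    and a gliding hump made of positive functions contradicts this unless the
    averages alone obey the ball condition ([trunc_bounded]).  By periodicity it is
    enough to look at balls inside [D] ([average_cball]). *)

(** * Powers and means *)

Section RealPowers.
Variable R : realType.
Implicit Types (p x s r v C : R).

Lemma powR_mulB x p q : 0 < x -> x `^ p * x `^ q = x `^ (p + q).
Proof. by move=> x0; rewrite powRD // (gt_eqF x0) implybT. Qed.

Lemma ler_powRl r x y : 0 <= r -> 0 <= x -> x <= y -> x `^ r <= y `^ r.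
Proof.
move=> r0 x0 xy; apply: ge0_ler_powR; rewrite ?nnegrE//; exact: le_trans xy.
Qed.

(** Young's inequality in the form of a tangent plane: the right-hand side is
    convex and homogeneous of degree one in [(x, s)], and the left-hand side is
    its linearization at a point where [x / s = r]. *)
Lemma powR_tangent p x s r : 1 < p -> 0 <= x -> 0 < s -> 0 <= r ->
  p * (r `^ (p - 1) * x) - (p - 1) * (r `^ p * s) <= x `^ p * s `^ (1 - p).
Proof.
move=> p1 x0 s0 r0.
have p0 : 0 < p by lra.
have pp0 : 0 < p - 1 by lra.
pose q := p / (p - 1).
have q0 : 0 < q by rewrite divr_gt0.
have pq : p^-1 + q^-1 = 1 by rewrite /q; field; rewrite !gt_eqF.
have := @conjugate_powR R (x * s `^ (- q^-1)) (r `^ (p - 1) * s `^ q^-1) p q.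
rewrite !mulr_ge0 ?powR_ge0// => /(_ isT isT p0 q0 pq).
have -> : x * s `^ (- q^-1) * (r `^ (p - 1) * s `^ q^-1) = r `^ (p - 1) * x.
  rewrite powRN; have : s `^ q^-1 != 0 by rewrite gt_eqF// powR_gt0.
  by move=> ?; field.
rewrite !powRM ?powR_ge0// -!powRrM.
have -> : - q^-1 * p = 1 - p by rewrite /q; field; rewrite !gt_eqF.
have -> : (p - 1) * q = p by rewrite /q; field; rewrite !gt_eqF.
rewrite mulVf ?gt_eqF// powRr1 ?(ltW s0)//.
have -> : q^-1 = (p - 1) / p by rewrite /q invf_div.
move=> H.
have {}H : p * (r `^ (p - 1) * x) <= p * (x `^ p * s `^ (1 - p) / p +
   r `^ p * s * ((p - 1) / p)) by rewrite ler_pM2l.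
move: H; set A := x `^ p * _; set B := r `^ p * s.
have -> : p * (A / p + B * ((p - 1) / p)) = A + (p - 1) * B.
  by field; rewrite gt_eqF.
by rewrite lerBlDr.
Qed.

(** With [r := x / s] the two terms on the left of [powR_tangent] are multiples
    of the same number, which [powR_homog] identifies with its right-hand side. *)
Lemma powR_slope p x s : 1 < p -> 0 <= x -> 0 < s ->
  (x / s) `^ (p - 1) * x = (x / s) `^ p * s.
Proof.
move=> p1 x0 s0; have [->|xn0] := eqVneq x 0.
  by rewrite mulr0 mul0r powR0 ?mul0r// gt_eqF//; lra.
have xs : 0 < x / s by rewrite divr_gt0// lt_neqAle eq_sym xn0.
have <- : (x / s) `^ (p - 1) * (x / s) `^ 1 = (x / s) `^ p.
  by rewrite powR_mulB//; congr (_ `^ _); ring.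
by rewrite powRr1 ?ltW// -mulrA divfK// gt_eqF.
Qed.

Lemma powR_homog p x s : 1 < p -> 0 <= x -> 0 < s ->
  (x / s) `^ p * s = x `^ p * s `^ (1 - p).
Proof.
move=> p1 x0 s0; rewrite powRM ?invr_ge0 ?(ltW s0)//.
rewrite -mulrA; congr (_ * _).
by rewrite -powR_inv1 ?(ltW s0)// -powRrM -{2}(powRr1 (ltW s0)) powR_mulB//;
  congr (_ `^ _); ring.
Qed.

End RealPowers.

Section Mean.
Variables (R : realType) (I : finType) (i0 : I).
Implicit Types (f g : I -> R).

Definition mean f := #|I|%:R^-1 * \sum_i f i.

Lemma card_gt0R : 0 < #|I|%:R :> R.
Proof. by rewrite ltr0n; apply/card_gt0P; exists i0. Qed.

Lemma mean_ge0 f : (forall i, 0 <= f i) -> 0 <= mean f.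
Proof. by move=> f0; rewrite mulr_ge0 ?invr_ge0// sumr_ge0. Qed.

Lemma ler_mean f g : (forall i, f i <= g i) -> mean f <= mean g.
Proof. by move=> fg; rewrite ler_wpM2l ?invr_ge0// ler_sum. Qed.

Lemma eq_mean f g : (forall i, f i = g i) -> mean f = mean g.
Proof. by move=> fg; congr (_ * _); apply: eq_bigr. Qed.

Lemma meanD f g : mean (fun i => f i + g i) = mean f + mean g.
Proof. by rewrite /mean big_split mulrDr. Qed.

Lemma meanZ c f : mean (fun i => c * f i) = c * mean f.
Proof. by rewrite /mean -mulr_sumr mulrCA. Qed.

Lemma mean_cst c : mean (fun=> c) = c.
Proof.
by rewrite /mean sumr_const cardT -cardE -(mulr_natl c) mulKf ?gt_eqF ?card_gt0R.
Qed.

Lemma meanB f g : mean (fun i => f i - g i) = mean f - mean g.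
Proof.
rewrite -(mulN1r (mean g)) -meanZ -meanD.
by apply: eq_mean => i; rewrite mulN1r.
Qed.

Lemma ler_mean_card f i : (forall i, 0 <= f i) -> f i <= #|I|%:R * mean f.
Proof.
move=> f0; rewrite /mean mulVKf ?gt_eqF ?card_gt0R// (bigD1 i)//= lerDl.
by rewrite sumr_ge0.
Qed.

(** The variance dominates the square of the mean deviation; for a martingale it
    is the gain of the second moment at one step. *)
Lemma mean_variance f :
  mean (fun i => `|f i - mean f|) ^+ 2 <= mean (fun i => f i ^+ 2) - mean f ^+ 2.
Proof.
set m := mean f; set d := fun i => `|f i - m|.
have -> : mean (fun i => f i ^+ 2) - m ^+ 2 = mean (fun i => d i ^+ 2).
  transitivity (mean (fun i => f i ^+ 2 - 2 * m * f i + m ^+ 2)).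
    by rewrite meanD meanB meanZ mean_cst -/m; ring.
  by apply: eq_mean => i; rewrite /d real_normK ?num_real//; ring.
rewrite -subr_ge0.
have -> : mean (fun i => d i ^+ 2) - mean d ^+ 2 = mean (fun i => (d i - mean d) ^+ 2).
  transitivity (mean (fun i => d i ^+ 2 - 2 * mean d * d i + mean d ^+ 2)).
    by rewrite meanD meanB meanZ mean_cst; ring.
  by apply: eq_mean => i; ring.
by apply: mean_ge0 => i; rewrite sqr_ge0.
Qed.

End Mean.

(** * Oscillations and stopping times on a homogeneous tree *)

Section Tree.
Variables (R : realType) (I : finType) (i0 : I) (N : Type) (ch : N -> I -> N).
Variable ok : N -> Prop.
Hypothesis ok_ch : forall Q i, ok Q -> ok (ch Q i).
Implicit Types (f g h : N -> R) (Q : N) (s : R * R) (n : nat).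

Local Notation mean := (@mean R I).

Definition martingale f := forall Q, ok Q -> f Q = mean (fun i => f (ch Q i)).

Definition osc f Q := mean (fun i => `|f (ch Q i) - f Q|).

Fixpoint osc_form n g h Q : R :=
  if n is m.+1 then osc g Q * osc h Q + mean (fun i => osc_form m g h (ch Q i))
  else 0.

Fixpoint level_mean j f Q : R :=
  if j is k.+1 then mean (fun i => level_mean k f (ch Q i)) else f Q.

Lemma osc_form_level_mean n g h Q :
  osc_form n g h Q = \sum_(j < n) level_mean j (fun P => osc g P * osc h P) Q.
Proof.
elim: n Q => [|n IH] Q; first by rewrite big_ord0.
rewrite big_ord_recl /=; congr (_ + _); under eq_mean do rewrite IH.
by rewrite /mean exchange_big /= mulr_sumr.
Qed.

Lemma level_meanD j f g Q :
  level_mean j (fun P => f P + g P) Q = level_mean j f Q + level_mean j g Q.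
Proof.
elim: j Q => [|j IH] Q //=; rewrite -meanD.
by apply: eq_mean => i; exact: IH.
Qed.

Lemma level_meanZ k j f Q : level_mean j (fun P => k * f P) Q = k * level_mean j f Q.
Proof.
elim: j Q => [|j IH] Q //=; rewrite -meanZ.
by apply: eq_mean => i; exact: IH.
Qed.

Section Stopping.
Variables G H : N -> R.
Hypotheses (Gmart : martingale G) (Hmart : martingale H).
Hypotheses (G0 : forall Q, ok Q -> 0 <= G Q) (H0 : forall Q, ok Q -> 0 <= H Q).

(** The state [s] holds the values of [G] and [H] at the last stopping node. *)
Definition stops s Q := (4 * s.1 < G Q) || (4 * s.2 < H Q).

Definition next s Q := if stops s Q then (G Q, H Q) else s.

(** The charge [c] of a stopping node may depend on the depth [n] of the tree
    that is left below it. *)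
Fixpoint stop_sum (c : nat -> N -> R) n s Q : R :=
  (if stops s Q then c n Q else 0) +
  (if n is m.+1 then mean (fun i => stop_sum c m (next s Q) (ch Q i)) else 0).

(** The part of the average of [f] over the leaves at depth [n] that no stopping
    node separates from [Q], the node [Q] included. *)
Fixpoint unstopped (f : N -> R) n s Q : R :=
  if stops s Q then 0
  else if n is m.+1 then mean (fun i => unstopped f m s (ch Q i)) else f Q.

Lemma stops_self Q : ok Q -> stops (G Q, H Q) Q = false.
Proof.
move=> okQ; apply/negbTE; rewrite /stops negb_or /= -!leNgt.
by have := G0 okQ; have := H0 okQ; lra.
Qed.

Lemma stop_sum_le c d n s Q : (forall m P, ok P -> c m P <= d m P) -> ok Q ->
  stop_sum c n s Q <= stop_sum d n s Q.
Proof.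
move=> cd; elim: n s Q => [|n IH] s Q okQ /=.
  by rewrite lerD//; case: ifP => // _; exact: cd.
rewrite lerD//; first by case: ifP => // _; exact: cd.
by apply: ler_mean => i; apply: IH; exact: ok_ch.
Qed.

Lemma stop_sumD c d n s Q :
  stop_sum (fun m P => c m P + d m P) n s Q = stop_sum c n s Q + stop_sum d n s Q.
Proof.
elim: n s Q => [|n IH] s Q /=; first by case: ifP => _; rewrite ?addr0.
under eq_mean do rewrite IH.
by rewrite meanD; case: ifP => _; ring.
Qed.

Lemma stop_sumZ k c n s Q :
  stop_sum (fun m P => k * c m P) n s Q = k * stop_sum c n s Q.
Proof.
elim: n s Q => [|n IH] s Q /=; first by case: ifP => _; rewrite ?addr0 ?mulr0.
under eq_mean do rewrite IH.
by rewrite meanZ; case: ifP => _; ring.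
Qed.

Lemma stop_sum_ge0 c n s Q : (forall m P, ok P -> 0 <= c m P) -> ok Q ->
  0 <= stop_sum c n s Q.
Proof.
move=> c0; elim: n s Q => [|n IH] s Q okQ /=.
  by rewrite addr_ge0//; case: ifP => // _; exact: c0.
rewrite addr_ge0//; first by case: ifP => // _; exact: c0.
by apply: mean_ge0 => i; apply: IH; exact: ok_ch.
Qed.

Lemma unstopped_le f g n s Q : (forall P, ok P -> f P <= g P) -> ok Q ->
  unstopped f n s Q <= unstopped g n s Q.
Proof.
move=> fg; elim: n Q => [|n IH] Q okQ /=; case: ifP => // _; first exact: fg.
by apply: ler_mean => i; apply: IH; exact: ok_ch.
Qed.

Lemma unstopped_ge0 f n s Q : (forall P, ok P -> 0 <= f P) -> ok Q ->
  0 <= unstopped f n s Q.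
Proof.
move=> f0; elim: n Q => [|n IH] Q okQ /=; case: ifP => // _; first exact: f0.
by apply: mean_ge0 => i; apply: IH; exact: ok_ch.
Qed.

Lemma unstopped_lin k l f g n s Q :
  unstopped (fun P => k * f P + l * g P) n s Q =
  k * unstopped f n s Q + l * unstopped g n s Q.
Proof.
elim: n Q => [|n IH] Q /=; case: ifP => _; rewrite ?mulr0 ?addr0//.
under eq_mean do rewrite IH.
by rewrite meanD !meanZ.
Qed.

Lemma unstopped_le_mart f n s Q : martingale f -> (forall P, ok P -> 0 <= f P) ->
  ok Q -> unstopped f n s Q <= f Q.
Proof.
move=> fm f0; elim: n Q => [|n IH] Q okQ /=; case: ifP => // _; try exact: f0.
by rewrite fm//; apply: ler_mean => i; apply: IH; exact: ok_ch.
Qed.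

(** Every leaf is charged to the last stopping node above it. *)
Lemma stop_sum_unstopped f n s Q : martingale f -> ok Q ->
  stop_sum (fun m P => unstopped f m (G P, H P) P) n s Q + unstopped f n s Q
  = f Q.
Proof.
move=> fm; elim: n s Q => [|n IH] s Q okQ.
  by rewrite /= stops_self//; case: ifP => _; rewrite ?addr0 ?add0r.
rewrite [unstopped _ _ s _]/= [stop_sum _ _ _ _]/= /next; case: ifP => st.
  rewrite stops_self// addr0 -meanD fm//.
  by apply: eq_mean => i; rewrite addrC; apply: IH; exact: ok_ch.
rewrite add0r -meanD fm//.
by apply: eq_mean => i; apply: IH; exact: ok_ch.
Qed.

(** At most half of a stopping node is covered by the stopping nodes below it:
    one of [G], [H] has grown by a factor [4] on each of these. *)
Lemma unstopped_half n Q : ok Q -> 2^-1 <= unstopped (fun=> 1) n (G Q, H Q) Q.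
Proof.
move=> okQ; set a := G Q; set b := H Q.
have a0 : 0 <= a by exact: G0.
have b0 : 0 <= b by exact: H0.
have le0 P : ok P -> (a = 0 -> G P = 0) -> (b = 0 -> H P = 0) ->
    stops (a, b) P -> 1 - G P / (4 * a) - H P / (4 * b) <= 0.
  move=> okP aP bP.
  have Ga : 0 <= G P / (4 * a) by rewrite divr_ge0 ?G0 ?mulr_ge0.
  have Hb : 0 <= H P / (4 * b) by rewrite divr_ge0 ?H0 ?mulr_ge0.
  case/orP => /= st.
    have a1 : 0 < 4 * a.
      have [az|an] := eqVneq a 0; first by move: st; rewrite aP// az; lra.
      by rewrite mulr_gt0// lt_neqAle eq_sym an.
    suff : 1 <= G P / (4 * a) by lra.
    by rewrite ler_pdivlMr// mul1r ltW.
  have b1 : 0 < 4 * b.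
    have [bz|bn] := eqVneq b 0; first by move: st; rewrite bP// bz; lra.
    by rewrite mulr_gt0// lt_neqAle eq_sym bn.
  suff : 1 <= H P / (4 * b) by lra.
  by rewrite ler_pdivlMr// mul1r ltW.
have zero f P i : martingale f -> (forall P', ok P' -> 0 <= f P') -> ok P ->
    f P = 0 -> f (ch P i) = 0.
  move=> fm f0 okP fP; have okc := ok_ch i okP.
  apply/eqP; rewrite eq_le f0// andbT.
  have := @ler_mean_card R I i0 (fun i => f (ch P i)) i
    (fun j => f0 _ (ok_ch j okP)).
  by rewrite -fm// fP mulr0.
have key : forall m P, ok P -> (a = 0 -> G P = 0) -> (b = 0 -> H P = 0) ->
    1 - G P / (4 * a) - H P / (4 * b) <= unstopped (fun=> 1) m (a, b) P.
  move=> m; elim: m => [|m IH] P okP aP bP /=; case: ifP => [|_]; try exact: le0.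
    have : 0 <= G P / (4 * a) by rewrite divr_ge0 ?G0 ?mulr_ge0.
    have : 0 <= H P / (4 * b) by rewrite divr_ge0 ?H0 ?mulr_ge0.
    by lra.
  have -> : 1 - G P / (4 * a) - H P / (4 * b) =
      mean (fun i => 1 - (4 * a)^-1 * G (ch P i) - (4 * b)^-1 * H (ch P i)).
    by rewrite !meanB mean_cst// !meanZ -Gmart// -Hmart// ![_^-1 * _]mulrC.
  apply: ler_mean => i; rewrite ![(4 * _)^-1 * _]mulrC.
  by apply: IH; [exact: ok_ch|move=> /aP; exact: zero|move=> /bP; exact: zero].
have quarter (x : R) : x / (4 * x) <= 4^-1.
  have [->|x0] := eqVneq x 0; first by rewrite mul0r invr_ge0.
  by rewrite invfM mulrCA mulfV// mulr1.
by have := key n Q okQ id id; have := quarter a; have := quarter b; rewrite -/a -/b; lra.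
Qed.

(** The unstopped part carries the bulk of the oscillation: there both averages
    stay within a bounded factor of their values at the stopping node, so the
    quadratic potential [phi] pays for it. *)
Lemma osc_form_le_stop_sum g h n Q : martingale g -> martingale h ->
  (forall P, ok P -> `|g P| <= G P) -> (forall P, ok P -> `|h P| <= H P) -> ok Q ->
  osc_form n g h Q <=
    (4 * #|I|%:R) ^+ 2 * stop_sum (fun _ P => G P * H P) n (-1, -1) Q.
Proof.
move=> gm hm gG hH okQ; set K : R := (4 * #|I|%:R) ^+ 2.
set q : R := #|I|%:R; pose c (m : nat) P := G P * H P.
have q1 : 1 <= q by rewrite ler1n; apply/card_gt0P; exists i0.
pose phi a b P := 2^-1 * (b / a * g P ^+ 2 + a / b * h P ^+ 2).
have phi0 (a b : R) P : 0 <= a -> 0 <= b -> 0 <= phi a b P.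
  move=> a0 b0; rewrite mulr_ge0 ?invr_ge0// addr_ge0// mulr_ge0 ?sqr_ge0//;
    exact: divr_ge0.
have small F P (x : R) i : martingale F -> (forall P', ok P' -> 0 <= F P') ->
    ok P -> F P <= x -> F (ch P i) <= q * x.
  move=> Fm F0 okP FP.
  have := @ler_mean_card R I i0 (fun i => F (ch P i)) i (fun j => F0 _ (ok_ch j okP)).
  by move=> /le_trans; apply; rewrite -Fm// ler_wpM2l// ler0n.
have phiK (a b : R) P : 0 <= a -> 0 <= b -> ok P -> G P <= 4 * q * a ->
    H P <= 4 * q * b -> phi a b P <= K * (a * b).
  move=> a0 b0 okP Ga Hb.
  have sq (y F x : R) : 0 <= x -> `|y| <= F -> F <= 4 * q * x ->
      y ^+ 2 <= K * x ^+ 2.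
    move=> x0 fF Fx; rewrite -exprMn -(real_normK (num_real y)).
    by rewrite lerXn2r ?nnegrE ?mulr_ge0//; exact: le_trans Fx.
  have part (x y z F : R) : 0 <= x -> 0 <= y -> `|z| <= F -> F <= 4 * q * x ->
      y / x * z ^+ 2 <= K * (x * y).
    move=> x0 y0 fF Fx; have [xz|xn] := eqVneq x 0.
      by rewrite xz invr0 mulr0 mul0r mul0r mulr0.
    apply: (@le_trans _ _ (y / x * (K * x ^+ 2))).
      by rewrite ler_wpM2l ?divr_ge0//; exact: sq fF Fx.
    by rewrite le_eqVlt; apply/orP; left; apply/eqP; field.
  have := part a b (g P) (G P) a0 b0 (gG P okP) Ga.
  have := part b a (h P) (H P) b0 a0 (hH P okP) Hb.
  by rewrite /phi (mulrC b a); lra.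
have step (a b : R) P : 0 <= a -> 0 <= b -> ok P -> G P <= 4 * a -> H P <= 4 * b ->
    osc g P * osc h P + phi a b P <= mean (fun i => phi a b (ch P i)).
  move=> a0 b0 okP Ga Hb.
  have V f : martingale f -> osc f P ^+ 2 + f P ^+ 2 <= mean (fun i => f (ch P i) ^+ 2).
    by move=> fm; have := mean_variance i0 (fun i => f (ch P i)); rewrite -fm// /osc; lra.
  have -> : mean (fun i => phi a b (ch P i)) =
      2^-1 * (b / a * mean (fun i => g (ch P i) ^+ 2) +
              a / b * mean (fun i => h (ch P i) ^+ 2)).
    by rewrite meanZ meanD !meanZ.
  have W : osc g P * osc h P <=
      2^-1 * (b / a * osc g P ^+ 2 + a / b * osc h P ^+ 2).
    have osc0 f F (x : R) : martingale F -> (forall P', ok P' -> 0 <= F P') ->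
        (forall P', ok P' -> `|f P'| <= F P') -> F P <= 4 * x -> x = 0 -> osc f P = 0.
      move=> Fm F0 fF Fx x0; rewrite /osc.
      have z P' : ok P' -> F P' <= 0 -> f P' = 0.
        by move=> okP' FP'; apply/normr0_eq0/eqP; rewrite eq_le normr_ge0 andbT
          (le_trans (fF _ okP')).
      have FP0 : F P <= 0 by move: Fx; rewrite x0 mulr0.
      have zi i : f (ch P i) = 0.
        by apply: z; [exact: ok_ch|rewrite -(mulr0 q); exact: small].
      rewrite (eq_mean (g := fun=> 0)) ?mean_cst// => i.
      by rewrite zi z// subr0 normr0.
    have [az|an] := eqVneq a 0.
      by rewrite (osc0 g G a)// az !(mul0r, invr0, mulr0, expr0n, addr0).
    have [bz|bn] := eqVneq b 0.
      by rewrite (osc0 h H b)// bz !(mul0r, invr0, mulr0, expr0n, addr0).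
    rewrite -subr_ge0.
    have -> : 2^-1 * (b / a * osc g P ^+ 2 + a / b * osc h P ^+ 2) - osc g P * osc h P
        = (2 * a * b)^-1 * (b * osc g P - a * osc h P) ^+ 2 by field; apply/andP.
    by rewrite mulr_ge0 ?sqr_ge0// invr_ge0 !mulr_ge0.
  have Vg := ler_wpM2l (divr_ge0 b0 a0) (V _ gm).
  have Vh := ler_wpM2l (divr_ge0 a0 b0) (V _ hm).
  by move: W Vg Vh; rewrite /phi; lra.
(* the averages at [P] are at most four times the state, so one level of
   oscillation is paid by the increase of the potential *)
have descend m (a b : R) P : 0 <= a -> 0 <= b -> ok P -> G P <= 4 * a -> H P <= 4 * b ->
    (forall i, osc_form m g h (ch P i) + phi a b (ch P i) <=
       K * stop_sum c m (a, b) (ch P i) + K * (a * b)) ->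
    osc_form m.+1 g h P + phi a b P <=
      K * mean (fun i => stop_sum c m (a, b) (ch P i)) + K * (a * b).
  move=> a0 b0 okP Ga Hb IH.
  have -> : K * mean (fun i => stop_sum c m (a, b) (ch P i)) + K * (a * b) =
      mean (fun i => K * stop_sum c m (a, b) (ch P i) + K * (a * b)).
    by rewrite meanD meanZ (mean_cst i0).
  apply: le_trans (ler_mean IH); rewrite meanD /= addrAC addrC lerD2l.
  exact: step.
have weak (F : N -> R) P : (forall P', ok P' -> 0 <= F P') -> ok P ->
    q * F P <= 4 * q * F P.
  move=> F0 okP; rewrite -subr_ge0 (_ : _ - _ = 3 * (q * F P)); last by ring.
  by rewrite !mulr_ge0 ?F0.
have K1 : 1 <= K by rewrite /K expr_ge1//; lra.
have main m (a b : R) P : 0 <= a -> 0 <= b -> ok P -> G P <= 4 * q * a ->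
    H P <= 4 * q * b ->
    osc_form m g h P + phi a b P <= K * stop_sum c m (a, b) P + K * (a * b).
  elim: m a b P => [|m IH] a b P a0 b0 okP Ga Hb.
    rewrite /= add0r addr0 (le_trans (phiK _ _ _ a0 b0 okP Ga Hb))// lerDr.
    by rewrite mulr_ge0 ?(le_trans _ K1)//; case: ifP => _//; rewrite mulr_ge0 ?G0 ?H0.
  rewrite [stop_sum _ _ _ _]/= /next; case: ifP => st.
    have := descend m (G P) (H P) P (G0 okP) (H0 okP) okP.
    have -> : G P <= 4 * G P by have := G0 okP; lra.
    have -> : H P <= 4 * H P by have := H0 okP; lra.
    move=> /(_ isT isT) D.
    have {}D : osc_form m.+1 g h P + phi (G P) (H P) P <= K * c m P +
        K * mean (fun i => stop_sum c m (G P, H P) (ch P i)).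
      rewrite [X in _ <= X]addrC; apply: D => i; apply: IH; rewrite ?G0 ?H0//; try exact: ok_ch.
        by apply: le_trans (small _ _ _ _ Gmart G0 okP (lexx _)) _; exact: weak.
      by apply: le_trans (small _ _ _ _ Hmart H0 okP (lexx _)) _; exact: weak.
    have := phiK _ _ _ a0 b0 okP Ga Hb; have := phi0 (G P) (H P) P (G0 okP) (H0 okP).
    by move: D; rewrite mulrDr; lra.
  move/negbT: st; rewrite /stops negb_or -!leNgt => /andP[/= Ga' Hb'].
  rewrite add0r; apply: descend => // i; apply: IH => //; first exact: ok_ch.
    by rewrite -mulrA mulrCA; exact: small.
  by rewrite -mulrA mulrCA; exact: small.
have G1 : G Q <= 4 * G Q by have := G0 okQ; lra.
have H1 : H Q <= 4 * H Q by have := H0 okQ; lra.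
have st : stops (-1, -1) Q.
  by apply/orP; left => /=; have := G0 okQ; lra.
have D m : osc_form m.+1 g h Q + phi (G Q) (H Q) Q <=
    K * stop_sum c m.+1 (-1, -1) Q.
  rewrite [stop_sum _ _ _ _]/= /next st mulrDr.
  rewrite [X in _ <= X]addrC; apply: descend; rewrite ?G0 ?H0// => i.
  apply: main; rewrite ?G0 ?H0//; try exact: ok_ch.
    by apply: le_trans (small _ _ _ _ Gmart G0 okQ (lexx _)) _; exact: weak.
  by apply: le_trans (small _ _ _ _ Hmart H0 okQ (lexx _)) _; exact: weak.
case: n => [|m].
  rewrite /= mulr_ge0// ?(le_trans _ K1)// addr0; case: ifP => // _.
  by rewrite mulr_ge0 ?G0 ?H0.
by have := D m; have := phi0 (G Q) (H Q) Q (G0 okQ) (H0 okQ); lra.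
Qed.

(** The unstopped part has at least half of the measure.  Where [v] is small the
    lower bound [1 <= v * u ^ r] makes [u] large, and [v] is large only on a set
    that its average limits; so [u] keeps a fixed part of its mass there. *)
Lemma unstopped_Ap v u r C n Q : 0 < r -> martingale v ->
  (forall P, ok P -> 0 < v P) -> (forall P, ok P -> 0 < u P) ->
  (forall P, ok P -> 1 <= v P * u P `^ r) -> v Q * u Q `^ r <= C -> ok Q ->
  4^-1 * (4 * C) `^ (- r^-1) * u Q <= unstopped u n (G Q, H Q) Q.
Proof.
move=> r0 vm v0 u0 lo hi okQ.
have vQ := v0 Q okQ; have uQ := u0 Q okQ.
pose k := (4 * v Q)^-1; pose mu := k `^ (- r^-1).
have k0 : 0 < k by rewrite invr_gt0 mulr_gt0.
have mu0 : 0 < mu by exact: powR_gt0.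
have leaf P : ok P -> 1 <= k * v P + mu * u P.
  move=> okP; have vP := v0 P okP; have uP := u0 P okP.
  have [kv|kv] := leP 1 (k * v P).
    by rewrite (le_trans kv)// lerDl mulr_ge0// ltW.
  have kv0 : 0 < k * v P by rewrite mulr_gt0.
  suff : 1 <= mu * u P by lra.
  have ku : k <= u P `^ r.
    rewrite -(ler_pM2r vP) (le_trans (ltW kv))// mulrC; exact: lo.
  rewrite /mu powRN mulrC ler_pdivlMr ?powR_gt0// mul1r.
  have -> : u P = (u P `^ r) `^ r^-1.
    by rewrite -powRrM mulfV ?gt_eqF// powRr1// ltW.
  by apply: ler_powRl (ltW k0) ku; rewrite invr_ge0 ltW.
have half : 2^-1 <= k * unstopped v n (G Q, H Q) Q + mu * unstopped u n (G Q, H Q) Q.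
  rewrite (le_trans (unstopped_half n okQ))// -unstopped_lin.
  exact: unstopped_le.
have quarter : k * unstopped v n (G Q, H Q) Q <= 4^-1.
  apply: (@le_trans _ _ (k * v Q)).
    by rewrite ler_wpM2l ?(ltW k0)//; apply: unstopped_le_mart => // P /v0/ltW.
  by rewrite /k invfM -mulrA mulVf ?mulr1// gt_eqF.
have {half quarter} : 4^-1 <= mu * unstopped u n (G Q, H Q) Q by lra.
rewrite mulrC -ler_pdivrMr// => /(le_trans _); apply.
rewrite -mulrA ler_wpM2l ?invr_ge0//.
have C0 : 0 < C by apply: lt_le_trans hi; rewrite mulr_gt0// powR_gt0.
have -> : mu^-1 = (4 * v Q) `^ (- r^-1).
  by rewrite /mu /k powRN invrK -powR_inv1 ?mulr_ge0 ?(ltW vQ)// -powRrM mulN1r.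
have -> : u Q = (u Q `^ - r) `^ (- r^-1).
  by rewrite -powRrM mulrNN mulfV ?gt_eqF// powRr1// ltW.
rewrite -powRM ?powR_ge0 ?mulr_ge0 ?(ltW C0)// !powRN lef_pV2 ?posrE; last 2 first.
- by rewrite powR_gt0// mulr_gt0// ?invr_gt0 ?powR_gt0// mulr_gt0.
- by rewrite powR_gt0// mulr_gt0.
apply: ler_powRl; rewrite ?invr_ge0 ?(ltW r0) ?mulr_ge0 ?(ltW vQ)//.
by rewrite -mulrA ler_pM2l// ler_pdivlMr// powR_gt0.
Qed.

(** Carleson embedding, by a Bellman function argument: [X ^ p / S ^ (p - 1)] is
    convex and homogeneous, so it decreases under averaging, and it gains when
    the mass [S] grows by the mass attached to a stopping node. *)
Lemma stop_sum_carleson p u X phi n s Q : 1 < p ->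
  martingale u -> martingale X -> martingale phi ->
  (forall P, ok P -> 0 < u P) -> (forall P, ok P -> 0 <= X P) ->
  (forall P, ok P -> X P `^ p <= phi P * u P `^ (p - 1)) -> ok Q ->
  (p - 1) / 2 `^ p *
    stop_sum (fun m P => unstopped u m (G P, H P) P * (X P / u P) `^ p) n s Q
  <= phi Q.
Proof.
move=> p1 um Xm phim u0 X0 Xphi.
have u0' P : ok P -> 0 <= u P by move=> /u0/ltW.
pose cu m P := unstopped u m (G P, H P) P.
pose M m st P := u P + stop_sum cu m st P.
have cu0 m P : ok P -> 0 <= cu m P by move=> okP; exact: unstopped_ge0.
have M0 m st P : ok P -> 0 < M m st P.
  by move=> okP; rewrite ltr_pwDl ?u0 ?stop_sum_ge0.
have M2 m st P : ok P -> M m st P <= 2 * u P.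
  move=> okP; have := stop_sum_unstopped m st um okP.
  have := @unstopped_ge0 u m st P u0' okP.
  by rewrite /M -/cu; lra.
have c0 : 0 <= (p - 1) / 2 `^ p by rewrite divr_ge0 ?powR_ge0//; lra.
(* the tangent inequality, with room for the mass [d] of the node itself *)
have gain P (a d : R) : ok P -> 0 < a + d -> a + d <= 2 * u P -> 0 <= d ->
    (p - 1) / 2 `^ p * (d * (X P / u P) `^ p) + X P `^ p * (a + d) `^ (1 - p) <=
    p * ((X P / (a + d)) `^ (p - 1) * X P) - (p - 1) * ((X P / (a + d)) `^ p * a).
  move=> okP ad ad2 d0; have XP := X0 P okP; have uP := u0 P okP.
  rewrite powR_slope//; rewrite -(powR_homog p1 XP ad).
  set r := X P / (a + d).
  suff rd : (X P / u P) `^ p / 2 `^ p * d <= r `^ p * d.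
    have p1' : 0 <= p - 1 by lra.
    have := ler_wpM2l p1' rd; set Y := _ `^ p; set Z := 2 `^ p; set W := r `^ p.
    rewrite -subr_ge0 => {}rd; rewrite -subr_ge0; move: rd.
    by congr (0 <= _); ring.
  rewrite ler_wpM2r// ler_pdivrMr ?powR_gt0// -powRM ?divr_ge0// ?(ltW ad)//.
  apply: ler_powRl; rewrite ?divr_ge0 ?(ltW uP)//; first lra.
  rewrite /r -mulrA ler_wpM2l// mulrC ler_pdivlMr// mulrC ler_pdivrMr//.
have tangent P (a : R) (r : R) : ok P -> 0 < a -> 0 <= r ->
    p * (r `^ (p - 1) * X P) - (p - 1) * (r `^ p * a) <= X P `^ p * a `^ (1 - p).
  by move=> okP a0 r0; apply: powR_tangent => //; exact: X0.
have leafE P : ok P -> X P `^ p * u P `^ (1 - p) <= phi P.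
  move=> okP; rewrite -opprB powRN ler_pdivrMr ?powR_gt0 ?u0//; exact: Xphi.
(* [d] is the mass attached to the node when it stops *)
pose d m st P := if stops st P then cu m P else 0.
have d0 m st P : ok P -> 0 <= d m st P by rewrite /d; case: ifP => // _; exact: cu0.
suff main m st P : ok P -> (p - 1) / 2 `^ p *
    stop_sum (fun m P => cu m P * (X P / u P) `^ p) m st P +
    X P `^ p * M m st P `^ (1 - p) <= phi P.
  move=> okQ; apply: le_trans (main n s Q okQ); rewrite lerDl.
  by rewrite mulr_ge0 ?powR_ge0.
elim: m st P => [|m IH] st P okP.
  have := gain P (u P) (d 0 st P) okP.
  have -> : u P + d 0 st P = M 0 st P by rewrite /M /= addr0.
  rewrite M0// M2// d0// => /(_ isT isT isT) Hg.
  rewrite /= addr0; apply: le_trans (leafE P okP).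
  apply: le_trans (tangent P (u P) (X P / M 0 st P) okP (u0 P okP) _); last first.
    by rewrite divr_ge0 ?X0// ltW// M0.
  apply: le_trans Hg; rewrite lerD2r ler_wpM2l// /d.
  by case: ifP => _; rewrite ?mul0r.
pose st' := next st P.
pose a := mean (fun i => M m st' (ch P i)).
have aE : a + d m.+1 st P = M m.+1 st P.
  by rewrite /a /M meanD -um//= /d; case: ifP => _; rewrite ?addr0 ?add0r// -/cu; ring.
have := gain P a (d m.+1 st P) okP; rewrite aE M0// M2// d0// => /(_ isT isT isT).
set r := X P / M m.+1 st P => Hg.
have r0 : 0 <= r by rewrite divr_ge0 ?X0// ltW// M0.
have T : p * (r `^ (p - 1) * X P) - (p - 1) * (r `^ p * a) <=
    mean (fun i => X (ch P i) `^ p * M m st' (ch P i) `^ (1 - p)).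
  rewrite Xm// /a -!meanZ -meanB; apply: ler_mean => i.
  by apply: tangent => //; [exact: ok_ch|apply: M0; exact: ok_ch].
rewrite phim//; apply: le_trans (ler_mean (fun i => IH st' (ch P i) (ok_ch i okP))).
rewrite meanD meanZ [stop_sum _ m.+1 _ _]/= mulrDr -/st' addrAC addrC lerD2l.
apply: le_trans T; apply: le_trans Hg; rewrite lerD2r /d.
by case: ifP => _; rewrite ?mul0r.
Qed.

End Stopping.

(** The inverse constants of [unstopped_Ap], for [r = p - 1], and of
    [stop_sum_carleson]. *)
Definition Ap_stop_cst (p C : R) :=
  4 * (4 * C) `^ (p - 1)^-1 * (2 `^ p / (p - 1)).

Lemma Ap_stop_cst_ge0 p C : 1 < p -> 0 <= Ap_stop_cst p C.
Proof.
move=> p1; rewrite !mulr_ge0 ?powR_ge0// invr_ge0; lra.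
Qed.

(** By [unstopped_Ap] the mass [u] of a stopping node is comparable to its
    unstopped part, to which the Carleson embedding applies. *)
Lemma stop_sum_weight p C G H v u X phi n s Q : 1 < p ->
  martingale G -> martingale H ->
  (forall P, ok P -> 0 <= G P) -> (forall P, ok P -> 0 <= H P) ->
  martingale v -> martingale u -> martingale X -> martingale phi ->
  (forall P, ok P -> 0 < v P) -> (forall P, ok P -> 0 < u P) ->
  (forall P, ok P -> 0 <= X P) ->
  (forall P, ok P -> 1 <= v P * u P `^ (p - 1) <= C) ->
  (forall P, ok P -> X P `^ p <= phi P * u P `^ (p - 1)) -> ok Q ->
  stop_sum G H (fun _ P => u P * (X P / u P) `^ p) n s Q <= Ap_stop_cst p C * phi Q.
Proof.
move=> p1 Gm Hm G0 H0 vm um Xm phim v0 u0 X0 Ap Xphi okQ.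
have p1' : 0 < p - 1 by lra.
have C0 : 0 < C.
  by have /andP[/(lt_le_trans ltr01)/lt_le_trans] := Ap Q okQ; exact.
have C4 : 0 < (4 * C) `^ (p - 1)^-1 by rewrite powR_gt0// mulr_gt0.
have le m P : ok P -> u P * (X P / u P) `^ p <= 4 * (4 * C) `^ (p - 1)^-1 *
    (unstopped G H u m (G P, H P) P * (X P / u P) `^ p).
  move=> okP; rewrite mulrA ler_wpM2r ?powR_ge0//.
  have := unstopped_Ap Gm Hm G0 H0 m p1' vm v0 u0
    (fun P okP => proj1 (andP (Ap P okP))) (proj2 (andP (Ap P okP))) okP.
  rewrite powRN -mulrA -!ler_pdivlMl ?invr_gt0//.
  by rewrite !invrK => h; rewrite -mulrA mulrCA.
apply: le_trans (stop_sum_le _ _ _ _ le okQ) _.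
rewrite stop_sumZ /Ap_stop_cst -[X in _ <= X]mulrA ler_wpM2l ?mulr_ge0 ?(ltW C4)//.
rewrite -ler_pdivrMl ?divr_gt0 ?powR_gt0// invf_div.
exact: stop_sum_carleson.
Qed.

(** To be used with [w] and [u] the averages of a weight and of its dual weight,
    and with [G], [H], [phi] and [psi] those of [|g|], [|h|], [|g| ^ p * w] and
    [|h| ^ p' * u].  By the bound [C] and by Young's inequality the product
    [G * H] at a stopping node splits into one term for each of the two weights,
    and the situation is symmetric in them. *)
Theorem osc_form_weighted p C g h G H w u phi psi n Q : 1 < p ->
  let p' := p / (p - 1) in
  martingale g -> martingale h -> martingale G -> martingale H ->
  martingale w -> martingale u -> martingale phi -> martingale psi ->
  (forall P, ok P -> `|g P| <= G P) -> (forall P, ok P -> `|h P| <= H P) ->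
  (forall P, ok P -> 0 < w P) -> (forall P, ok P -> 0 < u P) ->
  (forall P, ok P -> 1 <= w P * u P `^ (p - 1) <= C) ->
  (forall P, ok P -> G P `^ p <= phi P * u P `^ (p - 1)) ->
  (forall P, ok P -> H P `^ p' <= psi P * w P `^ (p' - 1)) -> ok Q ->
  osc_form n g h Q <= (4 * #|I|%:R) ^+ 2 * (C `^ p^-1 *
    (Ap_stop_cst p C * phi Q + Ap_stop_cst p' (C `^ (p' - 1)) * psi Q)).
Proof.
move=> p1 p' gm hm Gm Hm wm um phim psim gG hH w0 u0 Ap Gphi Hpsi okQ.
have p10 : 0 < p - 1 by lra.
have pn0 : p != 0 by rewrite gt_eqF//; lra.
have p1n0 : p - 1 != 0 by rewrite gt_eqF.
have p'1E : p' - 1 = (p - 1)^-1 by rewrite /p'; field.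
have p'1 : 1 < p' by rewrite -subr_gt0 p'1E invr_gt0.
have p'0 : 0 < p' by lra.
have pp' : p^-1 + p'^-1 = 1.
  by rewrite /p'; field; rewrite ?pn0 ?p1n0.
have G0 P : ok P -> 0 <= G P by move=> /gG; apply: le_trans.
have H0 P : ok P -> 0 <= H P by move=> /hH; apply: le_trans.
apply: le_trans (osc_form_le_stop_sum Gm Hm G0 H0 _ gm hm gG hH okQ) _.
rewrite ler_wpM2l ?sqr_ge0//.
have C0 : 0 < C.
  by have /andP[/(lt_le_trans ltr01)/lt_le_trans] := Ap Q okQ; exact.
have node P : ok P -> G P * H P <= C `^ p^-1 *
    (u P * (G P / u P) `^ p + w P * (H P / w P) `^ p').
  move=> okP; have uP := u0 P okP; have wP := w0 P okP.
  set x := G P / u P; set y := H P / w P.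
  have x0 : 0 <= x by rewrite divr_ge0 ?G0 ?ltW.
  have y0 : 0 <= y by rewrite divr_ge0 ?H0 ?ltW.
  have -> : G P * H P = (w P * u P `^ (p - 1)) `^ p^-1 *
      ((u P `^ p^-1 * x) * (w P `^ p'^-1 * y)).
    rewrite powRM ?powR_ge0 ?(ltW wP)// -powRrM.
    transitivity ((u P `^ ((p - 1) * p^-1) * u P `^ p^-1) * x *
        ((w P `^ p^-1 * w P `^ p'^-1) * y)); last by ring.
    rewrite !powR_mulB// pp'.
    have -> : (p - 1) * p^-1 + p^-1 = 1 by field.
    by rewrite !powRr1 ?ltW// /x /y ![_ * (_ / _)]mulrC !divfK ?gt_eqF.
  have ux : 0 <= u P `^ p^-1 * x by rewrite mulr_ge0 ?powR_ge0.
  have wy : 0 <= w P `^ p'^-1 * y by rewrite mulr_ge0 ?powR_ge0.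
  apply: ler_pM; [exact: powR_ge0|exact: mulr_ge0| |].
    have /andP[_ hi] := Ap P okP; apply: ler_powRl => //.
      by rewrite invr_ge0; lra.
    by rewrite mulr_ge0 ?powR_ge0 ?ltW.
  apply: le_trans (conjugate_powR ux wy _ p'0 pp') _; first lra.
  rewrite (powRM _ (powR_ge0 _ _) x0) (powRM _ (powR_ge0 _ _) y0) -!powRrM.
  rewrite !mulVf ?gt_eqF// ?powRr1 ?(ltW uP) ?(ltW wP)//; last lra.
  have div_le (z s : R) : 0 <= z -> 1 < s -> z / s <= z.
    by move=> z0 s1; rewrite ler_pdivrMr ?ler_peMr//; lra.
  by rewrite lerD// div_le// mulr_ge0 ?powR_ge0 ?ltW.
apply: le_trans (stop_sum_le _ _ _ _ (fun _ => node) okQ) _.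
rewrite stop_sumZ stop_sumD ler_wpM2l ?powR_ge0// lerD//.
  exact: (stop_sum_weight _ _ p1 Gm Hm G0 H0 wm um Gm).
apply: (stop_sum_weight _ _ p'1 Gm Hm G0 H0 um wm Hm) => // P okP.
have /andP[lo hi] := Ap P okP.
have -> : u P * w P `^ (p' - 1) = (w P * u P `^ (p - 1)) `^ (p' - 1).
  rewrite powRM ?powR_ge0 ?(ltW (w0 P okP))// -powRrM p'1E mulfV//.
  by rewrite powRr1 ?(ltW (u0 P okP))// mulrC.
apply/andP; split; last first.
  by apply: ler_powRl => //; [lra|exact: le_trans lo].
have := @ler_powRl _ (p' - 1) _ _ _ ler01 lo; rewrite powR1; apply; lra.
Qed.

End Tree.

(** * Complex numbers and digits *)

Section ComplexModulus.
Variable R : realType.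
Local Notation C := R[i].
Local Notation normc := (@Normc.normc R).
Implicit Types (z w : C).

Lemma ReD z w : complex.Re (z + w) = complex.Re z + complex.Re w.
Proof. by case: z => ? ?; case: w. Qed.

Lemma ImD z w : complex.Im (z + w) = complex.Im z + complex.Im w.
Proof. by case: z => ? ?; case: w. Qed.

Lemma ReM z w : complex.Re (z * w) = complex.Re z * complex.Re w - complex.Im z * complex.Im w.
Proof. by case: z => ? ?; case: w. Qed.

Lemma ImM z w : complex.Im (z * w) = complex.Re z * complex.Im w + complex.Im z * complex.Re w.
Proof. by case: z => ? ?; case: w. Qed.

Lemma eqC z w : complex.Re z = complex.Re w -> complex.Im z = complex.Im w -> z = w.
Proof. by case: z => ? ?; case: w => ? ? /= -> ->. Qed.

Lemma normc_ge0 z : 0 <= normc z.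
Proof. by case: z => a b; exact: sqrtr_ge0. Qed.

Lemma sqr_normc2 z : normc z ^+ 2 = complex.Re z ^+ 2 + complex.Im z ^+ 2.
Proof. by case: z => a b /=; rewrite sqr_sqrtr// addr_ge0 ?sqr_ge0. Qed.

Lemma ler_Re_normc z : `|complex.Re z| <= normc z.
Proof.
rewrite -(ler_pXn2r (n := 2)) ?nnegrE ?normc_ge0// sqr_normc2 real_normK ?num_real//.
by rewrite lerDl sqr_ge0.
Qed.

Lemma ler_Im_normc z : `|complex.Im z| <= normc z.
Proof.
rewrite -(ler_pXn2r (n := 2)) ?nnegrE ?normc_ge0// sqr_normc2 real_normK ?num_real//.
by rewrite lerDr sqr_ge0.
Qed.

Lemma ler_normc_ReIm z : normc z <= `|complex.Re z| + `|complex.Im z|.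
Proof.
rewrite -(ler_pXn2r (n := 2)) ?nnegrE ?normc_ge0 ?addr_ge0// sqr_normc2.
rewrite -(real_normK (num_real (complex.Re z))) -(real_normK (num_real (complex.Im z))).
by rewrite sqrrD addrAC lerDl mulrn_wge0 ?mulr_ge0.
Qed.

Lemma normc_conj z : normc (conjc z) = normc z.
Proof. by case: z => a b /=; rewrite sqrrN. Qed.

Lemma normc_mul_conj z : z * conjc z = Complex (normc z ^+ 2) 0.
Proof.
rewrite sqr_normc2; case: z => a b /=; apply: eqC => /=; ring.
Qed.

Lemma normc_sum (I : Type) (s : seq I) (P : pred I) (f : I -> C) :
  normc (\sum_(i <- s | P i) f i) <= \sum_(i <- s | P i) normc (f i).
Proof.
elim/big_rec2 : _ => [|i x z _ zx]; first by rewrite Normc.normc0.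
by apply: le_trans (le_normcD _ _) _; rewrite lerD2l.
Qed.

Lemma normc_real (r : R) : 0 <= r -> normc (Complex r 0) = r.
Proof. by move=> r0 /=; rewrite expr0n addr0 sqrtr_sqr ger0_norm. Qed.

End ComplexModulus.

Lemma digit0 b k : digit b 0 k = 0%N.
Proof. by rewrite /digit div0n mod0n. Qed.

Lemma digitS b n k : digit b n k.+1 = digit b (n %/ b) k.
Proof. by rewrite /digit expnS divnMA. Qed.

Lemma ltn_digit b n k : (0 < b)%N -> (digit b n k < b)%N.
Proof. by move=> b0; rewrite ltn_mod. Qed.

Lemma digit_big b n k : (n < b ^ k)%N -> digit b n k = 0%N.
Proof. by move=> nb; rewrite /digit divn_small// mod0n. Qed.

Lemma eq_digits b d n m : (0 < b)%N -> (n < b ^ d)%N -> (m < b ^ d)%N ->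
  (forall k, (k < d)%N -> digit b n k = digit b m k) -> n = m.
Proof.
move=> b0; elim: d n m => [|d IH] n m; first by case: n; case: m.
move=> nb mb nm; rewrite (divn_eq n b) (divn_eq m b).
have := nm 0%N (ltn0Sn _); rewrite /digit expn0 !divn1 => ->.
congr (_ * _ + _)%N; apply: IH.
- by rewrite ltn_divLR// -expnSr.
- by rewrite ltn_divLR// -expnSr.
- by move=> k kd; rewrite -!digitS; exact: nm.
Qed.

Lemma digit_low b n m j k : (0 < b)%N -> (k < j)%N ->
  digit b (n + m * b ^ j) k = digit b n k.
Proof.
move=> b0 kj; rewrite /digit.
rewrite -(subnK (ltnW kj)) expnD mulnA addnC divnMDl ?expn_gt0 ?b0//.
have -> : (b ^ (j - k) = b ^ (j - k.+1) * b)%N by rewrite -expnSr subnSK.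
by rewrite mulnA modnMDl.
Qed.

Lemma digit_top b n m j : (n < b ^ j)%N -> (m < b)%N -> digit b (n + m * b ^ j) j = m.
Proof.
move=> nb mb; have b0 : (0 < b)%N by exact: leq_ltn_trans mb.
by rewrite /digit addnC divnMDl ?expn_gt0 ?b0// divn_small// addn0 modn_small.
Qed.

Lemma exists_digits b d (f : nat -> nat) : (0 < b)%N -> (forall k, (f k < b)%N) ->
  exists2 n, (n < b ^ d)%N & forall k, (k < d)%N -> digit b n k = f k.
Proof.
move=> b0 fb; elim: d => [|d [n nd nf]]; first by exists 0%N.
exists (n + f d * b ^ d)%N.
  rewrite expnS addnC -ltn_subRL -mulnBl (leq_trans nd)// leq_pmull// subn_gt0.
  exact: fb.
move=> k; rewrite ltnS leq_eqVlt => /orP[/eqP ->|kd]; first by rewrite digit_top.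
by rewrite digit_low// nf.
Qed.

(** * Absolute value and balls of a local field *)

Section TopologicalFieldFacts.
Variable K : localFieldType.
Implicit Types (A U : set K) (a b x y : K).

Lemma image_addE a A : [set a + x | x in A] = [set y | A (y - a)].
Proof.
apply/seteqP; split => [_ [x Ax <-]|y Ay] /=; first by rewrite addrAC subrr add0r.
by exists (y - a) => //; rewrite addrC subrK.
Qed.

Lemma image_mulE a A : a != 0 -> [set a * x | x in A] = [set y | A (a^-1 * y)].
Proof.
move=> a0; apply/seteqP; split => [_ [x Ax <-]|y Ay] /=; first by rewrite mulKf.
by exists (a^-1 * y) => //; rewrite mulVKf.
Qed.

Lemma continuous_addl a : continuous (fun x : K => a + x).
Proof.
move=> x; apply: (@continuous_comp _ _ _ (fun y => (a, y)) (fun z : K * K => z.1 + z.2)).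
  by apply: cvg_pair => //; exact: cvg_cst.
exact: add_continuous.
Qed.

Lemma continuous_mull a : continuous (fun x : K => a * x).
Proof.
move=> x; apply: (@continuous_comp _ _ _ (fun y => (a, y)) (fun z : K * K => z.1 * z.2)).
  by apply: cvg_pair => //; exact: cvg_cst.
exact: mul_continuous_subproof.
Qed.

Lemma open_shift a A : open A -> open [set y | A (y - a)].
Proof.
move=> oA; have -> : [set y | A (y - a)] = (fun x => - a + x) @^-1` A.
  by apply/seteqP; split => y /=; rewrite addrC.
by apply: open_comp => // x _; exact: continuous_addl.
Qed.

(** The component of [0] is closed, and it is [{0}]. *)
Lemma hausdorff_localField : hausdorff_space K.
Proof.
have c0 : closed [set (0 : K)].
  by rewrite -(@totally_disconnected_subproof K 0 I); apply: component_closed closedT.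
move=> x y; rewrite /cluster /= => cl; apply/eqP; rewrite -subr_eq0; apply/negPn/negP => xy.
have U0 : nbhs (x - y) (~` [set (0 : K)]).
  by apply: open_nbhs_nbhs; split; [rewrite openC|exact/eqP].
have [[A B] /= [nA nB] AB] := @sub_continuous K (x, y) _ U0.
have [z [Az Bz]] := cl A B nA nB.
by apply: (AB (z, z)) => //=; rewrite subrr.
Qed.

Lemma finite_set_localField : ~ finite_set [set: K].
Proof.
move=> finK; apply: (@nondiscrete_subproof K) => A.
rewrite -closedC.
have [+ _] := accessible_finite_set_closed (T := K).
move/(_ (hausdorff_accessible (@hausdorff_localField))); apply.
exact: sub_finite_set finK.
Qed.

Lemma open_measurableK A : open A -> measurable (A : set (borel K)).
Proof. exact: sub_sigma_algebra. Qed.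

Lemma closed_measurableK A : closed A -> measurable (A : set (borel K)).
Proof. by rewrite -openC => /open_measurableK/measurableC; rewrite setCK. Qed.

Lemma compact_measurableK A : compact A -> measurable (A : set (borel K)).
Proof.
by move=> cA; apply: closed_measurableK; exact: compact_closed hausdorff_localField cA.
Qed.

Lemma measurable_shift a : measurable_fun [set: borel K] (fun x : borel K => x - a : borel K).
Proof.
apply: (@measurability _ _ (borel K) (borel K) _ _ (@open K)) => //.
move=> _ [A oA <-]; rewrite setTI; apply: open_measurableK.
exact: open_shift.
Qed.

Lemma compact_shift a A : compact A -> compact [set y | A (y - a)].
Proof.
move=> cA; rewrite -image_addE; apply: continuous_compact => //.
by apply: continuous_subspaceT; exact: continuous_addl.
Qed.

End TopologicalFieldFacts.

Section LocalFieldStructure.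
Variables (R : realType) (K : localFieldType).
Variables (mu : {measure set (borel K) -> \bar R}) (haar_mu : haar_measure mu).
Variables (abs : K -> R) (abs_mu : haar_absolute_value mu abs).
Implicit Types (A U : set K) (a b x y : K).

Lemma compact_pos_measure : exists2 X : set K, compact X & (0 < mu X < +oo)%E.
Proof.
have [X [cX _] X0] : exists2 X, compact X /\ X `<=` setT & mu X != 0%E.
  apply/not_exists2P => H.
  have : mu [set: borel K] = 0%E.
    rewrite (haar_inner_regular haar_mu openT); apply/eqP; rewrite eq_le; apply/andP; split.
      apply: ge_ereal_sup => _ [A [cA AT] <-].
      by have [/(_ (conj cA AT))//|/negP] := H A; rewrite negbK => /eqP ->.
    apply: ereal_sup_ubound; exists set0; rewrite ?measure0//; split => //.
    exact: compact0.
  by move/eqP; apply/negP; exact: haar_nonzero.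
exists X => //; rewrite (haar_compact haar_mu cX) andbT.
by rewrite lt_neqAle eq_sym X0 measure_ge0.
Qed.

Lemma measure_mul a A : a != 0 -> measurable (A : set (borel K)) ->
  mu [set a * x | x in A] = ((abs a)%:E * mu A)%E.
Proof. by move=> a0 mA; have [_] := abs_mu; exact. Qed.

Lemma compact_mul a A : compact A -> compact [set a * x | x in A].
Proof.
move=> cA; apply: continuous_compact => //.
by apply: continuous_subspaceT; exact: continuous_mull.
Qed.

Lemma abs0 : abs 0 = 0.
Proof. by case: abs_mu. Qed.

(** Both sides are the factor by which multiplication by [a * b] scales the
    measure of a compact set of positive measure. *)
Lemma absM a b : abs (a * b) = abs a * abs b.
Proof.
have [->|a0] := eqVneq a 0; first by rewrite mul0r abs0 mul0r.
have [->|b0] := eqVneq b 0; first by rewrite mulr0 abs0 mulr0.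
have [X cX /andP[X0 Xoo]] := compact_pos_measure.
have mX := compact_measurableK cX.
have Xfin : mu X \is a fin_num by rewrite ge0_fin_numE.
have ab0 : a * b != 0 by rewrite mulf_neq0.
have := measure_mul ab0 mX.
have -> : [set a * b * x | x in X] = [set a * x | x in [set b * x | x in X]].
  by rewrite image_comp; apply: eq_imagel => x _ /=; rewrite mulrA.
rewrite (measure_mul a0 (compact_measurableK (compact_mul (a := b) cX))).
rewrite (measure_mul b0 mX) -(fineK Xfin) -!EFinM => -[] /esym.
rewrite mulrA; apply: mulIf; rewrite gt_eqF//.
by rewrite fine_gt0// X0.
Qed.

Lemma abs_ge0 a : 0 <= abs a.
Proof.
have [->|a0] := eqVneq a 0; first by rewrite abs0.
have [X cX /andP[X0 Xoo]] := compact_pos_measure.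
have Xfin : mu X \is a fin_num by rewrite ge0_fin_numE// ltW.
have := measure_mul a0 (compact_measurableK cX); rewrite -(fineK Xfin) -EFinM => E.
have : (0 <= (abs a * fine (mu X))%:E)%E by rewrite -E measure_ge0.
rewrite lee_fin pmulr_lge0//.
by rewrite fine_gt0// X0.
Qed.

Lemma abs1 : abs 1 = 1.
Proof.
have [X cX /andP[X0 Xoo]] := compact_pos_measure.
have Xfin : mu X \is a fin_num by rewrite ge0_fin_numE// ltW.
have := measure_mul (oner_neq0 K) (compact_measurableK cX).
have -> : [set 1 * x | x in X] = X.
  by rewrite -[RHS]image_id; apply: eq_imagel => x _; rewrite mul1r.
rewrite -(fineK Xfin) -EFinM => -[] /esym/eqP.
rewrite -[X in _ == X]mul1r => /eqP /mulIf; apply.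
by rewrite gt_eqF// fine_gt0// X0.
Qed.

Lemma abs_gt0 a : a != 0 -> 0 < abs a.
Proof.
move=> a0; rewrite lt_neqAle abs_ge0 andbT eq_sym; apply/eqP => aa.
by have /eqP := absM a a^-1; rewrite mulfV// abs1 aa mul0r oner_eq0.
Qed.

Lemma abs_eq0 a : abs a = 0 -> a = 0.
Proof. by move=> aa; apply/eqP/negPn/negP => /abs_gt0; rewrite aa ltxx. Qed.

Lemma absV a : abs a^-1 = (abs a)^-1.
Proof.
have [->|a0] := eqVneq a 0; first by rewrite invr0 abs0 invr0.
apply: (mulfI (x := abs a)); first by rewrite gt_eqF// abs_gt0.
by rewrite -absM !mulfV ?abs1// gt_eqF// abs_gt0.
Qed.

Lemma absN a : abs (- a) = abs a.
Proof.
suff : abs (- 1) = 1 by move=> h; rewrite -mulN1r absM h mul1r.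
have : abs (-1) ^+ 2 = 1 by rewrite expr2 -absM mulrNN mulr1 abs1.
by move/eqP; rewrite -[X in _ == X](expr1n _ 2) eqrXn2 ?ler01 ?abs_ge0// => /eqP.
Qed.

Lemma absX a n : abs (a ^+ n) = abs a ^+ n.
Proof. by elim: n => [|n IH]; rewrite ?expr0 ?abs1// !exprS absM IH. Qed.

Lemma absXz a (k : int) : abs (a ^ k) = abs a ^ k.
Proof. by case: k => n; rewrite /exprz ?absV absX. Qed.

Lemma abs_distC x y : abs (x - y) = abs (y - x).
Proof. by rewrite -absN opprB. Qed.

(** A compact set [X] has an open neighbourhood [U] of measure below [r * mu X],
    and [a * X] stays inside [U] for [a] close to [1]. *)
Lemma abs_usc (r : R) : 1 < r -> \forall a \near (1 : K), abs a < r.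
Proof.
move=> r1; have [X cX /andP[X0 Xoo]] := compact_pos_measure.
have mX := compact_measurableK cX.
have Xfin : mu X \is a fin_num by rewrite ge0_fin_numE// ltW.
have lt : (mu X < r%:E * mu X)%E.
  by rewrite -(fineK Xfin) -EFinM lte_fin ltr_pMl// fine_gt0// X0.
have [U [oU XU] Ur] : exists2 U, open U /\ X `<=` U & (mu U < r%:E * mu X)%E.
  move: lt; rewrite {1}(haar_outer_regular haar_mu mX) => /ereal_inf_lt[_ [U [oU XU] <-]].
  by exists U.
have /compact_near_coveringP/(_ K (nbhs (1 : K)) (fun a x => U (a * x))) := cX.
move=> /(_ _ _) near_UX; have {}near_UX : \forall a \near (1 : K), X `<=` (fun x => U (a * x)).
  apply: near_UX => x Xx.
  have nU : nbhs ((fun z : K * K => z.1 * z.2) (1, x)) U.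
    by apply: open_nbhs_nbhs; split=> //=; rewrite mul1r; exact: XU.
  have [[A B] /= [nA nB] AB] := @mul_continuous_subproof K (1, x) _ nU.
  by exists (B, A) => //= -[b a] /= [Bb Aa]; exact: (AB (a, b)).
near=> a; have [->|a0] := eqVneq a 0; first by rewrite abs0 (lt_trans ltr01).
have aXU : [set a * x | x in X] `<=` U.
  move=> _ [x Xx <-].
  suff : X `<=` (fun x => U (a * x)) by apply.
  by near: a.
have E := measure_mul a0 mX.
have : ((abs a)%:E * mu X < r%:E * mu X)%E.
  rewrite -E; apply: le_lt_trans Ur; apply: le_measure => //; rewrite inE.
    by apply: compact_measurableK; exact: compact_mul.
  exact: open_measurableK.
rewrite -(fineK Xfin) -!EFinM lte_fin ltr_pM2r//.
by rewrite fine_gt0// X0.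
Unshelve. all: by end_near. Qed.

Variables (F : finFieldType) (red : K -> F) (red_residue : residue_map abs red).
Variables (varpi : K) (varpi_prime : prime_element abs varpi).

Local Notation D := (integers abs).
Local Notation P := (prime_ideal abs).

Lemma redD x y : D x -> D y -> red (x + y) = red x + red y.
Proof. by move=> Dx Dy; apply: (residue_mapD red_residue); exact: mem_set. Qed.

Lemma prime_ideal_sub : P `<=` D.
Proof. by move=> x /ltW. Qed.

(** The ultrametric inequality: otherwise [x / (x + y)] and [y / (x + y)] are in
    the prime ideal, but they add up to [1], whose residue is not [0]. *)
Lemma abs_ultra x y : abs (x + y) <= Num.max (abs x) (abs y).
Proof.
rewrite leNgt gt_max; apply/negP => /andP[xz yz].
have z0 : 0 < abs (x + y) by exact: le_lt_trans (abs_ge0 _) xz.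
have zn0 : x + y != 0 by apply: contraTneq z0 => ->; rewrite abs0 ltxx.
have Px : P (x / (x + y)) by rewrite /prime_ideal/= absM absV ltr_pdivrMr ?mul1r.
have Py : P (y / (x + y)) by rewrite /prime_ideal/= absM absV ltr_pdivrMr ?mul1r.
have := redD (prime_ideal_sub Px) (prime_ideal_sub Py).
rewrite -mulrDl mulfV// (residue_map1 red_residue).
rewrite (residue_map_ker red_residue (prime_ideal_sub Px)).2//.
rewrite (residue_map_ker red_residue (prime_ideal_sub Py)).2//.
by rewrite addr0 => /eqP; rewrite oner_eq0.
Qed.

Lemma abs_addr_le (r : R) x y : abs x <= r -> abs y <= r -> abs (x + y) <= r.
Proof. by move=> xr yr; apply: le_trans (abs_ultra x y) _; rewrite ge_max xr. Qed.

Lemma abs_subr_le (r : R) x y : abs x <= r -> abs y <= r -> abs (x - y) <= r.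
Proof. by move=> xr yr; apply: abs_addr_le; rewrite ?absN. Qed.

Lemma abs_addr_lt (r : R) x y : abs x < r -> abs y < r -> abs (x + y) < r.
Proof. by move=> xr yr; apply: le_lt_trans (abs_ultra x y) _; rewrite gt_max xr. Qed.

Lemma abs_subr_lt (r : R) x y : abs x < r -> abs y < r -> abs (x - y) < r.
Proof. by move=> xr yr; apply: abs_addr_lt; rewrite ?absN. Qed.

(** Otherwise [y = (x + y) - x] would be too small. *)
Lemma abs_dominant x y : abs x < abs y -> abs (x + y) = abs y.
Proof.
move=> xy; apply/eqP; rewrite eq_le abs_addr_le//; last exact: ltW.
rewrite leNgt; apply/negP => yxy.
have : abs (x + y - x) < abs y by exact: abs_subr_lt.
by rewrite addrAC subrr add0r ltxx.
Qed.

Lemma red_eq x y : D x -> D y -> (red x = red y <-> P (x - y)).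
Proof.
move=> Dx Dy; have Dxy : D (x - y) by exact: abs_subr_le.
rewrite -(residue_map_ker red_residue Dxy).
have -> : red x = red (x - y) + red y by rewrite -redD// subrK.
split => [/eqP|->]; last by rewrite add0r.
by rewrite -[X in _ == X]add0r => /eqP/addIr.
Qed.

(** If [varpi] were [0] then [K] would embed into the finite residue field, and
    a finite Hausdorff space is discrete. *)
Lemma varpi_neq0 : varpi != 0.
Proof.
have [Pv vmax] := varpi_prime; apply/negP => /eqP v0.
have Pz x : P x -> x = 0.
  by move=> /vmax; rewrite v0 abs0 => x0; apply/abs_eq0/eqP; rewrite eq_le x0 abs_ge0.
have DK x : D x.
  rewrite /integers/= leNgt; apply/negP => x1.
  have x0 : x^-1 = 0 by apply: Pz; rewrite /prime_ideal/= absV invf_lt1// (lt_trans ltr01).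
  by move: x1; rewrite -[x]invrK x0 invr0 abs0 ltr10.
apply: (@finite_set_localField K).
rewrite -(preimage_setT red); apply: finite_preimage => //.
move=> x y _ _ /(red_eq (DK x) (DK y))/Pz/eqP; rewrite subr_eq0 => /eqP//.
Qed.

Lemma abs_varpi_lt1 : abs varpi < 1.
Proof. by case: varpi_prime. Qed.

Lemma abs_varpi_gt0 : 0 < abs varpi.
Proof. exact: abs_gt0 varpi_neq0. Qed.

Lemma abs_lt_varpiXz x (k : int) : abs x < abs varpi ^ k -> abs x <= abs varpi ^ (k + 1).
Proof.
move=> xk; have [_ vmax] := varpi_prime.
have k0 : 0 < abs varpi ^ k by rewrite exprz_gt0// abs_varpi_gt0.
have : P (x / varpi ^ k).
  by rewrite /prime_ideal/= absM absV absXz ltr_pdivrMr// mul1r.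
move=> /vmax; rewrite absM absV absXz ler_pdivrMr// //.
by rewrite expfzDr ?gt_eqF ?abs_varpi_gt0// expr1z mulrC.
Qed.

Definition cball a (k : int) : set K := [set x | abs (x - a) <= abs varpi ^ k].

Lemma cball_center a k : cball a k a.
Proof. by rewrite /cball/= subrr abs0 ltW// exprz_gt0// abs_varpi_gt0. Qed.

Lemma integersE : D = cball 0 0.
Proof. by apply/seteqP; split => x; rewrite /cball/integers/= subr0 expr0z. Qed.

Lemma prime_idealE : P = cball 0 1.
Proof.
apply/seteqP; split => x; rewrite /cball/prime_ideal/= subr0.
  by rewrite -[X in _ < X](expr0z (abs varpi)) => /abs_lt_varpiXz.
by rewrite expr1z => /le_lt_trans; apply; exact: abs_varpi_lt1.
Qed.

Lemma varpiXz_neq0 (k : int) : varpi ^ k != 0.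
Proof. exact: expfz_neq0 varpi_neq0. Qed.

Lemma rad_gt0 (k : int) : 0 < abs varpi ^ k.
Proof. exact/exprz_gt0/abs_varpi_gt0. Qed.

Lemma ler_rad (k j : int) : k <= j -> abs varpi ^ j <= abs varpi ^ k.
Proof.
move=> kj; have -> : j = k + (j - k) by rewrite addrC subrK.
rewrite expfzDr ?gt_eqF ?abs_varpi_gt0// ger_pMr ?rad_gt0//.
have : 0 <= j - k by rewrite subr_ge0.
case: (j - k) => // n _.
by rewrite -exprnP exprn_ile1 ?abs_ge0// ltW// abs_varpi_lt1.
Qed.

Lemma near1_integers : \forall a \near (1 : K), D a.
Proof.
have v1 : 1 < (abs varpi)^-1 by rewrite invf_gt1 ?abs_varpi_gt0// abs_varpi_lt1.
near=> a; rewrite integersE /cball/= subr0 expr0z.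
have : abs a < abs varpi ^ (- 1) by rewrite -invr_expz expr1z; near: a; exact: abs_usc.
by move=> /abs_lt_varpiXz; rewrite addNr expr0z.
Unshelve. all: by end_near. Qed.

Lemma open_integers : open D.
Proof.
rewrite openE => x Dx; rewrite /interior/=.
have N : nbhs (1 - x + x) D by rewrite subrK; exact: near1_integers.
have C : nbhs x ((fun y : K => 1 - x + y) @^-1` D) := @continuous_addl K (1 - x) x _ N.
apply: (filterS _ C) => y /= Dy.
have -> : y = (1 - x + y) + (x - 1).
  by ring.
apply: abs_addr_le => //; apply: abs_subr_le => //.
by rewrite abs1.
Qed.

Lemma cballE a k : cball a k = [set y | [set x | D (varpi ^ (- k) * x)] (y - a)].
Proof.
apply/seteqP; split => y; rewrite /cball/integers/= absM absXz -invr_expz;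
  by rewrite mulrC ler_pdivrMr ?rad_gt0// mul1r.
Qed.

Lemma open_cball a k : open (cball a k).
Proof.
rewrite cballE; apply: open_shift.
by apply: open_comp open_integers => x _; exact: continuous_mull.
Qed.

Lemma cball_eq a b k : abs (a - b) <= abs varpi ^ k -> cball a k = cball b k.
Proof.
move=> ab; apply/seteqP; split => x; rewrite /cball/= => h.
  by rewrite -(subrKA a) abs_addr_le.
by rewrite -(subrKA b) abs_addr_le// abs_distC.
Qed.

Lemma closed_cball a k : closed (cball a k).
Proof.
rewrite -openC openE => x xa; rewrite /interior/=.
apply: filterS (open_nbhs_nbhs (conj (open_cball x k) (cball_center x k))) => y yx ya.
apply: xa; rewrite /cball/= -(subrKA y) abs_addr_le//.
by rewrite abs_distC.
Qed.

Lemma measurable_cball a k : measurable (cball a k : set (borel K)).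
Proof. by apply: open_measurableK; exact: open_cball. Qed.

Lemma cball_image a k : cball a k = [set a + x | x in [set varpi ^ k * y | y in D]].
Proof.
rewrite image_addE image_mulE ?varpiXz_neq0// cballE.
by rewrite invr_expz.
Qed.

Lemma field_ballE B : field_ball abs varpi B <-> exists a k, B = cball a k.
Proof.
by split=> -[a [k ->]]; exists a, k; rewrite cball_image.
Qed.

Hypothesis mu1 : mu D = 1%E.
Local Notation q := (#|F|).
Implicit Types (z : F) (k : int).

Lemma measure_cball a k : mu (cball a k) = (abs varpi ^ k)%:E.
Proof.
have mD : measurable (D : set (borel K)).
  by apply: open_measurableK; exact: open_integers.
have mvD : measurable ([set varpi ^ k * y | y in D] : set (borel K)).
  by rewrite -[X in measurable X]image_id image_comp; have := measurable_cball 0 k;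
    rewrite cball_image; congr measurable; rewrite image_comp; apply: eq_imagel => x _ /=;
    rewrite add0r.
rewrite cball_image (haar_translation haar_mu)// measure_mul ?varpiXz_neq0//.
by rewrite mu1 mule1 absXz.
Qed.

Definition sec z : K := sval (cid2 (residue_map_surj red_residue z)).

Lemma sec_int z : D (sec z).
Proof. by rewrite /sec; case: cid2. Qed.

Lemma red_sec z : red (sec z) = z.
Proof. by rewrite /sec; case: cid2. Qed.

(** The child of residue [z] of the ball of centre [a] and radius index [k]. *)
Definition child a k z : K := a + sec z * varpi ^ k.

Lemma abs_scale x k : D (varpi ^ (- k) * x) <-> abs x <= abs varpi ^ k.
Proof.
by rewrite /integers/= absM absXz -invr_expz mulrC ler_pdivrMr ?rad_gt0// mul1r.
Qed.

Lemma childP a k z x : cball a k x ->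
  cball (child a k z) (k + 1) x <-> z = red (varpi ^ (- k) * (x - a)).
Proof.
move=> xa; have Dx : D (varpi ^ (- k) * (x - a)) by exact/abs_scale.
transitivity (P (varpi ^ (- k) * (x - a) - sec z)).
  rewrite prime_idealE /cball/= subr0 expr1z.
  have -> : varpi ^ (- k) * (x - a) - sec z = varpi ^ (- k) * (x - child a k z).
    by rewrite /child -invr_expz; field; exact: varpiXz_neq0.
  rewrite absM absXz -invr_expz mulrC ler_pdivrMr ?rad_gt0//.
  by rewrite expfzDr ?gt_eqF ?abs_varpi_gt0// expr1z mulrC.
by rewrite -(red_eq Dx (sec_int z)) red_sec; split.
Qed.

Lemma child_sub a k z : cball (child a k z) (k + 1) `<=` cball a k.
Proof.
move=> x /= h; rewrite /cball/= -(subrKA (child a k z)) abs_addr_le//.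
  by apply: (le_trans h); apply: ler_rad; rewrite lerDl.
rewrite /child addrAC subrr add0r absM absXz ger_pMl ?rad_gt0//.
exact: sec_int.
Qed.

Lemma cball_split a k :
  cball a k = \big[setU/set0]_(z <- enum F) cball (child a k z) (k + 1).
Proof.
apply/seteqP; split => [x xa|]; last first.
  rewrite big_enum/=; elim/big_ind : _ => // [A B hA hB x [/hA|/hB]//|z _].
  exact: child_sub.
rewrite big_enum/= -bigcup_seq.
exists (red (varpi ^ (- k) * (x - a))); first by rewrite /= mem_index_enum.
exact/childP.
Qed.

Lemma trivIset_child a k (A : set F) :
  trivIset A (fun z => cball (child a k z) (k + 1)).
Proof.
move=> z z' _ _ [x [xz xz']]; have xa := child_sub xz.
by rewrite ((childP z xa).1 xz) ((childP z' xa).1 xz').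
Qed.

Lemma integral_child a k (f : K -> R) :
  measurable_fun (cball a k : set (borel K)) (f : borel K -> R) ->
  (\int[mu]_(x in cball a k) (f x)%:E =
  \sum_(z : F) \int[mu]_(x in cball (child a k z) (k + 1)) (f x)%:E)%E.
Proof.
move=> mf; rewrite -[RHS]big_enum/= {1}cball_split.
rewrite (@integral_bigsetU_EFin _ (borel K) R mu F
  (fun z => cball (child a k z) (k + 1)) f (enum F))//.
- by move=> z; exact: measurable_cball.
- exact: enum_uniq.
- exact: trivIset_child.
- by rewrite -cball_split; exact/measurable_EFinP.
Qed.

(** The ring of integers is the disjoint union of [q] balls of radius
    [abs varpi]. *)
Lemma card_abs_varpi : #|F|%:R * abs varpi = 1 :> R.
Proof.
have := @integral_child 0 0 (cst 1) (measurable_cst _).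
have E a k : (\int[mu]_(x in cball a k) (cst 1 x)%:E = (abs varpi ^ k)%:E)%E.
  by rewrite (eq_integral (cst 1%E))// integral_cst ?mul1e ?measure_cball//;
    exact: measurable_cball.
under [X in _ = X -> _]eq_bigr do rewrite E.
rewrite E sumEFin expr0z add0r expr1z => -[] h.
by rewrite [RHS]h sumr_const mulr_natl.
Qed.

Lemma abs_varpiE : abs varpi = q%:R^-1.
Proof.
have q0 : q%:R != 0 :> R.
  by apply/eqP => q0; have := card_abs_varpi; rewrite q0 mul0r => /eqP; rewrite eq_sym oner_eq0.
by apply: (mulfI q0); rewrite card_abs_varpi mulfV.
Qed.

Lemma measure_shift a A : measurable (A : set (borel K)) ->
  mu [set y | A (y - a)] = mu A.
Proof. by move=> mA; rewrite -(haar_translation haar_mu a mA) image_addE. Qed.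

(** Finitely many translates of [U] cover a compact set of positive measure. *)
Lemma open_pos_measure U : open U -> U 0 -> (0 < mu U)%E.
Proof.
move=> oU U0; rewrite lt_neqAle measure_ge0 andbT eq_sym; apply/negP => /eqP mU0.
have [X cX /andP[X0 _]] := compact_pos_measure.
pose f x := [set y | U (y - x)].
have fo x : open (f x) by exact: open_shift.
have [s _ Xs] : finite_subset_cover setT f X.
  move: cX; rewrite compact_cover; apply => // x Xx.
  by exists x => //; rewrite /f/= subrr.
have m0 (t : seq K) : mu (\big[setU/set0]_(x <- t) f x) = 0%E.
  elim: t => [|x t IH]; first by rewrite big_nil measure0.
  have mf y : measurable (f y : set (borel K)) by exact: open_measurableK.
  rewrite big_cons measureU0//.
    by rewrite /f measure_shift//; exact: open_measurableK.
  by apply: bigsetU_measurable => y _; exact: mf.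
have : (mu X <= 0)%E.
  rewrite -(m0 (finmap.enum_fset s)) le_measure// ?inE.
  - exact: compact_measurableK.
  - by apply: bigsetU_measurable => y _; exact: open_measurableK.
  - by move: Xs; rewrite /cover bigcup_fset.
by rewrite leNgt X0.
Qed.

(** A maximal family of disjoint translates of a small neighbourhood has bounded
    cardinality because [D] has finite measure; doubling the neighbourhood then
    covers [D] by finitely many translates of a compact set. *)
Lemma compact_integers : compact D.
Proof.
have [V V0 [cV clV]] := @locally_compact_subproof K 0 I.
have V0' : nbhs (0 : K) (fun x => [set: K] x -> V x) := V0.
have {V0 V0'}V0 : nbhs (0 : K) V by apply: (filterS _ V0') => x; exact.
have [U [oU U0] UV] : exists2 U, open U /\ U 0 & forall x y, U x -> U y -> V (x - y).
  have V0' : nbhs ((0 : K) - 0) V by rewrite subr0.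
  have [[A B] /= [nA nB] AB] := @sub_continuous K (0, 0) _ V0'.
  exists (A° `&` B°); first by split; [apply: openI; exact: open_interior|split].
  by move=> x y [/interior_subset Ax _] [_ /interior_subset By]; exact: (AB (x, y)).
wlog UD : U oU U0 UV / U `<=` D.
  move=> /(_ (U `&` D)); apply; last exact: subIsetr.
  - by apply: openI => //; exact: open_integers.
  - by split => //; rewrite /integers/= abs0 ler01.
  - by move=> x y [Ux _] [Uy _]; exact: UV.
have mU0 := open_pos_measure oU U0.
pose T x := [set y | U (y - x)]; pose TV x := [set y | V (y - x)].
have mT x : measurable (T x : set (borel K)) by apply: open_measurableK; exact: open_shift.
have mUT x : mu (T x) = mu U by rewrite measure_shift//; exact: open_measurableK.
have mD : measurable (D : set (borel K)).
  by apply: open_measurableK; exact: open_integers.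
have mU1 : (mu U <= 1)%E.
  by rewrite -mu1 le_measure// inE//; exact: open_measurableK.
have Ufin : mu U \is a fin_num.
  by rewrite ge0_fin_numE//; apply: le_lt_trans mU1 (ltry _).
have [s Ds] : exists s : seq K, D `<=` \big[setU/set0]_(x <- s) TV x.
  apply/not_existsP => no.
  have grow n : exists s : seq K, \big[setU/set0]_(x <- s) T x `<=` D /\
      (mu (\big[setU/set0]_(x <- s) T x) = n%:R%:E * mu U)%E.
    elim: n => [|n [s [sD ms]]].
      by exists [::]; rewrite !big_nil measure0 mul0e; split => //; exact: sub0set.
    have /existsNP[x /not_implyP[Dx xs]] := no s.
    exists (x :: s); rewrite !big_cons; split.
      rewrite subUset; split => // y /= Ty.
      by rewrite -(subrK x y); apply: abs_addr_le => //; exact: UD.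
    rewrite measureU//; last 2 first.
    - by apply: bigsetU_measurable.
    - rewrite -subset0 => y [/= Txy]; rewrite -bigcup_seq => -[z zs /= Tzy].
      apply: xs; rewrite -bigcup_seq; exists z => //=.
      by have := UV _ _ Tzy Txy; rewrite opprB addrC subrKA.
    transitivity (mu U + n%:R%:E * mu U)%E; first by congr (_ + _)%E; [exact: mUT|exact: ms].
    by rewrite -[X in (X + _)%E]mul1e -ge0_muleDl// -EFinD -natr1 addrC.
  pose n := Num.bound (fine (mu U))^-1.
  have [s [sD ms]] := grow n.
  have : (mu (\big[setU/set0]_(x <- s) T x) <= 1)%E.
    by rewrite -mu1 le_measure// inE//; exact: bigsetU_measurable.
  rewrite ms -(fineK Ufin) -EFinM lee_fin leNgt => /negP; apply.
  rewrite -ltr_pdivrMr ?div1r; last by rewrite fine_gt0// mU0 ltey_eq Ufin.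
  by rewrite archi_boundP// invr_ge0 fine_ge0.
have -> : D = \big[setU/set0]_(x <- s) TV x `&` D by rewrite setIidr.
apply: compact_closedI; last by rewrite integersE; exact: closed_cball.
by apply: bigsetU_compact => x _; exact: compact_shift.
Qed.

Lemma compact_cball a k : compact (cball a k).
Proof.
rewrite cball_image image_addE; apply: compact_shift; apply: compact_mul.
exact: compact_integers.
Qed.

Lemma rad_small (e : R) : 0 < e -> exists n : nat, abs varpi ^ n < e.
Proof.
move=> e0; have : (fun n : nat => abs varpi ^+ n) @ \oo --> (0 : R).
  by apply: cvg_expr; rewrite ger0_norm ?abs_ge0// abs_varpi_lt1.
move/cvgrPdist_lt => /(_ e e0)[n _ /(_ n (leqnn n))] /=.
rewrite sub0r normrN ger0_norm ?exprn_ge0 ?abs_ge0// => ne.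
by exists n.
Qed.

(** A point [y] different from [x] lies outside the small balls around [x], and by
    compactness of the unit ball one radius serves for all [y] outside [U]. *)
Lemma open_cball_sub U x : open U -> U x -> exists j : nat, cball x j `<=` U.
Proof.
move=> oU Ux; have /compact_near_coveringP : compact (cball x 0) by exact: compact_cball.
move=> /(_ nat \oo (fun n y => cball x n y -> U y) _)[y yx|n _ nU].
  have [->|yn] := eqVneq y x.
    exists (U, setT) => /=; first by split; [exact: open_nbhs_nbhs|exact: filterT].
    by move=> [z n] /= [Uz _] _.
  have yx0 : 0 < abs (y - x) by apply: abs_gt0; rewrite subr_eq0.
  have [n nyx] := rad_small yx0.
  exists (cball y n, [set m : nat | (n <= m)%N]) => /=.
    split; last by exists n.
    by apply: open_nbhs_nbhs; split; [exact: open_cball|exact: cball_center].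
  move=> [z m] /= [zy nm] zx; exfalso; move: nyx; rewrite ltNge => /negP; apply.
  rewrite -(subrKA z) abs_addr_le//; first by rewrite abs_distC.
  by apply: (le_trans zx); apply: ler_rad; rewrite lez_nat.
exists n => y yn; apply: (nU n (leqnn n)) => //.
by rewrite /cball/=; apply: (le_trans yn); apply: ler_rad.
Qed.

Variables (l c : nat) (l_prime : prime l) (c_gt0 : (0 < c)%N).
Hypothesis cardF : #|F| = (l ^ c)%N.
Variable eps : 'I_c -> K.
Hypothesis eps_basis : residue_basis abs red (card_finPcharP cardF l_prime) eps.

Local Notation u := (u_rep l eps varpi).
Local Notation ud := (u_digit l eps varpi).

Lemma q_gt1 : (1 < q)%N.
Proof. by rewrite cardF -(exp1n c) ltn_exp2r// prime_gt1. Qed.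

Lemma q_gt0 : (0 < q)%N.
Proof. exact: ltnW q_gt1. Qed.

Lemma u_digit0 : ud 0 = 0.
Proof. by rewrite /u_digit big1 ?mul0r// => i _; rewrite digit0 mul0r. Qed.

Lemma u_repE J n : (n < q ^ J)%N ->
  u n = \sum_(k < J) ud (digit q n k) * varpi ^- k.
Proof.
have stable m : (n < q ^ m)%N -> forall d,
    \sum_(k < m + d) ud (digit q n k) * varpi ^- k =
    \sum_(k < m) ud (digit q n k) * varpi ^- k.
  move=> nm; elim=> [|d IH]; first by rewrite addn0.
  rewrite addnS big_ord_recr/= IH digit_big ?u_digit0 ?mul0r ?addr0//.
  by apply: (leq_trans nm); rewrite leq_exp2l ?q_gt1// leq_addr.
move=> nJ; rewrite /u_rep -cardF; set T := (trunc_log q n).+1.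
have nT : (n < q ^ T)%N by apply: trunc_log_ltn; exact: q_gt1.
by rewrite -(stable T nT J) addnC stable.
Qed.

Lemma u_rep0 : u 0 = 0.
Proof. by rewrite (@u_repE 0) ?big_ord0// expn0. Qed.

Lemma u_repD n m j : (n < q ^ j)%N -> (m < q)%N ->
  u (n + m * q ^ j) = u n + ud m * varpi ^- j.
Proof.
move=> nj mq; rewrite (@u_repE j.+1); last first.
  rewrite expnS (@leq_trans ((m.+1) * q ^ j))//; first by rewrite mulSn ltn_add2r.
  by rewrite leq_mul2r mq orbT.
rewrite big_ord_recr/= (u_repE nj); congr (_ + _).
  by apply: eq_bigr => k _; rewrite digit_low// q_gt0.
by rewrite /digit addnC divnMDl ?expn_gt0 ?q_gt0// (divn_small nj) addn0 modn_small.
Qed.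

Lemma u_rep_small m : (m < q)%N -> u m = ud m.
Proof.
move=> mq; have := @u_repD 0 m 0 (ltnSn _) mq.
by rewrite expn0 muln1 add0n u_rep0 add0r expr0 invr1 mulr1.
Qed.

Definition lead m : K := \sum_(k < c) (digit l m k)%:R * eps k.

Lemma ud_lead m : ud m = lead m / varpi.
Proof. by []. Qed.

Lemma eps_int (i : 'I_c) : D (eps i).
Proof. by case: eps_basis => _ /(_ i) []. Qed.

Lemma abs_natr_le1 n : abs n%:R <= 1.
Proof.
elim: n => [|n IH]; first by rewrite abs0 ler01.
by rewrite -natr1; apply: abs_addr_le => //; rewrite abs1.
Qed.

Lemma abs_sum_le (I : Type) (s : seq I) (f : I -> K) (r : R) : 0 <= r ->
  (forall i, abs (f i) <= r) -> abs (\sum_(i <- s) f i) <= r.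
Proof.
move=> r0 fr; elim/big_rec : _ => [|i x _ xr]; first by rewrite abs0.
exact: abs_addr_le.
Qed.

Lemma lead_int m : D (lead m).
Proof.
apply: abs_sum_le => // k; rewrite absM mulr_ile1 ?abs_ge0 ?abs_natr_le1//.
exact: eps_int.
Qed.

Lemma red0 : red 0 = 0.
Proof.
have D0 : D 0 by rewrite /integers/= abs0.
by apply/(residue_map_ker red_residue D0); rewrite /prime_ideal/= abs0.
Qed.

Lemma red_nat n x : D x -> red (n%:R * x) = n%:R * red x.
Proof.
move=> Dx; elim: n => [|n IH]; first by rewrite !mul0r red0.
rewrite -!natr1 !mulrDl !mul1r redD ?IH//.
by rewrite /integers/= absM mulr_ile1 ?abs_ge0 ?abs_natr_le1.
Qed.

Lemma red_lead m : red (lead m) = \sum_(k < c) (digit l m k)%:R * red (eps k).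
Proof.
have Dk (k : 'I_c) : D ((digit l m k)%:R * eps k).
  by rewrite /integers/= absM mulr_ile1 ?abs_ge0 ?abs_natr_le1//; exact: eps_int.
rewrite /lead; suff [] : D (\sum_(k < c) (digit l m k)%:R * eps k) /\
    red (\sum_(k < c) (digit l m k)%:R * eps k) =
    \sum_(k < c) (digit l m k)%:R * red (eps k) by [].
elim/big_rec2 : _ => [|k x y _ [Dy ry]].
  by rewrite red0 /integers/= abs0 ler01.
split; first exact: abs_addr_le (Dk k) Dy.
by rewrite (redD (Dk k) Dy) ry red_nat//; exact: eps_int.
Qed.

(** The residues of [eps] form a basis over the prime field, in which two
    digits below [l] with the same class are equal. *)
Lemma red_lead_inj m n : (m < q)%N -> (n < q)%N -> red (lead m) = red (lead n) -> m = n.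
Proof.
move=> mq nq; rewrite !red_lead => mn.
apply: (@eq_digits l c); rewrite -?cardF// ?prime_gt0// => k kc.
have [_ _ /basis_free] := eps_basis.
set Rp := pPrimeCharType _.
pose X : c.-tuple Rp := [tuple (red (eps i) : Rp) | i < c].
have -> : [seq red (eps i) | i : 'I_c] = X by [].
move=> /freeP/(_ (fun i => (digit l m i)%:R - (digit l n i)%:R)) fX.
have Fl (a : nat) : (a < l)%N -> ((a%:R : 'F_l) : nat) = a.
  by move=> al; rewrite val_Fp_nat// modn_small.
have dl (a i : nat) : (digit l a i < l)%N by rewrite ltn_digit// prime_gt0.
have /eqP : (digit l m k)%:R - (digit l n k)%:R = 0 :> 'F_l.
  apply: (fX _ (Ordinal kc)).
  rewrite (eq_bigr (fun i : 'I_c => ((digit l m i)%:R * red (eps i) : Rp) -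
      ((digit l n i)%:R * red (eps i) : Rp))); last first.
    move=> i _; rewrite scalerBl (nth_map i) ?size_enum_ord// nth_ord_enum.
    by rewrite /GRing.scale /= /pprimeChar_scale !Fl.
  by rewrite sumrB; apply/eqP; rewrite subr_eq0; apply/eqP.
rewrite subr_eq0 => /eqP/(congr1 (fun z : 'F_l => z : nat)).
by rewrite !Fl.
Qed.

Lemma lead_bij : bijective (fun m : 'I_q => red (lead m)).
Proof.
apply: inj_card_bij; last by rewrite card_ord.
by move=> m n /red_lead_inj mn; apply/val_inj/mn; exact: ltn_ord.
Qed.

Lemma abs_u_digit_le m : abs (ud m) <= (abs varpi)^-1.
Proof.
rewrite ud_lead absM absV ger_pMl ?invr_gt0 ?abs_varpi_gt0//; exact: lead_int.
Qed.

Lemma abs_u_rep_le n j : (n < q ^ j)%N -> abs (u n) <= abs varpi ^ (- j%:Z).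
Proof.
move=> nj; rewrite (u_repE nj); apply: abs_sum_le; first by rewrite ltW// rad_gt0.
move=> k; rewrite absM absV absX.
apply: (@le_trans _ _ (abs varpi ^ (- (k.+1)%:Z))); last first.
  by apply: ler_rad; rewrite lerN2 lez_nat.
rewrite -invr_expz -exprnP exprS invfM ler_pM2r ?abs_u_digit_le//.
by rewrite invr_gt0 exprn_gt0// abs_varpi_gt0.
Qed.

Variable chi : K -> R[i].
Hypothesis chi_char : character chi.
Hypothesis chi_trivial : forall x, D x -> chi x = 1.
Hypothesis chi_nontrivial : exists2 x, prime_ideal_pow abs varpi (-1) x & chi x <> 1.

Lemma chiD x y : chi (x + y) = chi x * chi y.
Proof. by case: chi_char. Qed.

Lemma normc_chi x : Normc.normc (chi x) = 1.
Proof. by case: chi_char. Qed.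

Lemma chi0 : chi 0 = 1.
Proof. by apply: chi_trivial; rewrite /integers/= abs0. Qed.

Lemma chi_neq0 x : chi x != 0.
Proof.
apply/eqP => x0; have := normc_chi x.
by rewrite x0 Normc.normc0 => /eqP; rewrite eq_sym oner_eq0.
Qed.

Lemma chi_conj x : chi x * conjc (chi x) = 1.
Proof.
have := normc_chi x; case: (chi x) => a b /= ab; apply/eqP.
have E : a ^+ 2 + b ^+ 2 = 1 by rewrite -[LHS]sqr_sqrtr ?addr_ge0 ?sqr_ge0// ab expr1n.
by rewrite eq_complex /=; apply/andP; split; apply/eqP; [rewrite -E|]; ring.
Qed.

Lemma chiN x : chi (- x) = conjc (chi x).
Proof. by apply: (mulfI (chi_neq0 x)); rewrite -chiD subrr chi0 chi_conj. Qed.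

Lemma chi_eq x y : D (x - y) -> chi x = chi y.
Proof. by move=> Dxy; rewrite -(subrK y x) chiD (chi_trivial Dxy) mul1r. Qed.

Lemma chi_eqM (x y z : K) : abs x * abs (y - z) <= 1 -> chi (x * y) = chi (x * z).
Proof. by move=> h; apply: chi_eq; rewrite -mulrBr /integers/= absM. Qed.

(** The sum over the residue field of a nontrivial character of it. *)
Lemma chi_sum_sec y : abs y = (abs varpi)^-1 -> \sum_(z : F) chi (y * sec z) = 0.
Proof.
move=> yv.
have y0 : y != 0.
  by apply: contraTneq abs_varpi_gt0 => y0; rewrite -[abs varpi]invrK -yv y0 abs0 invr0 ltxx.
have sec_add z z' : chi (y * sec (z + z')) = chi (y * sec z) * chi (y * sec z').
  rewrite -chiD -mulrDr; apply: chi_eqM; rewrite yv.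
  have Ds : D (sec z + sec z') by apply: abs_addr_le; exact: sec_int.
  have : P (sec (z + z') - (sec z + sec z')).
    apply/(red_eq (sec_int _) Ds).
    by rewrite redD ?red_sec//; exact: sec_int.
  rewrite prime_idealE /cball/= subr0 expr1z => h.
  by rewrite mulrC ler_pdivrMr ?abs_varpi_gt0// mul1r.
have [d Dd chid] : exists2 d, D d & chi (y * d) <> 1.
  have [x [e De <-] chix] := chi_nontrivial.
  exists (varpi ^ (-1) * e / y); last by rewrite mulrC divfK.
  rewrite /integers/= !absM absV yv invrK -invr_expz expr1z absV.
  by rewrite mulrAC mulVf ?mul1r// gt_eqF// abs_varpi_gt0.
pose z0 := red d.
have chiz0 : chi (y * sec z0) != 1.
  apply/eqP => h; apply: chid; rewrite -h; apply: chi_eqM; rewrite yv.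
  have : P (d - sec z0) by apply/(red_eq Dd (sec_int _)); rewrite red_sec.
  rewrite prime_idealE /cball/= subr0 expr1z => h'.
  by rewrite mulrC ler_pdivrMr ?abs_varpi_gt0// mul1r.
set S := \sum_z _.
have : S = chi (y * sec z0) * S.
  rewrite {1}/S (reindex_inj (addrI z0)) mulr_sumr.
  by apply: eq_bigr => z _; rewrite sec_add.
move/eqP; rewrite -subr_eq0 -[X in X - _]mul1r -mulrBl mulf_eq0 subr_eq0 eq_sym.
by rewrite (negbTE chiz0) => /eqP.
Qed.

(** The products [u m * v] run through representatives of all residues divided by
    [varpi], on which [chi] is a nontrivial character unless [v] is in the prime
    ideal. *)
Lemma chi_sum_u v : D v ->
  \sum_(m < q) chi (u m * v) = if `[< P v >] then q%:R else 0.
Proof.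
move=> Dv; case: asboolP => Pv.
  rewrite (eq_bigr (fun=> 1)); first by rewrite sumr_const card_ord.
  move=> m _; apply: chi_trivial; rewrite u_rep_small//.
  move: Pv; rewrite prime_idealE /cball/integers/= subr0 expr1z absM => Pv.
  apply: (@le_trans _ _ ((abs varpi)^-1 * abs varpi)).
    by rewrite ler_pM ?abs_ge0 ?abs_u_digit_le.
  by rewrite mulVf// gt_eqF// abs_varpi_gt0.
have v1 : abs v = 1.
  by apply/eqP; rewrite eq_le Dv leNgt; apply/negP => /Pv.
rewrite -[RHS](@chi_sum_sec (v / varpi)); last by rewrite absM v1 absV mul1r.
rewrite (reindex _ (onW_bij _ lead_bij)); apply: eq_bigr => m _.
have -> : u m * v = v / varpi * lead m.
  by rewrite u_rep_small// ud_lead; field; exact: varpi_neq0.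
apply: chi_eqM; set e := lead m - _.
have : P e by apply/(red_eq (lead_int _) (sec_int _)); rewrite red_sec.
rewrite prime_idealE /cball/integers/= subr0 expr1z => h.
by rewrite absM v1 mul1r absV mulrC ler_pdivrMr ?abs_varpi_gt0// mul1r.
Qed.

(** * Averages, characters and partial sums *)

Definition rmeas (f : K -> R) := measurable_fun (D : set (borel K)) (f : borel K -> R).

Definition rint (f : K -> R) :=
  mu.-integrable (D : set (borel K)) (EFin \o (f : borel K -> R)).

Section RealAverages.
Implicit Types (f g : K -> R).

Lemma measurable_D : measurable (D : set (borel K)).
Proof. by rewrite integersE; exact: measurable_cball. Qed.

Lemma rint_meas f : rint f -> rmeas f.
Proof. by move=> /measurable_int/measurable_EFinP. Qed.

Lemma rint_cst r : rint (fun=> r).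
Proof.
apply: measurable_bounded_integrable => //; first exact: measurable_D.
  by rewrite mu1 ltry.
exists `|r|; split; first exact: num_real.
by move=> M rM x _ /=; exact: ltW.
Qed.

Lemma rintD f g : rint f -> rint g -> rint (fun x => f x + g x).
Proof. by move=> fi gi; have := integrableD measurable_D fi gi. Qed.

Lemma rintZ r f : rint f -> rint (fun x => r * f x).
Proof. by move=> fi; have := integrableZl measurable_D r fi. Qed.

Lemma rintN f : rint f -> rint (fun x => - f x).
Proof. by move=> fi; have := integrableN fi. Qed.

Lemma rintB f g : rint f -> rint g -> rint (fun x => f x - g x).
Proof. by move=> fi gi; apply: rintD => //; exact: rintN. Qed.

Lemma rint_le f g : rmeas f -> (forall x, D x -> `|f x| <= g x) -> rint g -> rint f.
Proof.
move=> fm fg gi; apply: (le_integrable measurable_D _ _ gi).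
  exact/measurable_EFinP.
by move=> x Dx /=; rewrite lee_fin (le_trans (fg x Dx))// ler_norm.
Qed.

Lemma rint_norm f : rint f -> rint (fun x => `|f x|).
Proof.
move=> fi; have := integrable_abse fi; apply: eq_integrable => //.
exact: measurable_D.
Qed.

Lemma rintM (B : R) f g : rint f -> rmeas g -> (forall x, D x -> `|g x| <= B) ->
  rint (fun x => f x * g x).
Proof.
move=> fi gm gB; apply: (@rint_le _ (fun x => B * `|f x|)).
- by apply: measurable_funM => //; exact: rint_meas.
- by move=> x Dx; rewrite normrM mulrC ler_wpM2r// gB.
- exact/rintZ/rint_norm.
Qed.

Lemma eq_rint f g : (forall x, D x -> f x = g x) -> rint f -> rint g.
Proof.
move=> fg; apply: eq_integrable; first exact: measurable_D.
by move=> x; rewrite inE => Dx /=; rewrite fg.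
Qed.

(** ** Averages over balls *)

Definition node_ok (Q : K * nat) := D Q.1.

Definition node_child (Q : K * nat) z := (child Q.1 Q.2 z, Q.2.+1).

Definition nball (Q : K * nat) : set K := cball Q.1 Q.2.

(** The measure of the ball of radius [abs varpi ^+ j] is its radius. *)
Definition av f (Q : K * nat) : R :=
  (abs varpi ^- Q.2) * \int[mu]_(x in nball Q) f x.

Implicit Type Q : K * nat.

Lemma PoszD1 (k : nat) : k%:Z + 1 = k.+1%:Z.
Proof. by rewrite -addn1 PoszD. Qed.

Lemma nball_sub Q : node_ok Q -> nball Q `<=` D.
Proof.
case: Q => a j Da x xa; rewrite /integers/= -(subrK a x).
by apply: abs_addr_le => //; apply: (le_trans xa); have := @ler_rad 0 j isT; rewrite expr0z.
Qed.

Lemma node_child_ok Q z : node_ok Q -> node_ok (node_child Q z).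
Proof.
move=> okQ; apply: (nball_sub okQ); have := @child_sub Q.1 Q.2 z; rewrite PoszD1; apply.
exact: cball_center.
Qed.

Lemma measurable_nball Q : measurable (nball Q : set (borel K)).
Proof. exact: measurable_cball. Qed.

Lemma nball_D : nball (0, 0%N) = D.
Proof. by rewrite integersE. Qed.

Lemma nball_self x j : nball (x, j) x.
Proof. exact: cball_center. Qed.

Lemma rint_nball f Q : node_ok Q -> rint f ->
  mu.-integrable (nball Q : set (borel K)) (EFin \o (f : borel K -> R)).
Proof.
move=> okQ; apply: integrableS; [exact: measurable_D|exact: measurable_nball|].
exact: nball_sub.
Qed.

Lemma nball_rad_gt0 (j : nat) : 0 < abs varpi ^- j.
Proof. by rewrite invr_gt0 exprn_gt0// abs_varpi_gt0. Qed.

Lemma eq_av f g Q : (forall x, nball Q x -> f x = g x) -> av f Q = av g Q.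
Proof.
by move=> fg; congr (_ * _); apply: eq_Rintegral => x; rewrite inE; exact: fg.
Qed.

Lemma avD f g Q : node_ok Q -> rint f -> rint g ->
  av (fun x => f x + g x) Q = av f Q + av g Q.
Proof.
move=> okQ fi gi.
have := RintegralD (measurable_nball Q) (rint_nball okQ fi) (rint_nball okQ gi).
by rewrite /av => ->; rewrite mulrDr.
Qed.

Lemma avZ r f Q : node_ok Q -> rint f -> av (fun x => r * f x) Q = r * av f Q.
Proof.
move=> okQ fi.
by rewrite /av (RintegralZl r (measurable_nball Q) (rint_nball okQ fi)) mulrCA.
Qed.

Lemma avN f Q : node_ok Q -> rint f -> av (fun x => - f x) Q = - av f Q.
Proof.
move=> okQ fi; rewrite -mulN1r -avZ//; apply: eq_av => x _; by rewrite mulN1r.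
Qed.

Lemma avB f g Q : node_ok Q -> rint f -> rint g ->
  av (fun x => f x - g x) Q = av f Q - av g Q.
Proof. by move=> okQ fi gi; rewrite avD// ?avN//; exact: rintN. Qed.

Lemma av_cst r Q : av (fun=> r) Q = r.
Proof.
rewrite /av Rintegral_cst; last exact: measurable_nball.
by rewrite measure_cball -exprnP mulrCA mulVf ?mulr1// expf_neq0// gt_eqF// abs_varpi_gt0.
Qed.

Lemma av_ge0 f Q : (forall x, nball Q x -> 0 <= f x) -> 0 <= av f Q.
Proof.
by move=> f0; rewrite mulr_ge0 ?(ltW (nball_rad_gt0 _))//; exact: Rintegral_ge0.
Qed.

Lemma ler_av f g Q : node_ok Q -> rint f -> rint g ->
  (forall x, nball Q x -> f x <= g x) -> av f Q <= av g Q.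
Proof.
move=> okQ fi gi fg; rewrite -subr_ge0 -avB//; apply: av_ge0 => x Qx.
by rewrite subr_ge0 fg.
Qed.

Lemma ler_norm_av f Q : node_ok Q -> rint f -> `|av f Q| <= av (fun x => `|f x|) Q.
Proof.
move=> okQ fi; have fi' := rint_norm fi.
rewrite ler_norml -avN// !ler_av//; try exact: rintN; move=> x _;
  by [exact: ler_norm|rewrite lerNl -normrN ler_norm].
Qed.

Lemma av_martingale f : rint f -> martingale node_child node_ok (av f).
Proof.
move=> fi Q okQ.
have fm : measurable_fun (cball Q.1 Q.2 : set (borel K)) (f : borel K -> R).
  by apply/measurable_EFinP; exact: measurable_int (rint_nball okQ fi).
have := integral_child fm; rewrite /av /mean /Rintegral PoszD1 => /(congr1 fine).
rewrite [fine (\sum_(z : F) _)%E](_ : _ = \sum_(z : F)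
   fine (\int[mu]_(x in nball (node_child Q z)) (f x)%:E)); last first.
  rewrite -sum_fine// => z _.
  have := integrable_fin_num (measurable_nball (node_child Q z))
    (rint_nball (node_child_ok z okQ) fi).
  by [].
rewrite /nball/= => ->; rewrite -mulr_sumr mulrA; congr (_ * _).
by rewrite -abs_varpiE exprS invfM mulrA mulfV ?mul1r// gt_eqF// abs_varpi_gt0.
Qed.

End RealAverages.

Implicit Types (Q : K * nat).

(** ** Complex averages and characters *)

Local Notation Re := (@complex.Re R).
Local Notation Im := (@complex.Im R).
Local Notation normc := (@Normc.normc R).

Definition cint (f : K -> R[i]) := rint (fun x => Re (f x)) /\ rint (fun x => Im (f x)).

Definition cmeas (f : K -> R[i]) := rmeas (fun x => Re (f x)) /\ rmeas (fun x => Im (f x)).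

Definition cav (f : K -> R[i]) Q : R[i] :=
  Complex (av (fun x => Re (f x)) Q) (av (fun x => Im (f x)) Q).

Lemma eq_cav (f g : K -> R[i]) Q : (forall x, nball Q x -> f x = g x) -> cav f Q = cav g Q.
Proof. by move=> fg; congr Complex; apply: eq_av => x /fg ->. Qed.

Lemma eq_cint (f g : K -> R[i]) : (forall x, D x -> f x = g x) -> cint f -> cint g.
Proof. by move=> fg [fr fi]; split; [apply: eq_rint fr|apply: eq_rint fi] => x /fg ->. Qed.

Lemma cint_cmeas (f : K -> R[i]) : cint f -> cmeas f.
Proof. by case=> fr fi; split; exact: rint_meas. Qed.

Lemma cintD (f g : K -> R[i]) : cint f -> cint g -> cint (fun x => f x + g x).
Proof.
move=> [fr fi] [gr gi]; split.
  by apply: eq_rint (rintD fr gr) => x _; rewrite ReD.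
by apply: eq_rint (rintD fi gi) => x _; rewrite ImD.
Qed.

Lemma cint_cst (z : R[i]) : cint (fun=> z).
Proof. by split; exact: rint_cst. Qed.

Lemma cmeasM (f g : K -> R[i]) : cmeas f -> cmeas g -> cmeas (fun x => f x * g x).
Proof.
move=> [fr fi] [gr gi]; split; rewrite /rmeas.
  rewrite (_ : (fun x => _) = (fun x => Re (f x) * Re (g x) - Im (f x) * Im (g x))).
    by apply: measurable_funB; exact: measurable_funM.
  by apply/funext => x; rewrite ReM.
rewrite (_ : (fun x => _) = (fun x => Re (f x) * Im (g x) + Im (f x) * Re (g x))).
  by apply: measurable_funD; exact: measurable_funM.
by apply/funext => x; rewrite ImM.
Qed.

Lemma cmeasD (f g : K -> R[i]) : cmeas f -> cmeas g -> cmeas (fun x => f x + g x).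
Proof.
move=> [fr fi] [gr gi]; split; rewrite /rmeas.
  rewrite (_ : (fun x => _) = (fun x => Re (f x) + Re (g x))); first exact: measurable_funD.
  by apply/funext => x; rewrite ReD.
rewrite (_ : (fun x => _) = (fun x => Im (f x) + Im (g x))); first exact: measurable_funD.
by apply/funext => x; rewrite ImD.
Qed.

Lemma rmeas_normc (f : K -> R[i]) : cmeas f -> rmeas (fun x => normc (f x)).
Proof.
move=> [fr fi]; rewrite /rmeas (_ : (fun x => _) =
    Num.sqrt \o (fun x => Re (f x) ^+ 2 + Im (f x) ^+ 2)); last first.
  apply/funext => x /=; rewrite -[LHS]ger0_norm ?normc_ge0// -sqrtr_sqr.
  by rewrite sqr_normc2.
apply: (measurable_comp (F := setT)) => //.
  apply: continuous_measurable_fun; exact: sqrt_continuous.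
by apply: measurable_funD; exact: measurable_funX.
Qed.

Lemma cint_normc (f : K -> R[i]) : cint f -> rint (fun x => normc (f x)).
Proof.
move=> fi; apply: (@rint_le _ (fun x => `|Re (f x)| + `|Im (f x)|)).
- by apply: rmeas_normc; exact: cint_cmeas.
- by move=> x _; rewrite ger0_norm ?normc_ge0// ler_normc_ReIm.
- by case: fi => fr fi; apply: rintD; exact: rint_norm.
Qed.

Lemma cint_le (f : K -> R[i]) (g : K -> R) : cmeas f -> (forall x, D x -> normc (f x) <= g x) ->
  rint g -> cint f.
Proof.
move=> [fr fi] fg gi; split.
  by apply: rint_le fr _ gi => x Dx; exact: le_trans (ler_Re_normc _) (fg x Dx).
by apply: rint_le fi _ gi => x Dx; exact: le_trans (ler_Im_normc _) (fg x Dx).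
Qed.

Lemma cintM (B : R) (f g : K -> R[i]) : cint f -> cmeas g ->
  (forall x, D x -> normc (g x) <= B) -> cint (fun x => f x * g x).
Proof.
move=> fi gm gB; apply: (@cint_le _ (fun x => B * normc (f x))).
- by apply: cmeasM => //; exact: cint_cmeas.
- by move=> x Dx; rewrite Normc.normcM mulrC ler_wpM2r ?normc_ge0// gB.
- by apply: rintZ; exact: cint_normc.
Qed.

Lemma cintZ (z : R[i]) (f : K -> R[i]) : cint f -> cint (fun x => z * f x).
Proof.
move=> fi; have := cintM (B := normc z) fi (cint_cmeas (cint_cst z)) (fun _ _ => lexx _).
by apply: eq_cint => x _; rewrite mulrC.
Qed.

Lemma cint_sum (I : Type) (s : seq I) (f : I -> K -> R[i]) :
  (forall i, cint (f i)) -> cint (fun x => \sum_(i <- s) f i x).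
Proof.
move=> fi; elim: s => [|i s IH].
  by apply: eq_cint (cint_cst 0) => x _; rewrite big_nil.
by apply: eq_cint (cintD (fi i) IH) => x _; rewrite big_cons.
Qed.

Lemma cavD (f g : K -> R[i]) Q : node_ok Q -> cint f -> cint g ->
  cav (fun x => f x + g x) Q = cav f Q + cav g Q.
Proof.
move=> okQ [fr fi] [gr gi]; apply: eqC => /=.
  by rewrite -avD//; apply: eq_av => x _; rewrite ReD.
by rewrite -avD//; apply: eq_av => x _; rewrite ImD.
Qed.

Lemma cavZ (z : R[i]) (f : K -> R[i]) Q : node_ok Q -> cint f ->
  cav (fun x => z * f x) Q = z * cav f Q.
Proof.
move=> okQ [fr fi]; apply: eqC.
  rewrite ReM /= -!avZ// -avB//; try exact: rintZ.
  by apply: eq_av => x _; rewrite ReM.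
rewrite ImM /= -!avZ// -avD//; try exact: rintZ.
by apply: eq_av => x _; rewrite ImM.
Qed.

Lemma cav_cst (z : R[i]) Q : cav (fun=> z) Q = z.
Proof. by rewrite /cav !av_cst; case: z. Qed.

Lemma cav_sum (I : Type) (s : seq I) (f : I -> K -> R[i]) Q : node_ok Q ->
  (forall i, cint (f i)) -> cav (fun x => \sum_(i <- s) f i x) Q = \sum_(i <- s) cav (f i) Q.
Proof.
move=> okQ fi; elim: s => [|i s IH].
  by rewrite big_nil -[RHS](cav_cst 0 Q); apply: eq_cav => x _; rewrite big_nil.
rewrite big_cons -IH -cavD//; last exact: cint_sum.
by apply: eq_cav => x _; rewrite big_cons.
Qed.

Lemma cav_pull (z : R[i]) (f g : K -> R[i]) Q : node_ok Q -> cint f ->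
  (forall x, nball Q x -> g x = z) -> cav (fun x => f x * g x) Q = cav f Q * z.
Proof.
move=> okQ fi gz; rewrite mulrC -cavZ//; apply: eq_cav => x /gz ->.
by rewrite mulrC.
Qed.

Lemma cav_child (f : K -> R[i]) Q : node_ok Q -> cint f ->
  cav f Q = (#|F|%:R^-1 : R)%:C%C * \sum_(z : F) cav f (node_child Q z).
Proof.
move=> okQ [fr fi]; rewrite mulr_sumr; apply: eqC.
  rewrite /= (av_martingale fr)// /mean mulr_sumr (big_morph Re (id1 := 0) (op1 := +%R))//.
    by apply: eq_bigr => z _; rewrite ReM /= mul0r subr0.
  exact: ReD.
rewrite /= (av_martingale fi)// /mean mulr_sumr (big_morph Im (id1 := 0) (op1 := +%R))//.
  by apply: eq_bigr => z _; rewrite ImM /= mul0r addr0.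
exact: ImD.
Qed.

Lemma normc_cav (f : K -> R[i]) Q : node_ok Q -> cint f ->
  `|Re (cav f Q)| <= av (fun x => normc (f x)) Q /\ `|Im (cav f Q)| <= av (fun x => normc (f x)) Q.
Proof.
move=> okQ [fr fi]; have ni := cint_normc (conj fr fi).
split; apply: le_trans (ler_norm_av okQ _) _ => //; apply: ler_av => //;
  try exact: rint_norm; move=> x _; [exact: ler_Re_normc|exact: ler_Im_normc].
Qed.

Lemma locconst_rmeas (k : nat) (f : K -> R) : (forall x t, cball x k t -> f t = f x) -> rmeas f.
Proof.
move=> fk; apply: (measurable_funS measurableT) => // _ Y mY; rewrite setTI.
apply: open_measurableK; rewrite openE => x Yx; rewrite /interior/=.
apply: filterS (open_nbhs_nbhs (conj (open_cball x k) (cball_center x k))) => t xt.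
by rewrite /preimage/= (fk _ _ xt).
Qed.

Lemma chi_locconst y : exists k : nat, forall x t, cball x k t -> chi (y * t) = chi (y * x).
Proof.
have [->|y0] := eqVneq y 0; first by exists 0%N => x t _; rewrite !mul0r.
have yV : 0 < (abs y)^-1 by rewrite invr_gt0 abs_gt0.
have [k yk] := rad_small yV.
exists k => x t xt; apply: chi_eqM.
rewrite -ler_pdivlMl ?abs_gt0// mulr1; exact: le_trans xt (ltW yk).
Qed.

Lemma chi_cmeas y : cmeas (fun x => chi (y * x)).
Proof.
have [k yk] := chi_locconst y.
by split; apply: (@locconst_rmeas k) => x t xt; rewrite (yk _ _ xt).
Qed.

Lemma cint_chi y (f : K -> R[i]) : cint f -> cint (fun x => f x * chi (y * x)).
Proof.
move=> fi; apply: (cintM (B := 1)) => //; first exact: chi_cmeas.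
by move=> x _; rewrite normc_chi.
Qed.

Lemma cint_conjchi y (f : K -> R[i]) : cint f -> cint (fun x => f x * conjc (chi (y * x))).
Proof.
move=> fi; apply: eq_cint (cint_chi (- y) fi) => x _.
by rewrite mulNr chiN.
Qed.

Lemma cintegralE (f : K -> R[i]) : cintegral mu D f = cav f (0, 0%N).
Proof. by rewrite /cintegral /cav /av expr0 invr1 !mul1r nball_D. Qed.

(** ** Partial sums *)

Implicit Types (f h : K -> R[i]).

Local Notation S := (fourier_sum mu D chi u).
Local Notation root := ((0 : K), 0%N).

(** Conjugate characters lower the frequencies by [y]. *)
Definition modulate y (f : K -> R[i]) t : R[i] := f t * conjc (chi (y * t)).

Lemma root_ok : node_ok root.
Proof. by rewrite /node_ok/integers/= abs0. Qed.

Lemma cint_modulate y f : cint f -> cint (modulate y f).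
Proof. exact: cint_conjchi. Qed.

Lemma fourier_sumE n f x :
  S n f x = \sum_(k < n) cav (modulate (u k) f) root * chi (u k * x).
Proof. by apply: eq_bigr => k _; rewrite /fourier_coef cintegralE. Qed.

Lemma modulateD y y' f : modulate (y + y') f = modulate y (modulate y' f).
Proof.
by apply/funext => t; rewrite /modulate mulrDl chiD rmorphM/= mulrA mulrAC.
Qed.

(** The value [u (i * q ^ j)]: the frequencies below [q ^ j.+1] are the sums of
    one of these with a frequency below [q ^ j]. *)
Definition freq j i : K := ud i * varpi ^- j.

Lemma u_repD_freq (k i j : nat) : (k < q ^ j)%N -> (i < q)%N -> u (k + i * q ^ j) = u k + freq j i.
Proof. exact: u_repD. Qed.

Lemma fourier_block n i j f x : (n <= q ^ j)%N -> (i < q)%N ->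
  \sum_(k < n) cav (modulate (u (k + i * q ^ j)) f) root * chi (u (k + i * q ^ j) * x) =
  S n (modulate (freq j i) f) x * chi (freq j i * x).
Proof.
move=> nj iq; rewrite fourier_sumE mulr_suml; apply: eq_bigr => k _.
rewrite u_repD_freq//; last by apply: leq_trans nj.
by rewrite modulateD mulrDl chiD mulrA.
Qed.

Lemma fourier_sum_blocks m j f x : (m <= q)%N ->
  S (m * q ^ j) f x = \sum_(i < m) S (q ^ j) (modulate (freq j i) f) x * chi (freq j i * x).
Proof.
elim: m => [|m IH] mq; first by rewrite mul0n fourier_sumE !big_ord0.
rewrite big_ord_recr/= -IH; last exact: ltnW.
rewrite -fourier_block// mulSn addnC !fourier_sumE big_split_ord/=; congr (_ + _).
by apply: eq_bigr => k _; rewrite addnC.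
Qed.

Lemma fourier_sum_rec n m j f x : (n < q ^ j)%N -> (m < q)%N ->
  S (n + m * q ^ j) f x =
  \sum_(i < m) S (q ^ j) (modulate (freq j i) f) x * chi (freq j i * x) +
  S n (modulate (freq j m) f) x * chi (freq j m * x).
Proof.
move=> nj mq; rewrite -fourier_sum_blocks; last exact: ltnW.
rewrite -fourier_block//; last exact: ltnW.
rewrite addnC !fourier_sumE big_split_ord/=; congr (_ + _).
by apply: eq_bigr => k _; rewrite addnC.
Qed.

Lemma chi_nball y x j t : abs y <= abs varpi ^- j -> nball (x, j) t ->
  chi (y * t) = chi (y * x).
Proof.
move=> yj xt; apply: chi_eqM.
have j0 : 0 < abs varpi ^+ j by rewrite exprn_gt0// abs_varpi_gt0.
by rewrite -(mulVf (lt0r_neq0 j0)) ler_pM ?abs_ge0.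
Qed.

Lemma abs_freq_le j i : abs (freq j i) <= abs varpi ^- j.+1.
Proof.
rewrite absM absV absX exprS invfM ler_pM2r ?abs_u_digit_le//.
exact: nball_rad_gt0.
Qed.

Lemma nball_eq x t j : nball (x, j) t -> nball (t, j) = nball (x, j).
Proof. exact: cball_eq. Qed.

Lemma eq_cav_nball f x t j : nball (x, j) t -> cav f (t, j) = cav f (x, j).
Proof. by move=> xt; rewrite /cav /av (nball_eq xt). Qed.

Lemma cav_modulate_child f y x j z : node_ok (x, j) -> cint f ->
  abs y <= abs varpi ^- j.+1 ->
  cav (fun t => f t * chi (y * t)) (node_child (x, j) z) =
  cav f (node_child (x, j) z) * (chi (y * x) * chi (y * (sec z * varpi ^+ j))).
Proof.
move=> okQ fi yj; apply: cav_pull => //; first exact: node_child_ok.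
by move=> t xt; rewrite (chi_nball yj xt) /child mulrDr chiD.
Qed.

(** By induction the sum of length [q ^ j.+1] consists of [q] averages of
    modulated functions over the ball of radius [q ^- j]; summing the characters
    over [i] kills all children of this ball but the one that contains [x]. *)
Lemma fourier_sum_average j f x : cint f -> D x -> S (q ^ j) f x = cav f (x, j).
Proof.
elim: j f => [|j IH] f fi Dx.
  rewrite expn0 fourier_sumE big_ord_recl big_ord0 addr0 u_rep0 mul0r chi0 mulr1.
  have xx : nball (0, 0%N) x by rewrite nball_D.
  rewrite (eq_cav_nball _ xx); apply: eq_cav => t _.
  by rewrite /modulate mul0r chi0 conjc1 mulr1.
rewrite expnS fourier_sum_blocks//.
have okx : node_ok (x, j) by [].
transitivity (\sum_(i < q) \sum_(z : F) (#|F|%:R^-1 : R)%:C%C *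
    (cav f (node_child (x, j) z) * conjc (chi (u i * sec z)))).
  apply: eq_bigr => i _; rewrite IH//; last exact: cint_modulate.
  rewrite (cav_child okx); last exact: cint_modulate.
  rewrite -mulrA mulr_suml mulr_sumr; apply: eq_bigr => z _; congr (_ * _).
  have -> : modulate (freq j i) f = (fun t => f t * chi (- freq j i * t)).
    by apply/funext => t; rewrite /modulate mulNr chiN.
  rewrite cav_modulate_child ?absN ?abs_freq_le//.
  set a := cav f _; set e := chi (- freq j i * (_ * _)).
  transitivity (a * e * (chi (freq j i * x) * chi (- freq j i * x))); first by ring.
  rewrite [- _ * x]mulNr chiN chi_conj mulr1 /e mulNr chiN; congr (_ * conjc (chi _)).
  rewrite u_rep_small// /freq mulrCA -mulrA mulVf ?mulr1 1?mulrC//.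
  by rewrite expf_neq0// varpi_neq0.
rewrite exchange_big (bigD1 (0 : F))//= [X in _ + X]big1 ?addr0; last first.
  move=> z z0; rewrite -mulr_sumr -mulr_sumr -rmorph_sum chi_sum_u; last exact: sec_int.
  case: asboolP => [Pz|_]; last by rewrite rmorph0 !mulr0.
  move: z0; rewrite -(red_sec z) (residue_map_ker red_residue (sec_int z)).2//.
  by rewrite eqxx.
rewrite -!mulr_sumr -rmorph_sum chi_sum_u; last exact: sec_int.
have Ps : P (sec 0).
  by apply/(residue_map_ker red_residue (sec_int 0)); rewrite red_sec.
case: asboolP => // _; rewrite rmorph_nat mulrCA.
have -> : ((#|F|%:R^-1 : R)%:C%C * #|F|%:R = 1 :> R[i]).
  have -> : (#|F|%:R : R[i]) = real_complex R #|F|%:R by rewrite rmorph_nat.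
  rewrite -[_%:C%C]/(real_complex R _) -rmorphM mulVf ?rmorph1//.
  by rewrite pnatr_eq0 -lt0n q_gt0.
rewrite mulr1; rewrite /node_child/=; apply: eq_cav_nball.
rewrite /nball/cball/child/= addrAC subrr add0r absM absX -exprnP exprS.
by rewrite ler_pM2r ?exprn_gt0 ?abs_varpi_gt0//; case: varpi_prime => _; exact.
Qed.

Lemma fourier_sum_bounded n f x : normc (S n f x) <= \sum_(k < n) normc (cav (modulate (u k) f) root).
Proof.
rewrite fourier_sumE; apply: le_trans (normc_sum _ _ _) _; apply: ler_sum => k _.
by rewrite Normc.normcM normc_chi mulr1.
Qed.

Lemma cmeas_sum (I : Type) (s : seq I) (f : I -> K -> R[i]) :
  (forall i, cmeas (f i)) -> cmeas (fun x => \sum_(i <- s) f i x).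
Proof.
move=> fm; elim: s => [|i s IH].
  have [fr fi] := cint_cmeas (cint_cst 0).
  by rewrite (_ : (fun x => _) = (fun=> 0))//; apply/funext => x; rewrite big_nil.
rewrite (_ : (fun x => _) = (fun x => f i x + \sum_(i <- s) f i x)); first exact: cmeasD.
by apply/funext => x; rewrite big_cons.
Qed.

Lemma fourier_sum_cmeas n f : cmeas (S n f).
Proof.
rewrite (_ : S n f = fun x => \sum_(k < n) cav (modulate (u k) f) root * chi (u k * x)).
  apply: cmeas_sum => k; apply: cmeasM; last exact: chi_cmeas.
  exact/cint_cmeas/cint_cst.
by apply/funext => x; exact: fourier_sumE.
Qed.

Lemma cint_fourier_sumM n f h : cint h -> cint (fun x => S n f x * h x).
Proof.
move=> hi; have := cintM hi (fourier_sum_cmeas n f) (fun x _ => fourier_sum_bounded n f x).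
by apply: eq_cint => x _; rewrite mulrC.
Qed.

Lemma cint_fourier_sum n f : cint (S n f).
Proof.
have := cint_fourier_sumM n f (cint_cst 1).
by apply: eq_cint => x _; rewrite mulr1.
Qed.

Definition cosc f Q : R :=
  osc node_child (av (fun x => Re (f x))) Q + osc node_child (av (fun x => Im (f x))) Q.

Lemma cosc_ge0 f Q : 0 <= cosc f Q.
Proof. by rewrite addr_ge0//; apply: mean_ge0. Qed.

Lemma chi_sum_ball y j : abs y = abs varpi ^- j.+1 ->
  \sum_(z : F) chi (y * (sec z * varpi ^+ j)) = 0.
Proof.
move=> yj; transitivity (\sum_z chi (y * varpi ^+ j * sec z)).
  by apply: eq_bigr => z _; rewrite -mulrA [varpi ^+ j * _]mulrC.
apply: chi_sum_sec.
rewrite absM absX yj exprS invfM -mulrA mulVf ?mulr1//.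
by rewrite expf_neq0// gt_eqF// abs_varpi_gt0.
Qed.

(** A character of the next generation has mean [0] over the ball and is
    constant on its children, so it only sees the oscillation. *)
Lemma normc_cav_chi f y Q : node_ok Q -> cint f -> abs y = abs varpi ^- Q.2.+1 ->
  normc (cav (fun t => f t * chi (y * t)) Q) <= cosc f Q.
Proof.
case: Q => x j okQ fi yj.
have fiy := cint_chi y fi.
rewrite (cav_child okQ fiy).
have -> : \sum_z cav (fun t => f t * chi (y * t)) (node_child (x, j) z) =
    \sum_z (cav f (node_child (x, j) z) - cav f (x, j)) *
      (chi (y * x) * chi (y * (sec z * varpi ^+ j))).
  transitivity (\sum_z cav f (node_child (x, j) z) *
      (chi (y * x) * chi (y * (sec z * varpi ^+ j))) -
      cav f (x, j) * (chi (y * x) * \sum_z chi (y * (sec z * varpi ^+ j)))).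
    rewrite chi_sum_ball// !mulr0 subr0; apply: eq_bigr => z _.
    by apply: cav_modulate_child => //; rewrite yj.
  rewrite !mulr_sumr -sumrB; apply: eq_bigr => z _.
  by rewrite mulrBl.
rewrite Normc.normcM normc_real ?invr_ge0//.
rewrite /cosc /osc -meanD /mean ler_wpM2l ?invr_ge0//.
apply: le_trans (normc_sum _ _ _) _; apply: ler_sum => z _.
rewrite Normc.normcM [normc (chi _ * _)]Normc.normcM !normc_chi !mulr1.
exact: ler_normc_ReIm.
Qed.

Lemma abs_freqB j m i : (m < q)%N -> (i < q)%N -> m != i ->
  abs (freq j m - freq j i) = abs varpi ^- j.+1.
Proof.
move=> mq iq mi.
have -> : freq j m - freq j i = (lead m - lead i) * (varpi^-1 * varpi ^- j).
  by rewrite /freq !ud_lead -!mulrA -mulrBl.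
rewrite absM absM !absV absX -invfM -exprS (_ : abs (lead m - lead i) = 1) ?mul1r//.
apply/eqP; rewrite eq_le abs_subr_le ?lead_int//= leNgt.
apply: contra mi => h; apply/eqP/red_lead_inj => //.
by apply/(red_eq (lead_int _) (lead_int _)).
Qed.

Lemma normc_cav_level f j Q : node_ok Q -> cint f ->
  normc (cav f Q) <= level_mean node_child j (fun P => normc (cav f P)) Q.
Proof.
move=> + fi; elim: j Q => [|j IH] Q okQ //.
rewrite (cav_child okQ fi) Normc.normcM normc_real ?invr_ge0//.
rewrite {1}/level_mean -/level_mean /mean ler_wpM2l ?invr_ge0//; apply: le_trans (normc_sum _ _ _) _.
by apply: ler_sum => z _; apply: IH; exact: node_child_ok.
Qed.

Lemma level_mean_le_nodes j (f g : K * nat -> R) Q : node_ok Q ->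
  (forall P, node_ok P -> P.2 = (Q.2 + j)%N -> f P <= g P) ->
  level_mean node_child j f Q <= level_mean node_child j g Q.
Proof.
elim: j Q => [|j IH] Q okQ fg /=; first by apply: fg => //; rewrite addn0.
apply: ler_mean => z; apply: IH; first exact: node_child_ok.
by move=> P okP P2; apply: fg => //; rewrite P2 addSnnS.
Qed.

Definition comodulate y f t : R[i] := f t * chi (y * t).

Lemma cint_comodulate y f : cint f -> cint (comodulate y f).
Proof. exact: cint_chi. Qed.

Lemma comodulateD y y' f : comodulate (y + y') f = comodulate y (comodulate y' f).
Proof. by apply/funext => t; rewrite /comodulate mulrDl chiD mulrA mulrAC. Qed.

(** Conjugating by the character of index [n] turns the partial sum into a sum
    of operators, one for each ball, each of which only sees oscillations: the
    frequencies below [n] are grouped by the highest digit in which they differ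
    from [n]. *)
Lemma fourier_sum_osc j n f h : (n < q ^ j)%N -> cint f -> cint h ->
  normc (cav (fun x => S n f x * h x) root) <=
  q%:R * \sum_(i < j) level_mean node_child i
    (fun Q => cosc (modulate (u n) f) Q * cosc (comodulate (u n) h) Q) root.
Proof.
elim: j n f h => [|j IH] n f h nj fi hi.
  rewrite big_ord0 mulr0; have -> : n = 0%N by case: n nj.
  rewrite (@eq_cav _ (fun=> 0)) ?cav_cst ?Normc.normc0// => x _.
  by rewrite fourier_sumE big_ord0 mul0r.
have qj0 : (0 < q ^ j)%N by rewrite expn_gt0 q_gt0.
pose m := (n %/ q ^ j)%N; pose n' := (n %% q ^ j)%N.
have mq : (m < q)%N by rewrite ltn_divLR// -expnS.
have n'j : (n' < q ^ j)%N by rewrite ltn_mod.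
have nE : n = (n' + m * q ^ j)%N by rewrite addnC -divn_eq.
have unE : u n = u n' + freq j m by rewrite {1}nE u_repD_freq.
pose f1 := modulate (freq j m) f; pose h1 := comodulate (freq j m) h.
pose G x := \sum_(i < m) S (q ^ j) (modulate (freq j i) f) x * comodulate (freq j i) h x.
have Gi : cint G.
  by apply: cint_sum => i; apply: cint_fourier_sumM; exact: cint_comodulate.
have -> : cav (fun x => S n f x * h x) root = cav G root + cav (fun x => S n' f1 x * h1 x) root.
  rewrite -cavD//; [|exact: root_ok|]; last by apply: cint_fourier_sumM; exact: cint_comodulate.
  apply: eq_cav => x _; rewrite nE fourier_sum_rec// mulrDl mulr_suml /G /h1 /comodulate.
  congr (_ + _); last by rewrite mulrAC mulrA.
  by apply: eq_bigr => i _; rewrite mulrAC mulrA.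
apply: le_trans (le_normcD _ _) _; rewrite big_ord_recr/= mulrDr addrC lerD//.
  apply: le_trans (IH n' f1 h1 n'j _ _) _; [exact: cint_modulate|exact: cint_comodulate|].
  by rewrite /f1 /h1 -modulateD -comodulateD -unE.
rewrite -level_meanZ.
apply: le_trans (normc_cav_level j root_ok Gi) _.
apply: (level_mean_le_nodes root_ok) => -[a k] okP kj.
have {kj} kj : k = j by rewrite -[RHS]add0n.
subst k.
have Da : D a by [].
have -> : cav G (a, j) = \sum_(i < m) cav (comodulate (freq j i) h) (a, j) *
    cav (modulate (freq j i) f) (a, j).
  rewrite /G cav_sum//; last first.
    by move=> i; apply: cint_fourier_sumM; exact: cint_comodulate.
  apply: eq_bigr => i _.
  rewrite -(@cav_pull _ _ (S (q ^ j) (modulate (freq j i) f)))//.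
  - by apply: eq_cav => x xa; rewrite mulrC.
  - exact: cint_comodulate.
  - move=> x xa; rewrite fourier_sum_average ?(eq_cav_nball _ xa)//.
      exact: cint_modulate.
    exact: nball_sub xa.
apply: le_trans (normc_sum _ _ _) _.
apply: (@le_trans _ _ (\sum_(i < m) cosc (modulate (u n) f) (a, j) * cosc (comodulate (u n) h) (a, j))).
  apply: ler_sum => i _; rewrite Normc.normcM mulrC.
  have im : (i < q)%N by exact: ltn_trans mq.
  pose w := u n - freq j i.
  have wj : abs w = abs varpi ^- j.+1.
    rewrite /w unE -addrA abs_dominant abs_freqB ?gtn_eqF//.
    apply: le_lt_trans (abs_u_rep_le n'j) _; rewrite -invr_expz -exprnP.
    rewrite ltf_pV2 ?posrE ?exprn_gt0 ?abs_varpi_gt0//.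
    by rewrite exprS gtr_pMl ?abs_varpi_lt1// exprn_gt0// abs_varpi_gt0.
  have -> : modulate (freq j i) f = (fun t => modulate (u n) f t * chi (w * t)).
    apply/funext => t; rewrite /modulate /w mulrBl chiD chiN -mulrA; congr (_ * _).
    by rewrite mulrA [conjc _ * _]mulrC chi_conj mul1r.
  have -> : comodulate (freq j i) h = (fun t => comodulate (u n) h t * chi (- w * t)).
    apply/funext => t; rewrite /comodulate /w opprB mulrBl chiD chiN -mulrA; congr (_ * _).
    by rewrite mulrCA chi_conj mulr1.
  apply: ler_pM; rewrite ?normc_ge0// normc_cav_chi ?absN//.
    exact: cint_modulate.
  exact: cint_comodulate.
rewrite sumr_const card_ord -[X in X <= _]mulr_natl ler_wpM2r//.
  by rewrite mulr_ge0// cosc_ge0.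
by rewrite ler_nat ltnW.
Qed.

(** ** Orthonormality of the characters *)

(** The highest digit in which [k] and [i] differ dominates the difference. *)
Lemma abs_u_repB (k i : nat) : k <> i -> exists s : nat, abs (u k - u i) = abs varpi ^- s.+1.
Proof.
move=> ki; have [j [kj ij]] : exists j, (k < q ^ j)%N /\ (i < q ^ j)%N.
  exists (k + i)%N; split; apply: leq_ltn_trans (ltn_expl _ q_gt1); [exact: leq_addr|exact: leq_addl].
elim: j k i kj ij ki => [|j IH] k i kj ij ki; first by case: k i kj ij ki => [|?] [|?].
have qj0 : (0 < q ^ j)%N by rewrite expn_gt0 q_gt0.
have lt n : (n < q ^ j.+1)%N -> (n %/ q ^ j < q)%N by rewrite ltn_divLR// -expnS.
rewrite (divn_eq k (q ^ j)) (divn_eq i (q ^ j)) ![(_ * _ + _)%N]addnC.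
rewrite !u_repD_freq ?ltn_mod ?lt//.
have [dd|dd] := eqVneq (k %/ q ^ j)%N (i %/ q ^ j)%N.
  rewrite dd opprD addrACA subrr addr0; apply: IH; rewrite ?ltn_mod// => mm; apply: ki.
  by rewrite (divn_eq k (q ^ j)) (divn_eq i (q ^ j)) dd mm.
exists j; rewrite opprD addrACA abs_dominant abs_freqB ?lt//.
apply: (@le_lt_trans _ _ (abs varpi ^ (- j%:Z))).
  by apply: abs_subr_le; apply: abs_u_rep_le; rewrite ltn_mod.
rewrite -invr_expz -exprnP ltf_pV2 ?posrE ?exprn_gt0 ?abs_varpi_gt0//.
by rewrite exprS gtr_pMl ?abs_varpi_lt1// exprn_gt0// abs_varpi_gt0.
Qed.

(** Over balls of radius [q ^- s] the means of the character are bounded by the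
    oscillation of a constant. *)
Lemma cav_chi0 y s : abs y = abs varpi ^- s.+1 -> cav (fun t => chi (y * t)) root = 0.
Proof.
move=> ys; apply: Normc.eq0_normc; apply/eqP; rewrite eq_le normc_ge0 andbT.
have ci : cint (fun t => chi (y * t)).
  by apply: eq_cint (cint_chi y (cint_cst 1)) => x _; rewrite mul1r.
apply: le_trans (normc_cav_level s root_ok ci) _.
have lm0 : level_mean node_child s (fun=> 0) root = 0 :> R.
  have := @level_meanZ R F _ node_child 0 s (fun=> 0) root.
  by rewrite !mul0r.
rewrite -lm0; apply: (level_mean_le_nodes root_ok) => -[a k] okP kj.
have {kj} kj : k = s by rewrite -[RHS]add0n.
subst k.
have -> : cav (fun t => chi (y * t)) (a, s) = cav (fun t => 1 * chi (y * t)) (a, s).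
  by apply: eq_cav => x _; rewrite mul1r.
apply: le_trans (normc_cav_chi okP (cint_cst 1) ys) _.
rewrite /cosc /osc /= /mean !big1 ?mulr0 ?addr0// => z _; by rewrite !av_cst subrr normr0.
Qed.

Lemma cav_chi_chi (k i : nat) : cav (modulate (u k) (fun t => chi (u i * t))) root = (k == i)%:R.
Proof.
have [->|/eqP ki] := eqVneq k i.
  rewrite -[RHS](cav_cst 1 root); apply: eq_cav => t _.
  by rewrite /modulate chi_conj.
have [s us] := abs_u_repB (fun e => ki (esym e)).
rewrite mulr0n -(cav_chi0 us); apply: eq_cav => t _.
by rewrite /modulate mulrBl chiD chiN.
Qed.

Lemma fourier_sumD n f h x : cint f -> cint h ->
  S n (fun t => f t + h t) x = S n f x + S n h x.
Proof.
move=> fi hi; rewrite !fourier_sumE -big_split/=; apply: eq_bigr => k _.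
rewrite -mulrDl -cavD; [|exact: root_ok|exact: cint_modulate|exact: cint_modulate].
by congr (_ * _); apply: eq_cav => t _; rewrite /modulate mulrDl.
Qed.

Lemma fourier_sumZ n (z : R[i]) f x : cint f -> S n (fun t => z * f t) x = z * S n f x.
Proof.
move=> fi; rewrite !fourier_sumE mulr_sumr; apply: eq_bigr => k _.
rewrite mulrA -cavZ; [|exact: root_ok|exact: cint_modulate].
by congr (_ * _); apply: eq_cav => t _; rewrite /modulate mulrA.
Qed.

Lemma fourier_sumB n f h x : cint f -> cint h ->
  S n (fun t => f t - h t) x = S n f x - S n h x.
Proof.
move=> fi hi; rewrite -mulN1r -fourier_sumZ// -fourier_sumD//; last exact: cintZ.
congr (S n _ x); apply/funext => t; by rewrite mulN1r.
Qed.

(** The characters are orthonormal, so [S m f] has no coefficients beyond [m] and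
    those of [f] below it. *)
Lemma fourier_sum_sum n m f x : (m <= n)%N -> S n (S m f) x = S m f x.
Proof.
move=> mn; pose a i := cav (modulate (u i) f) root.
have coef (k : nat) : cav (modulate (u k) (S m f)) root = if (k < m)%N then a k else 0.
  have -> : cav (modulate (u k) (S m f)) root =
      \sum_(i < m) a i * cav (modulate (u k) (fun t => chi (u i * t))) root.
    transitivity (cav (fun t => \sum_(i < m) a i *
        modulate (u k) (fun t => chi (u i * t)) t) root).
      apply: eq_cav => t _; rewrite /modulate fourier_sumE mulr_suml.
      by apply: eq_bigr => i _; rewrite mulrA.
    have ci (i : nat) : cint (modulate (u k) (fun t => chi (u i * t))).
      apply: cint_modulate; apply: eq_cint (cint_chi (u i) (cint_cst 1)) => y _.
      by rewrite mul1r.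
    rewrite cav_sum; [|exact: root_ok|by move=> i; exact: cintZ].
    by apply: eq_bigr => i _; rewrite cavZ//; exact: root_ok.
  under eq_bigr do rewrite cav_chi_chi.
  case: ifPn => km.
    rewrite (bigD1 (Ordinal km))//= eqxx mulr1 big1 ?addr0// => i ik.
    by rewrite (_ : k == i = false) ?mulr0//; apply/negbTE; apply: contra ik => /eqP ki;
      apply/eqP/val_inj.
  rewrite big1// => i _; rewrite (_ : k == i = false) ?mulr0//.
  by apply/negbTE; apply: contra km => /eqP ->.
rewrite (fourier_sumE n) (fourier_sumE m).
rewrite (eq_bigr (fun k : 'I_n => if (k < m)%N then a k * chi (u k * x) else 0)); last first.
  by move=> k _; rewrite coef; case: ifP => // _; rewrite mul0r.
rewrite -big_mkcond/= -(subnKC mn) big_split_ord/= [X in _ + X]big1 ?addr0; last first.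
  by move=> i; rewrite ltnNge leq_addr.
by apply: eq_bigl => i; rewrite ltn_ord.
Qed.

(** ** Density of locally constant functions *)

Definition locally_constant (k : nat) (g : K -> R) :=
  forall x t, nball (x, k) t -> g t = g x.

Definition approximable (f : K -> R) := forall e : R, 0 < e ->
  exists (k : nat) g, [/\ locally_constant k g, rint g & av (fun x => `|f x - g x|) root <= e].

Lemma rint_indic (A : set K) : measurable (A : set (borel K)) -> rint (\1_A : K -> R).
Proof.
move=> mA; apply: (@rint_le _ (fun=> 1)); last exact: rint_cst.
  by apply: (measurable_funS measurableT) => //; exact: measurable_indic.
by move=> x _; rewrite indicE; case: (x \in A); rewrite ?normr1 ?normr0.
Qed.

Lemma rint_mul_indic (g : K -> R) (A : set K) : rint g -> measurable (A : set (borel K)) ->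
  rint (fun x => g x * \1_A x).
Proof.
move=> gi mA; apply: (rintM (B := 1)) => //; first exact: rint_meas (rint_indic mA).
by move=> x _; rewrite indicE; case: (_ \in _); rewrite ?normr1 ?normr0.
Qed.

Lemma av_indic (A : set K) : measurable (A : set (borel K)) -> A `<=` D ->
  (av (\1_A : K -> R) root)%:E = mu A.
Proof.
move=> mA AD; rewrite /av expr0 invr1 mul1r nball_D.
have mD := measurable_D.
rewrite /Rintegral fineK; last first.
  by have := integrable_fin_num mD (rint_indic mA).
by rewrite integral_indic// setIidl.
Qed.

(** Enclose the set between a compact [X] and an open [U'] of almost the same
    measure.  By compactness the balls of some fixed radius around the points of
    [X] stay in [U'], and the set of centres of such balls is locally
    constant. *)
Lemma approximable_indic (A : set K) : measurable (A : set (borel K)) ->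
  approximable (\1_A : K -> R).
Proof.
move=> mA e e0; have mD := measurable_D.
pose B := A `&` D; have mB : measurable (B : set (borel K)) by exact: measurableI.
have BD : B `<=` D by exact: subIsetr.
have e20 : 0 < e / 2 by rewrite divr_gt0.
have [U [oU BU UB]] : exists U, [/\ open U, B `<=` U & (mu U < mu B + (e / 2)%:E)%E].
  have : (mu B < mu B + (e / 2)%:E)%E by rewrite -av_indic// -EFinD lte_fin ltrDl.
  rewrite {1}(haar_outer_regular haar_mu mB) => /ereal_inf_lt[_ [U [oU XU] <-]] ?.
  by exists U.
pose U' := U `&` D.
have oU' : open U' by apply: openI => //; exact: open_integers.
have mU' : measurable (U' : set (borel K)) by exact: open_measurableK.
have U'D : U' `<=` D by exact: subIsetr.
have BU' : B `<=` U' by move=> x Bx; split; [exact: BU|exact: BD].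
have [X [cX XU UX]] : exists X, [/\ compact X, X `<=` U' & (mu U' < mu X + (e / 2)%:E)%E].
  have : (mu U' - (e / 2)%:E < mu U')%E.
    by rewrite -av_indic// -EFinB lte_fin ltrBlDr ltrDl.
  rewrite {2}(haar_inner_regular haar_mu oU') => /ereal_sup_gt[_ [X [cX XU'] <-]].
  by rewrite lteBlDr// => ?; exists X.
have mX : measurable (X : set (borel K)) by exact: compact_measurableK.
have XD : X `<=` D by exact: subset_trans U'D.
have [k Xk] : exists k : nat, forall x, X x -> nball (x, k) `<=` U'.
  have /compact_near_coveringP := cX.
  move=> /(_ nat \oo (fun n y => nball (y, n) `<=` U') _)[y Xy|n _ nU].
    have [j yj] := open_cball_sub oU' (XU _ Xy).
    exists (cball y j, [set m : nat | (j <= m)%N]) => /=.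
      split; last by exists j.
      by apply: open_nbhs_nbhs; split; [exact: open_cball|exact: cball_center].
    move=> [z m] /= [zy jm] t zt; apply: yj; rewrite /cball/= -(subrKA z) abs_addr_le//.
    by apply: (le_trans zt); apply: ler_rad; rewrite lez_nat.
  by exists n => x Xx; exact: (nU n (leqnn n)).
pose V := [set y | nball (y, k) `<=` U'].
have VU' : V `<=` U' by move=> y; apply; exact: nball_self.
have XV : X `<=` V by move=> x /Xk.
have lcV : locally_constant k (\1_V : K -> R).
  move=> x t xt; rewrite !indicE; congr (_ %:R); congr (nat_of_bool _).
  by apply/idP/idP => /set_mem Vt; apply/mem_set; rewrite /V/= ?(nball_eq xt) // -(nball_eq xt).
have gV : rint (\1_V : K -> R).
  apply: (@rint_le _ (fun=> 1)); last exact: rint_cst.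
    exact: locconst_rmeas lcV.
  by move=> x _; rewrite indicE; case: (x \in V); rewrite ?normr1 ?normr0.
have iA := rint_indic mA; have iB := rint_indic mB.
have iU := rint_indic mU'; have iX := rint_indic mX.
exists k, (\1_V : K -> R); split => //.
apply: (@le_trans _ _ (av (fun x => (\1_U' x - \1_B x) + (\1_U' x - \1_X x)) root)).
  apply: ler_av; [exact: root_ok|apply: rint_norm; exact: rintB| |].
    by apply: rintD; exact: rintB.
  rewrite nball_D => x Dx; rewrite !indicE.
  have -> : (x \in A) = (x \in B).
    by apply/idP/idP => /set_mem h; apply/mem_set; [split|case: h].
  have : (x \in B) ==> (x \in U') by apply/implyP => /set_mem h; apply/mem_set/BU'.
  have : (x \in V) ==> (x \in U') by apply/implyP => /set_mem h; apply/mem_set/VU'.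
  have : (x \in X) ==> (x \in V) by apply/implyP => /set_mem h; apply/mem_set/XV.
  by case: (x \in X); case: (x \in V); case: (x \in U'); case: (x \in B) => //=;
    rewrite ?subrr ?subr0 ?sub0r ?normrN ?normr0 ?normr1 ?addr0 ?add0r ?lexx//; lra.
rewrite avD ?avB//; try exact: root_ok; try exact: rintB.
have : (mu U' <= mu U)%E.
  rewrite le_measure ?inE//; [exact: open_measurableK|exact: subIsetl].
move=> /le_lt_trans/(_ UB); move: UX.
rewrite -!av_indic// -!EFinD !lte_fin; lra.
Qed.

Lemma approximableD (f g : K -> R) : rint f -> rint g -> approximable f -> approximable g ->
  approximable (fun x => f x + g x).
Proof.
move=> fi gi fa ga e e0; have e20 : 0 < e / 2 by rewrite divr_gt0.
have [k [f' [fk f'i fe]]] := fa _ e20; have [m [g' [gm g'i ge]]] := ga _ e20.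
exists (maxn k m), (fun x => f' x + g' x); split.
- have sub n x t : (n <= maxn k m)%N -> nball (x, maxn k m) t -> nball (x, n) t.
    by move=> nk xt; apply: (le_trans xt); apply: ler_rad; rewrite lez_nat.
  by move=> x t xt; rewrite (fk x t) ?(gm x t)//; apply: sub xt;
    [exact: leq_maxr|exact: leq_maxl].
- exact: rintD.
apply: (@le_trans _ _ (av (fun x => `|f x - f' x| + `|g x - g' x|) root)).
  apply: ler_av; [exact: root_ok| | |].
  - by apply: rint_norm; apply: rintB; exact: rintD.
  - by apply: rintD; apply: rint_norm; exact: rintB.
  - by move=> x _; rewrite opprD addrACA ler_normD.
rewrite avD; [|exact: root_ok|apply: rint_norm; exact: rintB|apply: rint_norm; exact: rintB].
by rewrite [X in _ <= X]splitr lerD.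
Qed.

Lemma approximableZ (r : R) (f : K -> R) : rint f -> approximable f -> approximable (fun x => r * f x).
Proof.
move=> fi fa e e0; have r0 : 0 < `|r| + 1 by rewrite ltr_wpDl.
have [k [g [gk gi ge]]] := fa (e / (`|r| + 1)) (divr_gt0 e0 r0).
exists k, (fun x => r * g x); split; [by move=> x t /gk ->|exact: rintZ|].
have iN : rint (fun x => `|f x - g x|) by apply: rint_norm; exact: rintB.
apply: (@le_trans _ _ (av (fun x => `|r| * `|f x - g x|) root)).
  rewrite le_eqVlt; apply/orP; left; apply/eqP; apply: eq_av => x _; by rewrite -mulrBr normrM.
rewrite avZ//; last exact: root_ok.
apply: (@le_trans _ _ ((`|r| + 1) * av (fun x => `|f x - g x|) root)).
  by rewrite ler_wpM2r ?lerDl// av_ge0.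
by rewrite mulrC -ler_pdivlMr.
Qed.

Lemma approximable_eq (f g : K -> R) : (forall x, f x = g x) -> approximable f -> approximable g.
Proof. by move=> /funext ->. Qed.

Lemma approximable_sum (I : Type) (s : seq I) (f : I -> K -> R) :
  (forall i, rint (f i)) -> (forall i, approximable (f i)) ->
  approximable (fun x => \sum_(i <- s) f i x) /\ rint (fun x => \sum_(i <- s) f i x).
Proof.
move=> fi fa; elim: s => [|i s [IHa IHi]].
  split; last by apply: eq_rint (rint_cst 0) => x _; rewrite big_nil.
  move=> e e0; exists 0%N, (fun=> 0); split; [by []|exact: rint_cst|].
  rewrite (@eq_av _ (fun=> 0)) ?av_cst ?ltW// => x _.
  by rewrite big_nil subr0 normr0.
split; last by apply: eq_rint (rintD (fi i) IHi) => x _; rewrite big_cons.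
apply: (@approximable_eq (fun x => f i x + \sum_(j <- s) f j x)).
  by move=> x; rewrite big_cons.
exact: approximableD.
Qed.

Import HBSimple.

Lemma approximable_sfun (f : {sfun borel K >-> R}) : approximable (f : K -> R).
Proof.
pose s := finmap.enum_fset (fset_set (range f)).
pose g (y : R) (x : K) := y * \1_(f @^-1` [set y]) x.
have mf (y : R) : measurable (f @^-1` [set y] : set (borel K)) by exact: measurable_sfunP.
apply: (@approximable_eq (fun x => \sum_(y <- s) g y x)).
  move=> x; rewrite /s /g [RHS]fimfunE fsbig_finite//=.
have [] // := @approximable_sum R s g.
  by move=> y; apply: rintZ; exact: rint_indic.
by move=> y; apply: approximableZ; [exact: rint_indic|exact: approximable_indic].
Qed.

Lemma rint_approximable (f : K -> R) : rint f -> approximable f.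
Proof.
move=> fi e e0; have e20 : 0 < e / 2 by rewrite divr_gt0.
have [g [gi _]] := approximation_sfun_integrable measurable_D fi.
move=> /fine_cvgP[_ /cvgrPdist_lt/(_ _ e20)[n _ /(_ n (leqnn n))]] /=.
rewrite sub0r normrN => ge.
have {}ge : av (fun x => `|f x - g n x|) root <= e / 2.
  rewrite (le_trans _ (ltW ge))// (le_trans _ (ler_norm _))// /av expr0 invr1 mul1r nball_D.
  by [].
have [k [h [hk hi he]]] := approximable_sfun (g n) e20.
have gni : rint (g n : K -> R) := gi n.
exists k, h; split => //.
apply: (@le_trans _ _ (av (fun x => `|f x - g n x| + `|g n x - h x|) root)).
  apply: ler_av; [exact: root_ok|by apply: rint_norm; exact: rintB| |].
    by apply: rintD; apply: rint_norm; exact: rintB.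
  by move=> x _; rewrite -{1}(subrK (g n x) (f x)) -addrA ler_normD.
rewrite avD; [|exact: root_ok|apply: rint_norm; exact: rintB|apply: rint_norm; exact: rintB].
by rewrite [X in _ <= X]splitr lerD.
Qed.

Definition cond_exp (J : nat) (f : K -> R) x := av f (x, J).

Lemma cond_exp_const J (f : K -> R) : locally_constant J (cond_exp J f).
Proof. by move=> x t xt; rewrite /cond_exp /av (nball_eq xt). Qed.

Lemma av_level (f : K -> R) j Q : node_ok Q -> rint f ->
  av f Q = level_mean node_child j (av f) Q.
Proof.
move=> + fi; elim: j Q => [|j IH] Q okQ //.
rewrite (av_martingale fi)//; apply: eq_mean => z.
by rewrite IH//; exact: node_child_ok.
Qed.

Definition real_to_cplx (f : K -> R) x : R[i] := Complex (f x) 0.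

Lemma cint_real_to_cplx (f : K -> R) : rint f -> cint (real_to_cplx f).
Proof. by move=> fi; split => //; exact: rint_cst. Qed.

Lemma cond_exp_fourier J (f : K -> R) x : rint f -> D x ->
  S (q ^ J) (real_to_cplx f) x = real_to_cplx (cond_exp J f) x.
Proof.
move=> fi Dx; rewrite fourier_sum_average//; last exact: cint_real_to_cplx.
by rewrite /cav /real_to_cplx /cond_exp /= av_cst.
Qed.

Lemma rint_cond_exp J (f : K -> R) : rint f -> rint (cond_exp J f).
Proof.
move=> fi; have [h _] := cint_fourier_sum (q ^ J) (real_to_cplx f).
by apply: eq_rint h => x Dx; rewrite cond_exp_fourier.
Qed.

Lemma av_cond_exp J (f : K -> R) : rint f -> av (cond_exp J f) root = av f root.
Proof.
move=> fi; rewrite (av_level J root_ok fi) (av_level J root_ok (rint_cond_exp J fi)).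
have E P : P.2 = J -> av (cond_exp J f) P = av f P.
  case: P => a j /= ->; rewrite (@eq_av _ (fun=> av f (a, J))) ?av_cst// => x xa.
  exact: cond_exp_const.
by apply/eqP; rewrite eq_le; apply/andP; split; apply: (level_mean_le_nodes root_ok);
  move=> P _; rewrite add0n => /E ->.
Qed.

(** Averaging contracts [L ^ 1] and fixes locally constant functions as soon as
    the balls are small. *)
Lemma cond_exp_cvg (f : K -> R) e : rint f -> 0 < e ->
  exists J0 : nat, forall J, (J0 <= J)%N -> av (fun x => `|f x - cond_exp J f x|) root <= e.
Proof.
move=> fi e0; have e20 : 0 < e / 2 by rewrite divr_gt0.
have [k [g [gk gi ge]]] := rint_approximable fi e20.
exists k => J kJ.
pose d x := `|f x - g x|.
have di : rint d by apply: rint_norm; exact: rintB.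
apply: (@le_trans _ _ (av (fun x => d x + cond_exp J d x) root)).
  apply: ler_av; [exact: root_ok| | |].
  - by apply: rint_norm; apply: rintB => //; exact: rint_cond_exp.
  - by apply: rintD => //; exact: rint_cond_exp.
  rewrite nball_D => x Dx; have okx : node_ok (x, J) by [].
  have gE : cond_exp J g x = g x.
    rewrite /cond_exp (@eq_av _ (fun=> g x)) ?av_cst// => t xt.
    by apply: gk; apply: (le_trans xt); apply: ler_rad; rewrite lez_nat.
  rewrite -(subrK (g x) (f x)) -addrA (le_trans (ler_normD _ _))// lerD2l//.
  rewrite -gE /cond_exp -avB// (le_trans (ler_norm_av okx _))//; first exact: rintB.
  by rewrite le_eqVlt; apply/orP; left; apply/eqP; apply: eq_av => t _; rewrite distrC.
rewrite avD ?av_cond_exp//; [|exact: root_ok|exact: rint_cond_exp].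
by rewrite [X in _ <= X]splitr lerD.
Qed.

(** * The lattice of coset representatives *)

(** Read off the digits of [x] from the highest one down. *)
Lemma coset_rep x : exists n, D (x - u n).
Proof.
have [->|x0] := eqVneq x 0; first by exists 0%N; rewrite u_rep0 subr0 /integers/= abs0.
have [j xj] : exists j : nat, abs x <= abs varpi ^- j.
  have xV : 0 < (abs x)^-1 by rewrite invr_gt0 abs_gt0.
  have [j] := rad_small xV; rewrite -exprnP => h; exists j.
  by rewrite -[leLHS]invrK lef_pV2 ?posrE// ?ltW// exprn_gt0// abs_varpi_gt0.
suff [n _ Dn] : exists2 n, (n < q ^ j)%N & D (x - u n) by exists n.
elim: j x xj {x0} => [|j IH] x xj.
  by exists 0%N => //; rewrite u_rep0 subr0 /integers/= (le_trans xj)// expr0 invr1.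
have v0 := varpi_neq0; have av0 := abs_varpi_gt0.
pose y := x * varpi ^+ j.+1.
have Dy : D y by rewrite /integers/= absM absX -ler_pdivlMr ?exprn_gt0// mul1r.
have [g _ gK] := lead_bij; pose m := g (red y).
have mE : red (lead m) = red y by exact: gK.
have Pym : P (y - lead m) by apply/(red_eq Dy (lead_int m)).
have [|n nj Dn] := IH (x - ud m * varpi ^- j).
  have -> : x - ud m * varpi ^- j = (y - lead m) * varpi ^- j.+1.
    by rewrite ud_lead /y mulrBl mulfK ?expf_neq0// exprS invfM mulrA.
  rewrite absM absV absX exprS invfM mulrA ger_pMl ?invr_gt0 ?exprn_gt0//.
  by rewrite ler_pdivrMr// mul1r; have [_] := varpi_prime; apply.
exists (n + m * q ^ j)%N; last by rewrite u_repD//; move: Dn; rewrite addrAC opprD addrA.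
rewrite expnS addnC -ltn_subRL -mulnBl.
apply: (leq_trans nj); rewrite leq_pmull// subn_gt0; exact: ltn_ord.
Qed.

Lemma integral_shift a (A : set K) (g : K -> R) : measurable (A : set (borel K)) ->
  measurable_fun [set: borel K] (g : borel K -> R) -> (forall x, 0 <= g x) ->
  (\int[mu]_(x in [set y | A (y - a)%R]) (g x)%:E = \int[mu]_(x in A) (g (x + a)%R)%:E)%E.
Proof.
move=> mA mg g0; pose phi (x : borel K) : borel K := x + a.
have mphi : measurable_fun setT phi.
  by have := measurable_shift (- a); congr measurable_fun; apply/funext => x; rewrite opprK.
pose B : set K := [set y | A (y - a)].
have mB : measurable (B : set (borel K)).
  by have := measurable_shift a measurableT mA; rewrite setTI.
have := @ge0_integral_pushforward _ _ _ _ R phi mphi mu B (EFin \o g) mB.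
have -> : phi @^-1` B = A by apply/seteqP; split => x; rewrite /phi /B/= addrK.
move=> <-; last first.
- by move=> x _; rewrite lee_fin.
- by apply/measurable_EFinP; exact: measurable_funTS.
apply: eq_measure_integral => C mC _; rewrite /pushforward.
rewrite -(measure_shift (- a) mC); congr (mu _).
by apply/seteqP; split => x; rewrite /= opprK.
Qed.

(** ** Translations that preserve the integrals over balls *)

(** Only a dense monoid of such translations has to be found, because a ball of
    given radius does not change under small translations. *)
Definition ball_invariant (g : K -> R) a := forall b (k : int),
  (\int[mu]_(x in cball (b + a)%R k) (g x)%:E = \int[mu]_(x in cball b k) (g x)%:E)%E.

Lemma ball_invariant0 (g : K -> R) : ball_invariant g 0.
Proof. by move=> b k; rewrite addr0. Qed.

Lemma ball_invariantD (g : K -> R) a b :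
  ball_invariant g a -> ball_invariant g b -> ball_invariant g (a + b).
Proof. by move=> ga gb d k; rewrite addrA gb ga. Qed.

Lemma ball_invariantMn (g : K -> R) a n : ball_invariant g a -> ball_invariant g (n%:R * a).
Proof.
move=> ga; elim: n => [|n IH]; first by rewrite mul0r; exact: ball_invariant0.
by rewrite -natr1 mulrDl mul1r; exact: ball_invariantD.
Qed.

Lemma periodic_ball_invariant (g : K -> R) n : measurable_fun [set: borel K] (g : borel K -> R) ->
  (forall x, 0 <= g x) -> periodic_ae mu u g -> ball_invariant g (u n).
Proof.
move=> mg g0 gu b k.
have -> : cball (b + u n) k = [set y | cball b k (y - u n)].
  by apply/seteqP; split => y; rewrite /cball/= opprD addrA addrAC.
rewrite integral_shift//; last exact: measurable_cball.
apply: ae_eq_integral; first exact: measurable_cball.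
- apply/measurable_EFinP/measurable_funTS.
  have -> : (fun x => g (x + u n)) = g \o (fun x : borel K => x - - u n : borel K).
    by apply/funext => x /=; rewrite opprK.
  by have := measurableT_comp mg (measurable_shift (- u n)).
- exact/measurable_EFinP/measurable_funTS.
- have [N [mN N0 gN]] := gu n; exists N; split => // x nx; apply: gN => gx.
  by apply: nx => _; rewrite gx.
Qed.

Lemma char_residue_lt1 : abs l%:R < 1.
Proof.
have D1 : D 1 by rewrite /integers/= abs1.
have Dl : D l%:R by exact: abs_natr_le1.
apply/(residue_map_ker red_residue Dl).
rewrite -[l%:R]mulr1 red_nat//; have := card_finPcharP cardF l_prime.
by rewrite inE => /andP[_ /eqP ->]; rewrite mul0r.
Qed.

(** Multiplication by [l] is a contraction and preserves the monoid generated by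
    the representatives; as [l ^ i * u n] comes within [abs l ^ i] of any given
    element, this monoid is dense. *)
Lemma ball_invariant_dense (g : K -> R) : l%:R != 0 :> K ->
  (forall n, ball_invariant g (u n)) -> forall a b (k : int),
  (\int[mu]_(x in cball a k) (g x)%:E = \int[mu]_(x in cball b k) (g x)%:E)%E.
Proof.
move=> l0 gu a b k.
have [i li] : exists i : nat, abs l%:R ^+ i <= abs varpi ^ k.
  have : (fun n : nat => abs l%:R ^+ n) @ \oo --> (0 : R).
    by apply: cvg_expr; rewrite ger0_norm ?abs_ge0// char_residue_lt1.
  move=> /cvgrPdist_lt/(_ _ (rad_gt0 k))[i _ /(_ i (leqnn i))].
  rewrite /= sub0r normrN ger0_norm ?exprn_ge0 ?abs_ge0// => h.
  by exists i; exact: ltW.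
have [n Dn] := coset_rep ((a - b) / l%:R ^+ i).
have : abs (a - (b + (l ^ i)%:R * u n)) <= abs varpi ^ k.
  rewrite opprD addrA natrX -[a - b](divfK (expf_neq0 i l0)) [X in X - _]mulrC -mulrBr.
  by rewrite absM absX (le_trans _ li)// ger_pMr// exprn_gt0// abs_gt0.
by move=> /cball_eq ->; exact: ball_invariantMn.
Qed.

(** ** Equal characteristic: the representatives form a group *)

Section EqualCharacteristic.
Hypothesis l0 : l%:R = 0 :> K.

Lemma natr_modl n : (n %% l)%:R = n%:R :> K.
Proof. by rewrite [in RHS](divn_eq n l) natrD natrM l0 mulr0 add0r. Qed.

Lemma u_digitD m n : exists2 e, (e < q)%N & ud m + ud n = ud e.
Proof.
have ll (k : nat) : ((digit l m k + digit l n k) %% l < l)%N by rewrite ltn_mod prime_gt0.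
have [e ec eE] := exists_digits c (prime_gt0 l_prime) ll.
exists e; first by rewrite cardF.
rewrite /u_digit -mulrDl -big_split/=; congr (_ * _); apply: eq_bigr => k _.
by rewrite eE// natr_modl natrD mulrDl.
Qed.

Lemma u_repD_closed m n : exists i, u m + u n = u i.
Proof.
have [j [mj nj]] : exists j, (m < q ^ j)%N /\ (n < q ^ j)%N.
  exists (m + n)%N; split; apply: leq_ltn_trans (ltn_expl _ q_gt1); [exact: leq_addr|exact: leq_addl].
suff [i _ ->] : exists2 i, (i < q ^ j)%N & u m + u n = u i by exists i.
elim: j m n mj nj => [|j IH] m n mj nj.
  exists 0%N => //; move: mj nj; rewrite expn0 !ltnS !leqn0 => /eqP -> /eqP ->.
  by rewrite u_rep0 addr0.
have qj : (0 < q ^ j)%N by rewrite expn_gt0 q_gt0.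
have split_ (i : nat) : (i < q ^ j.+1)%N -> [/\ (i %% q ^ j < q ^ j)%N, (i %/ q ^ j < q)%N &
    u i = u (i %% q ^ j)%N + ud (i %/ q ^ j)%N * varpi ^- j].
  move=> ij; have iq : (i %/ q ^ j < q)%N by rewrite ltn_divLR// -expnS.
  have im : (i %% q ^ j < q ^ j)%N by rewrite ltn_mod.
  by split => //; rewrite -u_repD// addnC -divn_eq.
have [m1 m2 ->] := split_ m mj; have [n1 n2 ->] := split_ n nj.
have [k kj kE] := IH _ _ m1 n1; have [e eq eE] := u_digitD (m %/ q ^ j)%N (n %/ q ^ j)%N.
exists (k + e * q ^ j)%N.
  rewrite expnS addnC -ltn_subRL -mulnBl (leq_trans kj)// leq_pmull// subn_gt0.
  exact: eq.
by rewrite u_repD// addrACA kE -mulrDl eE.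
Qed.

Definition coset_index x : nat := sval (cid (coset_rep x)).

Lemma coset_indexP x : D (x - u (coset_index x)).
Proof. exact: (svalP (cid (coset_rep x))). Qed.

Lemma coset_index_uniq x n : D (x - u n) -> coset_index x = n.
Proof.
move=> Dn; apply/eqP/negPn/negP => /eqP kn; have [s sE] := abs_u_repB kn.
have : abs (u (coset_index x) - u n) <= 1.
  have -> : u (coset_index x) - u n = (x - u n) - (x - u (coset_index x)).
    by rewrite opprB [RHS]addrC subrKA.
  by apply: abs_subr_le => //; exact: coset_indexP.
rewrite sE leNgt invf_gt1 ?exprn_gt0 ?abs_varpi_gt0//.
by rewrite exprn_ilt1 ?abs_ge0// abs_varpi_lt1.
Qed.

(** The representative in [D] of the coset of [x] depends only on the class of [x]
    modulo the group of all [u n]. *)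
Definition periodization f x := f (x - u (coset_index x)).

Lemma periodizationE f x : D x -> periodization f x = f x.
Proof.
by move=> Dx; rewrite /periodization (@coset_index_uniq x 0) u_rep0 subr0.
Qed.

Lemma periodization_periodic f : periodic_ae mu u (periodization f).
Proof.
move=> n; apply: aeW => x; rewrite /periodization.
have [m mE] := u_repD_closed (coset_index x) n.
have xE : x + u n - u m = x - u (coset_index x) by rewrite -mE opprD addrACA subrr addr0.
by rewrite (@coset_index_uniq _ m) xE//; exact: coset_indexP.
Qed.

End EqualCharacteristic.

(** * The three conditions *)

Section Conditions.
Variables (p : R) (w : K -> R).

Definition ball_condition := exists2 C : R, 0 < C &
  forall B : set K, field_ball abs varpi B ->
    (average mu B w *
     poweR (average mu B (fun x => (w x `^ (- (p - 1)^-1))%R)) (p - 1)%R <= C%:E)%E.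

Definition norm_bound := exists2 C : R, 0 < C &
  forall f, weighted_Lp mu D w p f -> cintegrable mu D f /\
    forall n : nat, (weighted_pintegral mu D w p (S n f)
      <= C%:E * weighted_pintegral mu D w p f)%E.

Definition norm_convergence := forall f, periodic_ae mu u f -> weighted_Lp mu D w p f ->
  cintegrable mu D f /\
  weighted_Lp_norm mu D w p (fun x => S n f x - f x) @[n --> \oo] --> 0%E.

End Conditions.

Section AlmostEverywhereEqual.
Variables (p : R) (v w : K -> R).
Hypotheses (v_meas : measurable_fun [set: borel K] (v : borel K -> R)).
Hypotheses (w_meas : measurable_fun [set: borel K] (w : borel K -> R)).
Hypothesis vw : {ae mu, forall x, v x = w x}.

Lemma integral_ae (B : set K) (g h : K -> R) : measurable (B : set (borel K)) ->
  measurable_fun (B : set (borel K)) (g : borel K -> R) ->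
  measurable_fun (B : set (borel K)) (h : borel K -> R) ->
  {ae mu, forall x, g x = h x} ->
  (\int[mu]_(x in B) (g x)%:E = \int[mu]_(x in B) (h x)%:E)%E.
Proof.
move=> mB gm hm [N [mN N0 gh]]; apply: ae_eq_integral => //.
- exact/measurable_EFinP.
- exact/measurable_EFinP.
by exists N; split => // x nx; apply: gh => ghx; apply: nx => _; rewrite ghx.
Qed.

Lemma average_ae (B : set K) (phi : R -> R) : measurable_fun setT phi ->
  field_ball abs varpi B ->
  average mu B (fun x => phi (v x)) = average mu B (fun x => phi (w x)).
Proof.
move=> phim /field_ballE[a [k ->]]; rewrite /average; congr (_ * _)%E.
apply: integral_ae.
- exact: measurable_cball.
- by have := measurableT_comp phim v_meas; exact: measurable_funTS.
- by have := measurableT_comp phim w_meas; exact: measurable_funTS.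
by have [N [mN N0 h]] := vw; exists N; split => // x nx; apply: h => vwx; apply: nx; rewrite /= vwx.
Qed.

Lemma weighted_pintegral_ae f : cmeas f ->
  weighted_pintegral mu D v p f = weighted_pintegral mu D w p f.
Proof.
move=> fm; have mp : rmeas (fun x => normc (f x) `^ p).
  have := measurableT_comp (measurable_powR p) (rmeas_normc fm).
  by [].
apply: integral_ae; first exact: measurable_D.
- by apply: measurable_funM => //; exact: measurable_funTS.
- by apply: measurable_funM => //; exact: measurable_funTS.
by have [N [mN N0 h]] := vw; exists N; split => // x nx; apply: h => vwx; apply: nx; rewrite /= vwx.
Qed.

Lemma weighted_Lp_ae f : weighted_Lp mu D w p f -> weighted_Lp mu D v p f.
Proof. by move=> [fm fi]; split => //; rewrite weighted_pintegral_ae. Qed.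

Lemma ball_condition_ae : ball_condition p v -> ball_condition p w.
Proof.
move=> [C C0 CP]; exists C; first exact C0.
move=> B fB; have := CP B fB.
rewrite (average_ae (measurable_powR (- (p - 1)^-1)) fB).
by have := average_ae (@measurable_id _ _ setT) fB => /= ->.
Qed.

Lemma norm_bound_ae : norm_bound p v -> norm_bound p w.
Proof.
move=> [C C0 CP]; exists C => // f fL; have [fi fP] := CP f (weighted_Lp_ae fL).
split => // n; rewrite -(weighted_pintegral_ae (fourier_sum_cmeas n f)).
by rewrite -(weighted_pintegral_ae (cint_cmeas fi)); exact: fP.
Qed.

Lemma norm_convergence_ae : norm_convergence p v -> norm_convergence p w.
Proof.
move=> cv f fu fL; have [fi fc] := cv f fu (weighted_Lp_ae fL).
split => //; apply: cvg_trans fc; apply: near_eq_cvg; apply: nearW => n.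
rewrite /weighted_Lp_norm weighted_pintegral_ae//.
have fm := cint_cmeas fi.
have := cmeasD (fourier_sum_cmeas n f) (cmeasM (cint_cmeas (cint_cst (-1))) fm).
by congr cmeas; apply/funext => x; rewrite mulN1r.
Qed.

End AlmostEverywhereEqual.

Lemma oscZ (t : R) (g : K * nat -> R) Q : 0 <= t ->
  osc node_child (fun P => t * g P) Q = t * osc node_child g Q.
Proof.
move=> t0; rewrite /osc -meanZ; apply: eq_mean => z.
by rewrite -mulrBr normrM ger0_norm.
Qed.

Lemma osc_formZ (s t : R) n (g h : K * nat -> R) Q : 0 <= s -> 0 <= t -> s * t = 1 ->
  osc_form node_child n (fun P => s * g P) (fun P => t * h P) Q = osc_form node_child n g h Q.
Proof.
move=> s0 t0 st; elim: n Q => [|n IH] Q //=; congr (_ + _).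
  by rewrite !oscZ// mulrACA st mul1r.
by apply: eq_mean => z; exact: IH.
Qed.

Lemma sum_level_cosc j f h : \sum_(i < j) level_mean node_child i
    (fun Q => cosc f Q * cosc h Q) root =
  (osc_form node_child j (av (fun x => Re (f x))) (av (fun x => Re (h x))) root +
   osc_form node_child j (av (fun x => Re (f x))) (av (fun x => Im (h x))) root) +
  (osc_form node_child j (av (fun x => Im (f x))) (av (fun x => Re (h x))) root +
   osc_form node_child j (av (fun x => Im (f x))) (av (fun x => Im (h x))) root).
Proof.
rewrite !osc_form_level_mean -!big_split/=; apply: eq_bigr => i _.
rewrite -!level_meanD; congr (level_mean _ _ _ _); apply/funext => Q.
by rewrite /cosc; ring.
Qed.

(** * The weighted inequality *)

Section Weighted.
Variables (p : R) (p1 : 1 < p) (w : K -> R).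
Hypotheses (w_meas : rmeas w) (w_int : rint w) (w0 : forall x, 0 < w x).

Local Notation p' := (p / (p - 1)).

Definition dual_weight x := w x `^ (- (p - 1)^-1).
Local Notation sigma := dual_weight.

Lemma p_gt0 : 0 < p. Proof. exact: lt_trans p1. Qed.
Lemma p1_gt0 : 0 < p - 1. Proof. by rewrite subr_gt0. Qed.
Lemma p'1E : p' - 1 = (p - 1)^-1.
Proof. by field; rewrite gt_eqF// p1_gt0. Qed.
Lemma p'_gt1 : 1 < p'.
Proof. by rewrite -subr_gt0 p'1E invr_gt0 p1_gt0. Qed.

Lemma dual_weight_gt0 x : 0 < sigma x.
Proof. exact: powR_gt0. Qed.

Lemma rmeas_powR (f : K -> R) (r : R) : rmeas f -> rmeas (fun x => f x `^ r).
Proof.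
move=> fm; rewrite /rmeas -[X in measurable_fun _ X]/((fun b : R => b `^ r) \o f).
by apply: (measurable_comp (F := setT)) => //; exact: measurable_powR.
Qed.

Lemma dual_weight_meas : rmeas sigma.
Proof. exact: rmeas_powR. Qed.

Lemma dual_weightK x : sigma x `^ (1 - p) = w x.
Proof.
rewrite -powRrM (_ : _ * _ = 1) ?powRr1 ?ltW//.
by field; rewrite gt_eqF// p1_gt0.
Qed.

Lemma dual_weightE x : w x `^ (1 - p') = sigma x.
Proof. by congr (_ `^ _); rewrite -opprB p'1E. Qed.

Lemma av_gt0 (f : K -> R) Q : node_ok Q -> rint f -> (forall x, 0 < f x) -> 0 < av f Q.
Proof.
move=> okQ fi f0; rewrite lt_neqAle av_ge0 ?andbT; last by move=> x _; exact: ltW.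
apply/eqP => /esym/eqP; rewrite mulf_eq0 gt_eqF ?nball_rad_gt0//= => /eqP f00.
have mQ := measurable_nball Q.
have fiQ := rint_nball okQ fi.
have : (\int[mu]_(x in nball Q) `|(f x)%:E| = 0)%E.
  under eq_integral do rewrite gee0_abs ?lee_fin ?ltW//.
  by rewrite -(fineK (integrable_fin_num mQ fiQ)); congr EFin.
move/(ae_eq_integral_abs mu mQ (measurable_int _ fiQ)).1 => [A [mA A0 AQ]].
have : (mu (nball Q) <= 0)%E.
  rewrite -A0 le_measure ?inE// => x Qx; apply: AQ => /= /(_ Qx)/eqP.
  by rewrite eqe gt_eqF.
by rewrite measure_cball leNgt lte_fin rad_gt0.
Qed.

(** The tangent inequality at [r := av g Q / av u Q], integrated. *)
Lemma av_hoelder (s : R) (g v u : K -> R) Q : 1 < s -> node_ok Q ->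
  (forall x, 0 <= g x) -> (forall x, 0 < u x) -> (forall x, u x `^ (1 - s) = v x) ->
  rint g -> rint u -> rint (fun x => g x `^ s * v x) ->
  av g Q `^ s <= av (fun x => g x `^ s * v x) Q * av u Q `^ (s - 1).
Proof.
move=> s1 okQ g0 u0 uv gi ui gvi.
have a0 : 0 <= av g Q by exact: av_ge0.
have b0 : 0 < av u Q by exact: av_gt0.
rewrite -ler_pdivrMr ?powR_gt0// -powRN opprB.
set r := av g Q / av u Q; have r0 : 0 <= r by rewrite divr_ge0// ltW.
have <- : s * (r `^ (s - 1) * av g Q) - (s - 1) * (r `^ s * av u Q) =
    av g Q `^ s * av u Q `^ (1 - s).
  by rewrite powR_slope// -powR_homog// -/r; ring.
rewrite -!avZ//; try exact: rintZ.
rewrite -avB//; try (apply: rintZ; exact: rintZ).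
apply: ler_av => //.
  by apply: rintB; apply: rintZ; exact: rintZ.
by move=> x _; rewrite -uv; exact: powR_tangent.
Qed.

Definition wLp f := cmeas f /\ rint (fun x => normc (f x) `^ p * w x).

Section DualIntegrable.
Hypothesis sigma_int : rint sigma.

(** Where [|f| <= sigma] use that [sigma] is integrable, and elsewhere the tangent
    inequality at [r := 1]. *)
Lemma wLp_cint f : wLp f -> cint f.
Proof.
move=> [fm fi]; apply: (cint_le fm _ (rintD fi sigma_int)) => x _.
have := powR_tangent p1 (normc_ge0 (f x)) (dual_weight_gt0 x) (@ler01 R).
rewrite !powR1 !mul1r dual_weightK.
set n := normc (f x); set s := sigma x; set N := _ * w x => h.
have N0 : 0 <= N by rewrite mulr_ge0 ?powR_ge0// ltW.
have s0 : 0 <= s by rewrite ltW// dual_weight_gt0.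
have [sn|ns] := leP s n; last by rewrite (le_trans (ltW ns))// lerDr.
apply: (le_trans _ (_ : N <= _)); last by rewrite lerDl.
apply: le_trans h; rewrite -subr_ge0.
rewrite (_ : _ - n = (p - 1) * (n - s)); last by ring.
by rewrite mulr_ge0 ?subr_ge0// ltW.
Qed.

(** Four real parts and imaginary parts, the factor [q] of [fourier_sum_osc] and
    the constants of [osc_form_weighted]. *)
Definition fourier_cst (C : R) : R :=
  4 * (q%:R * ((4 * q%:R) ^+ 2 * C `^ p^-1)).

(** Duality: testing against [|S_n f| ^ (p - 2) * conj (S_n f) * w], whose dual
    norm is a power of the norm of [S_n f], makes the bilinear bound absorb half
    of its left-hand side. *)
Lemma fourier_sum_weighted C :
  (forall Q, node_ok Q -> av w Q * av sigma Q `^ (p - 1) <= C) ->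
  exists2 C' : R, 0 < C' & forall f n, wLp f ->
    av (fun x => normc (S n f x) `^ p * w x) root <=
    C' * av (fun x => normc (f x) `^ p * w x) root.
Proof.
move=> Ap; have p0 := p_gt0; have p10 := p1_gt0.
have p'1 := p'_gt1; have p'0 : 0 < p' by exact: lt_trans p'1.
pose A := fourier_cst C.
pose a1 := Ap_stop_cst p C; pose a2 := Ap_stop_cst p' (C `^ (p' - 1)).
have A0 : 0 <= A by rewrite !mulr_ge0 ?sqr_ge0 ?powR_ge0.
have a10 : 0 <= a1 by exact: Ap_stop_cst_ge0.
have a20 : 0 <= a2 by exact: Ap_stop_cst_ge0.
(* [t] weighs the two terms of the estimate: the one with [S n f] gets the factor
   [(M + 1)^-1] and is absorbed *)
pose M := 2 * (A * a2); have M0 : 0 <= M := mulr_ge0 (ler0n _ 2) (mulr_ge0 A0 a20).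
have M1 : 0 < M + 1 by rewrite ltr_wpDl.
pose t := (M + 1) `^ (p'^-1); have t0 : 0 < t := powR_gt0 _ M1.
exists (2 * (A * a1 * t `^ p) + 1).
  by rewrite ltr_wpDl// (mulr_ge0 _ (mulr_ge0 (mulr_ge0 A0 a10) (powR_ge0 _ _))).
move=> f n fL; have fi := wLp_cint fL; have [fm fp] := fL.
have u0 Q : node_ok Q -> 0 < av sigma Q.
  by move=> okQ; apply: av_gt0 => // x; exact: dual_weight_gt0.
have aw0 Q : node_ok Q -> 0 < av w Q by move=> okQ; exact: av_gt0.
pose s := S n f.
have sm : cmeas s := fourier_sum_cmeas n f.
have sB := fourier_sum_bounded n f.
set B := \sum_(k < n) _ in sB.
have nsm : rmeas (fun x => normc (s x)) by exact: rmeas_normc.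
have spB (r : R) x : 0 <= r -> normc (s x) `^ r <= B `^ r.
  by move=> r0; apply: ler_powRl => //; exact: normc_ge0.
have swi (r : R) : 0 <= r -> rint (fun x => normc (s x) `^ r * w x).
  move=> r0; apply: (rint_le _ _ (rintZ (B `^ r) w_int)).
    by apply: measurable_funM => //; exact: rmeas_powR.
  by move=> x _; rewrite ger0_norm ?mulr_ge0 ?powR_ge0 ?(ltW (w0 x))// ler_pM2r ?spB.
(* the modulus of [h] is [|s| ^ (p - 1) * w], so that [s * h = |s| ^ p * w] *)
pose h x : R[i] := conjc (s x) * Complex (normc (s x) `^ (p - 2) * w x) 0.
have hn x : normc (h x) = normc (s x) `^ (p - 1) * w x.
  rewrite Normc.normcM normc_conj normc_real ?mulr_ge0 ?powR_ge0 ?ltW// mulrA.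
  congr (_ * _); have := normc_ge0 (s x); rewrite le_eqVlt => /orP[/eqP <-|sx].
    by rewrite mul0r powR0// gt_eqF.
  rewrite -{1}(powRr1 (ltW sx)) powR_mulB//; congr (_ `^ _); ring.
have sh x : s x * h x = Complex (normc (s x) `^ p * w x) 0.
  rewrite mulrA normc_mul_conj; apply: eqC => /=; rewrite ?mul0r ?mulr0 ?subr0 ?addr0//.
  rewrite mulrA; congr (_ * _).
  have := normc_ge0 (s x); rewrite le_eqVlt => /orP[/eqP <-|sx].
    by rewrite expr0n mul0r powR0// gt_eqF.
  by rewrite -powR_mulrn ?(ltW sx)// powR_mulB//; congr (_ `^ _); ring.
have hm : cmeas h.
  apply: cmeasM.
    have [sr si] := sm; split; rewrite /rmeas.
      by rewrite (_ : (fun x => _) = fun x => Re (s x))//; apply/funext => x; case: (s x).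
    rewrite (_ : (fun x => _) = fun x => - Im (s x)); first exact: measurableT_comp.
    by apply/funext => x; case: (s x).
  split => /=; last exact: measurable_cst.
  by apply: measurable_funM => //; exact: rmeas_powR.
have hi : cint h.
  apply: (cint_le hm _ (swi (p - 1) (ltW p10))) => x _.
  by rewrite hn.
pose I0 := av (fun x => normc (s x) `^ p * w x) root.
pose phi := av (fun x => normc (f x) `^ p * w x).
have I00 : 0 <= I0 by apply: av_ge0 => x _; rewrite mulr_ge0 ?powR_ge0 ?ltW.
have phi0 : 0 <= phi root by apply: av_ge0 => x _; rewrite mulr_ge0 ?powR_ge0 ?ltW.
have hp x : normc (h x) `^ p' * sigma x = normc (s x) `^ p * w x.
  rewrite hn powRM ?powR_ge0 ?(ltW (w0 x))// -powRrM -mulrA; congr (_ * _).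
    by congr (_ `^ _); field; rewrite gt_eqF.
  have e1 : p' + - (p - 1)^-1 = 1 by field; rewrite gt_eqF.
  by rewrite /dual_weight powR_mulB// e1 powRr1 ?ltW.
have IE : normc (cav (fun x => S n f x * h x) root) = I0.
  have -> : cav (fun x => S n f x * h x) root = Complex I0 0.
    apply: eqC => /=; first by apply: eq_av => x _; rewrite sh.
    by rewrite -[RHS](av_cst 0 root); apply: eq_av => x _; rewrite sh.
  exact: normc_real.
have [j nj] : exists j, (n < q ^ j)%N by exists n; exact/ltn_expl/q_gt1.
have := fourier_sum_osc nj fi hi; rewrite IE sum_level_cosc.
set f' := modulate (u n) f; set h' := comodulate (u n) h.
have f'i : cint f' by exact: cint_modulate.
have h'i : cint h' by exact: cint_comodulate.
have nf' x : normc (f' x) = normc (f x).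
  by rewrite Normc.normcM normc_conj normc_chi mulr1.
have nh' x : normc (h' x) = normc (h x) by rewrite Normc.normcM normc_chi mulr1.
pose G := av (fun x => normc (f x)); pose H := av (fun x => normc (h x)).
have nfi := cint_normc fi; have nhi := cint_normc hi.
have G0 Q : 0 <= G Q by apply: av_ge0 => x _; exact: normc_ge0.
have H0 Q : 0 <= H Q by apply: av_ge0 => x _; exact: normc_ge0.
have tV0 : 0 <= t^-1 by rewrite invr_ge0 ltW.
have tV : t * t^-1 = 1 by rewrite mulfV// gt_eqF.
have tp' : t^-1 `^ p' = (M + 1)^-1.
  have tp : t `^ p' = M + 1 by rewrite /t -powRrM mulVf ?gt_eqF// powRr1// ltW.
  by rewrite -powR_inv1 ?(ltW t0)// -powRrM mulN1r powRN tp.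
have core (g e : K * nat -> R) : martingale node_child node_ok g ->
    martingale node_child node_ok e ->
    (forall Q, node_ok Q -> `|g Q| <= G Q) -> (forall Q, node_ok Q -> `|e Q| <= H Q) ->
    osc_form node_child j g e root <= (4 * q%:R) ^+ 2 * (C `^ p^-1 *
      (a1 * (t `^ p * phi root) + a2 * ((M + 1)^-1 * I0))).
  move=> gm em gG eH.
  have scale (b : R) (F' : K * nat -> R) : martingale node_child node_ok F' ->
      martingale node_child node_ok (fun P => b * F' P).
    by move=> F'm Q okQ; rewrite meanZ -F'm.
  have i0 : F := 0.
  rewrite -(osc_formZ _ _ _ _ (ltW t0) tV0 tV).
  apply: (@osc_form_weighted R F i0 _ node_child node_ok node_child_ok p C _ _
    (fun P => t * G P) (fun P => t^-1 * H P) (av w) (av sigma)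
    (fun P => t `^ p * phi P)
    (fun P => (M + 1)^-1 * av (fun x => normc (s x) `^ p * w x) P)) => //.
  - exact: scale.
  - exact: scale.
  - by apply: scale; exact: av_martingale.
  - by apply: scale; exact: av_martingale.
  - exact: av_martingale.
  - exact: av_martingale.
  - by apply: scale; exact: av_martingale.
  - by apply: scale; apply: av_martingale; exact: swi (ltW p0).
  - by move=> Q okQ; rewrite normrM gtr0_norm// ler_pM2l// gG.
  - by move=> Q okQ; rewrite normrM gtr0_norm ?invr_gt0// ler_pM2l ?invr_gt0// eH.
  - move=> Q okQ; rewrite Ap// andbT.
    have := @av_hoelder p (fun=> 1) w sigma Q p1 okQ (fun=> ler01) dual_weight_gt0
      dual_weightK (rint_cst 1) sigma_int.
    rewrite av_cst powR1 (_ : (fun x => 1 * w x) = w); first exact.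
    by apply/funext => x; rewrite mul1r.
  - move=> Q okQ; rewrite (powRM p (ltW t0) (G0 Q)).
    rewrite -mulrA ler_pM2l ?powR_gt0//.
    exact: (@av_hoelder p _ w sigma Q p1 okQ (fun x => normc_ge0 (f x)) dual_weight_gt0
      dual_weightK nfi sigma_int fp).
  - move=> Q okQ; rewrite (powRM p' tV0 (H0 Q)).
    rewrite tp' -mulrA ler_pM2l ?invr_gt0//.
    have hpi : rint (fun x => normc (h x) `^ p' * sigma x).
      by apply: eq_rint (swi p (ltW p0)) => x _; rewrite hp.
    have := @av_hoelder p' _ sigma w Q p'1 okQ (fun x => normc_ge0 (h x)) w0
      dual_weightE nhi w_int hpi.
    have -> : av (fun x => normc (h x) `^ p' * sigma x) Q =
        av (fun x => normc (s x) `^ p * w x) Q by apply: eq_av => x _; exact: hp.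
    by [].
  - exact: root_ok.
have [f'r f'im] := f'i; have [h'r h'im] := h'i.
have Gre Q : node_ok Q -> `|av (fun x => Re (f' x)) Q| <= G Q /\ `|av (fun x => Im (f' x)) Q| <= G Q.
  by move=> okQ; have := normc_cav okQ f'i; under eq_av do rewrite nf'.
have Hre Q : node_ok Q -> `|av (fun x => Re (h' x)) Q| <= H Q /\ `|av (fun x => Im (h' x)) Q| <= H Q.
  by move=> okQ; have := normc_cav okQ h'i; under eq_av do rewrite nh'.
set X := _ * (_ * (a1 * _ + _)) in core.
have q0 : 0 <= q%:R :> R by [].
have four := lerD
  (lerD (core _ _ (av_martingale f'r) (av_martingale h'r) (fun Q o => (Gre Q o).1) (fun Q o => (Hre Q o).1))
        (core _ _ (av_martingale f'r) (av_martingale h'im) (fun Q o => (Gre Q o).1) (fun Q o => (Hre Q o).2)))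
  (lerD (core _ _ (av_martingale f'im) (av_martingale h'r) (fun Q o => (Gre Q o).2) (fun Q o => (Hre Q o).1))
        (core _ _ (av_martingale f'im) (av_martingale h'im) (fun Q o => (Gre Q o).2) (fun Q o => (Hre Q o).2))).
move=> /le_trans/(_ (ler_wpM2l q0 four)).
have -> : q%:R * (X + X + (X + X)) = A * a1 * t `^ p * phi root + (M + 1)^-1 * (A * a2) * I0.
  by rewrite /X /A /fourier_cst; ring.
have : (M + 1)^-1 * (A * a2) * I0 <= 2^-1 * I0.
  rewrite ler_wpM2r// ler_pdivrMl//.
  have -> : (M + 1) * 2^-1 = A * a2 + 2^-1 by rewrite /M; field.
  by rewrite lerDl invr_ge0.
by rewrite /I0 -/s -/phi -/I0; nra.
Qed.

End DualIntegrable.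

(** ** Density in the weighted space *)

Definition large n (g : K -> R) : set K := D `&` g @^-1` `]n%:R, +oo[%classic.

Lemma measurable_large n (g : K -> R) : rmeas g -> measurable (large n g : set (borel K)).
Proof. by move=> gm; apply: gm; [exact: measurable_D|exact: measurable_itv]. Qed.

Lemma largeE n (g : K -> R) x : D x -> (x \in large n g) = (n%:R < g x).
Proof.
move=> Dx; apply/idP/idP => [/set_mem[_]|h].
  by rewrite /preimage/= in_itv/= andbT.
by apply/mem_set; split => //; rewrite /preimage/= in_itv/= andbT.
Qed.

Lemma rint_tail n (h g : K -> R) : rint h -> rmeas g -> rint (fun x => h x * \1_(large n g) x).
Proof.
by move=> hi gm; apply: rint_mul_indic => //; exact: measurable_large.
Qed.

Lemma tail_cvg (h g : K -> R) e : (forall x, 0 <= h x) -> rint h -> rmeas g -> 0 < e ->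
  exists n, av (fun x => h x * \1_(large n g) x) root <= e.
Proof.
move=> h0 hi gm e0; have mD := measurable_D.
have hin n := rint_tail n hi gm.
have := @dominated_cvg _ (borel K) R mu D mD
  (fun n x => (h x * \1_(large n g) x)%:E) (cst 0%E) (EFin \o h).
have lim x : D x -> (h x * \1_(large n g) x)%:E @[n --> \oo] --> (cst 0%E x : \bar R).
  move=> Dx; apply: cvg_near_cst.
  exists (Num.bound `|g x|) => //= n /= gn.
  rewrite indicE largeE//.
  have gxn : `|g x| < n%:R.
    by apply: (lt_le_trans (archi_boundP (normr_ge0 (g x)))); rewrite ler_nat.
  by rewrite ltNge (le_trans (ler_norm _) (ltW gxn)) mulr0.
move=> H; have {H} := H _ lim _ hi _; rewrite integral_cst// mul0e.
have meas n : measurable_fun (D : set (borel K)) (fun x : borel K => (h x * \1_(large n g) x)%:E).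
  exact: measurable_int (hin n).
have fin x : D x -> (EFin \o h) x \is a fin_num by [].
have dom n x : D x -> (`|(h x * \1_(large n g) x)%:E| <= (EFin \o h) x)%E.
  move=> Dx; rewrite /= lee_fin indicE.
  by case: (_ \in _); rewrite ?mulr1 ?mulr0 ?normr0// ger0_norm.
move=> /(_ meas fin dom) /fine_cvgP[_ /cvgrPdist_lt/(_ _ e0)[n _ /(_ n (leqnn n))]] /=.
rewrite sub0r normrN => ge; exists n.
rewrite (le_trans _ (ltW ge))// (le_trans _ (ler_norm _))// /av expr0 invr1 mul1r nball_D.
by [].
Qed.

Local Notation Nm f := (av (fun x => normc (f x) `^ p * w x) root).

Lemma Nm_ge0 f : 0 <= Nm f.
Proof. by apply: av_ge0 => x _; rewrite mulr_ge0 ?powR_ge0 ?ltW. Qed.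

Lemma powR_add_le (a b : R) : 0 <= a -> 0 <= b -> (a + b) `^ p <= 2 `^ p * (a `^ p + b `^ p).
Proof.
move=> a0 b0; wlog ab : a b a0 b0 / a <= b.
  move=> H; have [ab|/ltW ba] := leP a b; first exact: H.
  by rewrite addrC [_ `^ p + _]addrC; exact: H.
apply: (@le_trans _ _ ((2 * b) `^ p)).
  by apply: ler_powRl; [exact: ltW p_gt0|exact: addr_ge0|lra].
by rewrite powRM// ler_wpM2l ?powR_ge0// lerDr powR_ge0.
Qed.

Lemma wLp_dom (b : K -> R) f : cmeas f -> rint b ->
  (forall x, D x -> normc (f x) `^ p * w x <= b x) -> wLp f.
Proof.
move=> fm bi fb; split => //; apply: rint_le bi.
  by apply: measurable_funM => //; apply: rmeas_powR; exact: rmeas_normc.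
by move=> x Dx; rewrite ger0_norm ?fb// mulr_ge0 ?powR_ge0// ltW.
Qed.

Lemma normc_add_pow x f h : normc (f x + h x) `^ p * w x <=
  2 `^ p * (normc (f x) `^ p * w x + normc (h x) `^ p * w x).
Proof.
rewrite -mulrDl mulrA ler_pM2r//.
apply: le_trans (powR_add_le (normc_ge0 _) (normc_ge0 _)).
by apply: ler_powRl; [exact: ltW p_gt0|exact: normc_ge0|exact: le_normcD].
Qed.

Lemma wLpD f h : wLp f -> wLp h -> wLp (fun x => f x + h x).
Proof.
move=> [fm fi] [hm hi]; apply: (wLp_dom _ (rintZ (2 `^ p) (rintD fi hi))).
  exact: cmeasD.
by move=> x _; exact: normc_add_pow.
Qed.

Lemma Nm_add f h : wLp f -> wLp h -> Nm (fun x => f x + h x) <= 2 `^ p * (Nm f + Nm h).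
Proof.
move=> fL hL; have [_ fhi] := wLpD fL hL; move: fL hL => [_ fi] [_ hi].
rewrite -avD; [|exact: root_ok|by []|by []].
rewrite -avZ; [|exact: root_ok|exact: rintD].
apply: ler_av => //; [exact: root_ok|by apply: rintZ; exact: rintD|].
by move=> x _; exact: normc_add_pow.
Qed.

Lemma normcN (z : R[i]) : normc (- z) = normc z.
Proof. by case: z => a b /=; rewrite !sqrrN. Qed.

Lemma wLpN f : wLp f -> wLp (fun x => - f x).
Proof.
move=> [fm fi]; apply: (wLp_dom _ fi); last by move=> x _; rewrite normcN.
have := cmeasM (cint_cmeas (cint_cst (-1))) fm.
by congr cmeas; apply/funext => x; rewrite mulN1r.
Qed.

Lemma NmN f : Nm (fun x => - f x) = Nm f.
Proof. by apply: eq_av => x _; rewrite normcN. Qed.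

Lemma wLp_bounded (B : R) f : cmeas f -> (forall x, D x -> normc (f x) <= B) -> wLp f.
Proof.
move=> fm fB; apply: (wLp_dom fm (rintZ (B `^ p) w_int)) => x Dx.
by rewrite ler_pM2r//; apply: ler_powRl; [exact: ltW p_gt0|exact: normc_ge0|exact: fB].
Qed.

Lemma wLp_fourier_sum n f : wLp (S n f).
Proof.
exact: wLp_bounded (fourier_sum_cmeas n f) (fun x _ => fourier_sum_bounded n f x).
Qed.

Lemma rint_bounded (B : R) (g : K -> R) : rmeas g -> (forall x, D x -> `|g x| <= B) -> rint g.
Proof. by move=> gm gB; exact: rint_le gm gB (rint_cst B). Qed.

(** For a bounded function the [L ^ 1] convergence of the averages suffices,
    once the set where the weight is large has been cut off. *)
Lemma Nm_cond_exp_bounded (B : R) f e : cmeas f -> (forall x, D x -> normc (f x) <= B) ->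
  0 < e -> exists J0 : nat, forall J, (J0 <= J)%N -> Nm (fun x => f x - S (q ^ J) f x) <= e.
Proof.
move=> [fr fim] fB e0.
have B0 : 0 <= B by apply: le_trans (normc_ge0 (f 0)) (fB 0 root_ok).
pose a x := Re (f x); pose b x := Im (f x).
have aB x : D x -> `|a x| <= B by move=> /fB; exact: le_trans (ler_Re_normc _).
have bB x : D x -> `|b x| <= B by move=> /fB; exact: le_trans (ler_Im_normc _).
have ai : rint a by exact: rint_bounded aB.
have bi : rint b by exact: rint_bounded bB.
pose L := 4 * B + 1; have L0 : 0 < L by rewrite ltr_wpDl// mulr_ge0.
have Lp0 : 0 < L `^ p by exact: powR_gt0.
have L1 : 0 < L `^ (p - 1) by exact: powR_gt0.
have e2 : 0 < e / 2 / L `^ p by rewrite !divr_gt0.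
have [n tail] := tail_cvg (fun x => ltW (w0 x)) w_int w_meas e2.
pose M : R := n%:R + 1; have M0 : 0 < M by rewrite ltr_wpDl.
have e4 : 0 < e / 4 / (M * L `^ (p - 1)) by rewrite !divr_gt0// mulr_gt0.
have [J1 aJ] := cond_exp_cvg ai e4; have [J2 bJ] := cond_exp_cvg bi e4.
exists (maxn J1 J2) => J JJ.
have {}aJ := aJ J (leq_trans (leq_maxl _ _) JJ).
have {}bJ := bJ J (leq_trans (leq_maxr _ _) JJ).
pose da x := `|a x - cond_exp J a x|; pose db x := `|b x - cond_exp J b x|.
have dai : rint da by apply: rint_norm; apply: rintB => //; exact: rint_cond_exp.
have dbi : rint db by apply: rint_norm; apply: rintB => //; exact: rint_cond_exp.
have fi : cint f by [].
have condB (g : K -> R) x : rint g -> (forall x, D x -> `|g x| <= B) -> D x -> `|cond_exp J g x| <= B.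
  move=> gi gB Dx; have okx : node_ok (x, J) by [].
  rewrite (le_trans (ler_norm_av okx gi))// -[leRHS](av_cst B (x, J)).
  by apply: ler_av => //; [exact: rint_norm|exact: rint_cst|move=> t /(nball_sub okx)/gB].
have dn x : D x -> normc (f x - S (q ^ J) f x) <= da x + db x.
  move=> Dx; rewrite fourier_sum_average//.
  by apply: le_trans (ler_normc_ReIm _) _; rewrite /da /db /cond_exp /a /b /cav ReD ImD.
have dL x : D x -> da x + db x <= L.
  move=> Dx; have := ler_normB (a x) (cond_exp J a x); have := ler_normB (b x) (cond_exp J b x).
  have := aB x Dx; have := bB x Dx; have := condB a x ai aB Dx; have := condB b x bi bB Dx.
  by rewrite /L /da /db; lra.
pose T x := w x * \1_(large n w) x.
have Ti : rint T by exact: rint_tail.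
pose bound x := M * L `^ (p - 1) * (da x + db x) + L `^ p * T x.
have boundi : rint bound by apply: rintD; apply: rintZ => //; exact: rintD.
have [_ gi] : wLp (fun x => f x - S (q ^ J) f x).
  apply: wLpD; first exact: wLp_bounded fB.
  exact/wLpN/wLp_fourier_sum.
apply: (@le_trans _ _ (av bound root)).
  apply: ler_av => //; first exact: root_ok.
  rewrite nball_D => x Dx.
  set z := normc _; have z0 : 0 <= z by exact: normc_ge0.
  have zd : z <= da x + db x by exact: dn.
  have zL : z <= L by exact: le_trans (dL x Dx).
  have zp : z `^ p <= L `^ p by apply: ler_powRl => //; exact: ltW p_gt0.
  have zp1 : z `^ p <= L `^ (p - 1) * z.
    have [->|zn] := eqVneq z 0; first by rewrite mulr0 powR0// gt_eqF// p_gt0.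
    have zgt : 0 < z by rewrite lt_neqAle eq_sym zn.
    rewrite -{2}(powRr1 z0) -(subrK 1 p) addrK -powR_mulB//.
    by rewrite ler_wpM2r ?powR_ge0//; apply: ler_powRl => //; exact: ltW p1_gt0.
  rewrite /bound /T indicE largeE//; case: ltP => wn.
    rewrite mulr1 (le_trans (_ : _ <= L `^ p * w x))//; first by rewrite ler_pM2r.
    rewrite lerDr; apply: mulr_ge0; last by rewrite (le_trans z0).
    by apply: mulr_ge0; exact: ltW.
  rewrite !mulr0 addr0.
  have wM : w x <= M by rewrite (le_trans wn)// lerDl.
  rewrite mulrC -mulrA; apply: ler_pM => //; [exact: ltW|exact: powR_ge0|].
  by apply: (le_trans zp1); rewrite ler_pM2l.
rewrite avD ?avZ ?avD//; try exact: root_ok; try exact: rintD; try (by apply: rintZ => //; exact: rintD).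
have ML : 0 < M * L `^ (p - 1) by rewrite mulr_gt0.
have h1 : M * L `^ (p - 1) * (av da root + av db root) <= e / 2.
  rewrite mulrC -ler_pdivlMr//.
  have -> : e / 2 / (M * L `^ (p - 1)) = e / 4 / (M * L `^ (p - 1)) + e / 4 / (M * L `^ (p - 1)).
    by rewrite -mulrDl; congr (_ / _); field.
  exact (lerD aJ bJ).
have h2 : L `^ p * av T root <= e / 2 by rewrite mulrC -ler_pdivlMr.
by rewrite [leRHS]splitr lerD.
Qed.

(** ** Uniform bounds give convergence *)

Section BoundedToConvergence.
Variables (C : R) (C0 : 0 <= C).
Hypothesis S_bounded : forall f, wLp f ->
  cint f /\ forall n, Nm (S n f) <= C * Nm f.

Lemma Nm_fourier_sumB n f : wLp f -> Nm (fun x => S n f x - f x) <= 2 `^ p * (C + 1) * Nm f.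
Proof.
move=> fL; have [_ Sf] := S_bounded fL.
apply: le_trans (Nm_add (wLp_fourier_sum n f) (wLpN fL)) _.
by rewrite NmN -mulrA ler_pM2l ?powR_gt0// mulrDl mul1r lerD2r.
Qed.

Lemma Nm_distC f h : Nm (fun x => f x - h x) = Nm (fun x => h x - f x).
Proof. by rewrite -NmN; apply: eq_av => x _; rewrite opprB. Qed.

(** The large values of [f] have small norm, on which the uniform bound is used,
    and the rest of [f] is bounded. *)
Lemma fourier_sum_approx f e : wLp f -> 0 < e ->
  exists J : nat, Nm (fun x => f x - S (q ^ J) f x) <= e.
Proof.
move=> fL e0; have [fm fi] := fL.
have nfm : rmeas (fun x => normc (f x)) by exact: rmeas_normc.
pose A : R := 2 `^ p; have A0 : 0 < A by exact: powR_gt0.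
pose B : R := 2 `^ p * (C + 1).
have B0 : 0 < B by rewrite mulr_gt0// ltr_wpDl.
have e2 : 0 < e / 2 / A / B by rewrite !divr_gt0.
have fw0 x : 0 <= normc (f x) `^ p * w x by rewrite mulr_ge0 ?powR_ge0 ?ltW.
have [n tail] := tail_cvg fw0 fi nfm e2.
pose T := large n (fun x => normc (f x)).
have mT : rmeas \1_T by exact: rint_meas (rint_indic (measurable_large n nfm)).
have indm (g : K -> R) : rmeas g -> cmeas (fun x => Complex (g x) 0).
  by move=> gm; split => //; exact: measurable_cst.
pose f2 x := f x * Complex (\1_T x) 0.
pose f1 x := f x * Complex (1 - \1_T x) 0.
have f2m : cmeas f2 by apply: cmeasM => //; exact: indm.
have f1m : cmeas f1.
  by apply: cmeasM => //; apply: indm; apply: measurable_funB => //; exact: measurable_cst.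
have f1B x : D x -> normc (f1 x) <= n%:R.
  move=> Dx; rewrite Normc.normcM normc_real; last first.
    by rewrite indicE; case: (_ \in _); rewrite ?subrr ?subr0.
  by rewrite indicE largeE//; case: ltP => h /=; rewrite ?subrr ?mulr0// subr0 mulr1.
have f2w x : normc (f2 x) `^ p * w x = normc (f x) `^ p * w x * \1_T x.
  rewrite Normc.normcM normc_real; last by rewrite indicE; case: (_ \in _).
  rewrite indicE; case: (_ \in _); rewrite ?mulr1//= !mulr0 powR0 ?mul0r//.
  by rewrite gt_eqF// p_gt0.
have f2L : wLp f2.
  split => //; apply: eq_rint (rint_tail n fi nfm) => x _; exact/esym/f2w.
have f1L : wLp f1 := wLp_bounded f1m f1B.
have fE : f = fun x => f1 x + f2 x.
  apply/funext => x; rewrite /f1 /f2 -mulrDr -[LHS]mulr1; congr (_ * _).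
  by apply: eqC; rewrite ?ReD ?ImD /= ?subrK ?addr0.
have [c1 _] := S_bounded f1L; have [c2 _] := S_bounded f2L.
have [J0 /(_ J0 (leqnn _)) f1J] :=
  Nm_cond_exp_bounded f1m f1B (divr_gt0 (divr_gt0 e0 (ltr0n _ 2)) A0).
exists J0.
have -> : Nm (fun x => f x - S (q ^ J0) f x) =
    Nm (fun x => (f1 x - S (q ^ J0) f1 x) + (f2 x - S (q ^ J0) f2 x)).
  apply: eq_av => x _; congr (normc _ `^ p * _).
  by rewrite {2}fE fourier_sumD// [in LHS]fE opprD addrACA.
apply: le_trans (Nm_add _ _) _.
- by apply: wLpD => //; apply/wLpN/wLp_fourier_sum.
- by apply: wLpD => //; apply/wLpN/wLp_fourier_sum.
have f2J : Nm (fun x => f2 x - S (q ^ J0) f2 x) <= e / 2 / A.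
  have := Nm_fourier_sumB (q ^ J0)%N f2L; rewrite -/B Nm_distC => h.
  apply: (le_trans h); rewrite mulrC -ler_pdivlMr//; apply: le_trans tail.
  by rewrite le_eqVlt; apply/orP; left; apply/eqP; apply: eq_av => x _; exact: f2w.
apply: (le_trans (ler_wpM2l (ltW A0) (lerD f1J f2J))).
rewrite (_ : A * _ = e)//; rewrite [X in _ = X]splitr mulrDr.
by congr (_ + _); rewrite mulrC divfK// gt_eqF.
Qed.

(** For [n >= q ^ J] the error for [f] is the error for [f - S (q ^ J) f], which
    the uniform bound controls by the norm of this function. *)
Lemma fourier_sum_cvg f e : wLp f -> 0 < e ->
  exists n0 : nat, forall n, (n0 <= n)%N -> Nm (fun x => S n f x - f x) <= e.
Proof.
move=> fL e0.
have B0 : 0 < 2 `^ p * (C + 1) by rewrite mulr_gt0 ?powR_gt0// ltr_wpDl.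
have [J fJ] := fourier_sum_approx fL (divr_gt0 e0 B0).
exists (q ^ J)%N => n Jn; have [fi _] := S_bounded fL.
have gL : wLp (fun x => f x - S (q ^ J) f x).
  by apply: wLpD => //; apply/wLpN/wLp_fourier_sum.
have h0 := Nm_fourier_sumB n gL.
have -> : Nm (fun x => S n f x - f x) =
    Nm (fun x => S n (fun t => f t - S (q ^ J) f t) x - (f x - S (q ^ J) f x)).
  apply: eq_av => x _; congr (normc _ `^ p * _).
  rewrite fourier_sumB//; last exact: cint_fourier_sum.
  by rewrite fourier_sum_sum// opprB addrA subrK.
by apply: (le_trans h0); rewrite mulrC -ler_pdivlMr.
Qed.

End BoundedToConvergence.

(** ** From convergence back to the weight condition *)

(** The ball condition for the balls inside [D], in real numbers. *)
Definition muckenhoupt := rint sigma /\ exists2 C : R, 0 < C &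
  forall Q, node_ok Q -> av w Q * av sigma Q `^ (p - 1) <= C.

Lemma eq_ae_av (f g : K -> R) Q : node_ok Q -> rmeas f -> rmeas g ->
  (forall x, 0 <= f x) -> (forall x, 0 <= g x) ->
  ae_eq mu (D : set (borel K)) f g -> av f Q = av g Q.
Proof.
move=> okQ fm gm f0 g0 [N [mN N0 fg]]; rewrite /av /Rintegral; congr (_ * fine _).
have QD := nball_sub okQ; have mQ := measurable_nball Q.
apply: ge0_ae_eq_integral => //.
- by apply/measurable_EFinP; exact: measurable_funS measurable_D QD fm.
- by apply/measurable_EFinP; exact: measurable_funS measurable_D QD gm.
- by move=> x _; rewrite lee_fin.
- by move=> x _; rewrite lee_fin.
exists N; split => // x nx; apply: fg => fgx; apply: nx => Qx.
by rewrite fgx//; exact: QD.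
Qed.

Lemma ae_eq_rint (f g : K -> R) : rmeas f -> rint g ->
  ae_eq mu (D : set (borel K)) f g -> rint f.
Proof.
move=> fm gi [N [mN N0 fg]]; apply/integrableP; split; first exact/measurable_EFinP.
move/integrableP : (gi) => [gm]; rewrite [X in (X < _)%E -> _](_ : _ =
  \int[mu]_(x in D) `|(EFin \o (f : borel K -> R)) x|)%E//.
apply: ge0_ae_eq_integral => //.
- exact: measurable_D.
- exact: measurableT_comp.
- by apply: measurableT_comp => //; exact/measurable_EFinP.
- by exists N; split => // x nx; apply: fg => fgx; apply: nx => Dx /=; rewrite fgx.
Qed.

(** All averages of [w] over balls of equal radius agree, hence all conditional
    expectations of [w] are constant, and so is their limit [w]. *)
Lemma invariant_muckenhoupt : (forall a b (k : int),
    (\int[mu]_(x in cball a k) (w x)%:E = \int[mu]_(x in cball b k) (w x)%:E)%E) ->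
  muckenhoupt.
Proof.
move=> winv; pose r := av w root.
have r0 : 0 < r by apply: av_gt0 => //; exact: root_ok.
have wr J x : D x -> cond_exp J w x = r.
  move=> Dx; have E t : cond_exp J w t = cond_exp J w x.
    by rewrite /cond_exp /av /Rintegral /nball/= (winv t x).
  rewrite /r -(av_cond_exp J w_int) -[LHS](av_cst _ root); apply: eq_av => t _.
  exact/esym/E.
have wrae : ae_eq mu (D : set (borel K)) w (fun=> r).
  have di : rint (fun x => w x - r) by apply: rintB => //; exact: rint_cst.
  have d0 : av (fun x => `|w x - r|) root = 0.
    apply/eqP; rewrite eq_le av_ge0 ?andbT// leNgt; apply/negP => d0.
    have [J /(_ J (leqnn J))] := cond_exp_cvg w_int (divr_gt0 d0 (ltr0n _ 2)).
    have -> : av (fun x => `|w x - cond_exp J w x|) root = av (fun x => `|w x - r|) root.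
      by apply: eq_av => x; rewrite nball_D => Dx; rewrite wr.
    by rewrite ler_pdivlMr// leNgt mulr_natr mulr2n ltrDl d0.
  have dni := rint_norm di.
  have : (\int[mu]_(x in D) `|(w x - r)%:E| = 0)%E.
    have := integrable_fin_num measurable_D dni => /fineK <-.
    move: d0; rewrite /av expr0 invr1 mul1r nball_D /Rintegral.
    by move=> ->.
  move/(ae_eq_integral_abs mu measurable_D (measurable_int _ di)).1 => [N [mN N0 NE]].
  exists N; split => // x nx; apply: NE => h; apply: nx => Dx.
  by have /= := h Dx => -[] /eqP; rewrite subr_eq0 => /eqP.
have sm := dual_weight_meas; pose s : R := r `^ (- (p - 1)^-1).
have srae : ae_eq mu (D : set (borel K)) sigma (fun=> s).
  have [N [mN N0 NE]] := wrae; exists N; split => // x nx; apply: NE => h; apply: nx => Dx.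
  by rewrite /dual_weight h.
have s0 : 0 < s by exact: powR_gt0.
split; first by apply: (ae_eq_rint sm (rint_cst s)).
exists (r * s `^ (p - 1)); first by rewrite mulr_gt0// powR_gt0.
move=> Q okQ.
have -> : av w Q = r.
  rewrite -[RHS](av_cst r Q); apply: eq_ae_av => //; first exact: measurable_cst.
    by move=> x; exact: ltW.
  by move=> _; exact: ltW.
suff -> : av sigma Q = s by [].
rewrite -[RHS](av_cst s Q); apply: eq_ae_av => //; first exact: measurable_cst.
  by move=> x; exact/ltW/dual_weight_gt0.
by move=> _; exact: ltW.
Qed.

Lemma av_ball_indic (g : K -> R) Q : node_ok Q ->
  av (fun x => g x * \1_(nball Q) x) root = abs varpi ^+ Q.2 * av g Q.
Proof.
move=> okQ; rewrite /av expr0 invr1 mul1r nball_D mulrA mulfV; last first.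
  by rewrite expf_neq0// gt_eqF// abs_varpi_gt0.
rewrite mul1r -[in RHS](setIidr (nball_sub okQ)) Rintegral_mkcondr.
by apply: eq_Rintegral => x _; rewrite patchE indicE; case: ifP => _; rewrite ?mulr1 ?mulr0.
Qed.

Lemma ler_ae_av (f g : K -> R) Q : node_ok Q -> rint f -> rint g ->
  (forall x, 0 <= f x) -> (forall x, 0 <= g x) ->
  {ae mu, forall x, nball Q x -> f x <= g x} -> av f Q <= av g Q.
Proof.
move=> okQ fi gi f0 g0 [N [mN N0 fg]].
rewrite /av ler_pM2l ?nball_rad_gt0//; apply: fine_le.
- by have := integrable_fin_num (measurable_nball Q) (rint_nball okQ fi).
- by have := integrable_fin_num (measurable_nball Q) (rint_nball okQ gi).
apply: ae_ge0_le_integral => //.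
- exact: measurable_nball.
- by move=> x _; rewrite lee_fin.
- exact: measurable_int (rint_nball okQ fi).
- by move=> x _; rewrite lee_fin.
- exact: measurable_int (rint_nball okQ gi).
by exists N.
Qed.

Definition trunc (M : nat) x : R := Num.min (sigma x) M%:R.

Lemma trunc_ge0 M x : 0 <= trunc M x.
Proof. by rewrite le_min (ltW (dual_weight_gt0 x)) ler0n. Qed.

Lemma trunc_int M : rint (trunc M).
Proof.
apply: (rint_bounded (B := M%:R)).
  by apply: measurable_minr; [exact: dual_weight_meas|exact: measurable_cst].
by move=> x _; rewrite ger0_norm ?trunc_ge0// ge_min lexx orbT.
Qed.

(** Without the truncation this is the identity [sigma ^ p * w = sigma]. *)
Lemma trunc_pow M x : trunc M x `^ p * w x <= trunc M x.
Proof.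
have := trunc_ge0 M x; rewrite le_eqVlt => /orP[/eqP <-|t0].
  by rewrite powR0 ?mul0r// gt_eqF// p_gt0.
have -> : trunc M x `^ p = trunc M x * trunc M x `^ (p - 1).
  by rewrite -{2}(powRr1 (ltW t0)) powR_mulB// addrC subrK.
rewrite -mulrA ger_pMr//.
have s1 : sigma x `^ (p - 1) * w x = 1.
  by rewrite -(dual_weightK x) powR_mulB ?dual_weight_gt0// addrA subrK subrr powRr0.
rewrite -[leRHS]s1 ler_pM2r//; apply: ler_powRl; [exact: ltW p1_gt0|exact: ltW|].
by rewrite ge_min lexx.
Qed.

Lemma trunc_cvg Q (V : R) : node_ok Q -> (forall M, av (trunc M) Q <= V) ->
  (\int[mu]_(x in nball Q) (sigma x)%:E <= (abs varpi ^+ Q.2 * V)%:E)%E.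
Proof.
move=> okQ tV; have mQ := measurable_nball Q.
pose g (M : nat) x := (trunc M x)%:E.
have E : (\int[mu]_(x in nball Q) (sigma x)%:E =
    \int[mu]_(x in nball Q) limn (g^~ x))%E.
  apply: eq_integral => x _; apply/esym/cvg_lim => //; apply: cvg_near_cst.
  exists (Num.bound (sigma x)) => //= M /= sM; rewrite /g /trunc min_l//.
  rewrite (le_trans (ltW (archi_boundP (ltW (dual_weight_gt0 x)))))// ler_nat.
  exact: sM.
have gm M : measurable_fun (nball Q : set (borel K)) (g M).
  exact: measurable_int (rint_nball okQ (trunc_int M)).
have g0 M x : nball Q x -> (0 <= g M x)%E by rewrite lee_fin trunc_ge0.
have nd x : nball Q x -> {homo g^~ x : n m / (n <= m)%N >-> (n <= m)%E}.
  by move=> _ n m nm; rewrite lee_fin /trunc le_min !ge_min lexx/= ler_nat nm orbT.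
rewrite E (monotone_convergence mu mQ gm g0 nd); apply: lime_le.
  apply: ereal_nondecreasing_is_cvgn => n m nm; apply: ge0_le_integral => //.
  - by move=> x /g0.
  - by move=> x /nd; exact.
apply: nearW => M.
have := integrable_fin_num mQ (rint_nball okQ (trunc_int M)) => /fineK <-.
rewrite lee_fin -ler_pdivrMl ?exprn_gt0 ?abs_varpi_gt0//.
exact: tV.
Qed.

(** The sum of the series, which is finite almost everywhere as its terms have
    summable integrals; [fine] makes it finite on the exceptional set. *)
Lemma series_dominates (g : nat -> K -> R) : (forall i x, 0 <= g i x) ->
  (forall i, rint (g i)) -> (forall i, av (g i) root <= 1 / (2 ^ i.+1)%:R) ->
  exists h : K -> R, [/\ forall x, 0 <= h x, rint h &
    {ae mu, forall x, D x -> forall i, g i x <= h x}].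
Proof.
move=> g0 gi ga; pose H (x : borel K) : \bar R := (\sum_(i <oo) (g i x)%:E)%E.
have mD := measurable_D.
have e0 i x : (0 <= (g i x)%:E)%E by rewrite lee_fin.
have H0 x : (0 <= H x)%E by apply: nneseries_ge0 => i _ _.
have gm i : measurable_fun (D : set (borel K)) (fun x : borel K => (g i x)%:E).
  exact: measurable_int (gi i).
have Hm : measurable_fun (D : set (borel K)) H.
  have := @ge0_emeasurable_sum _ (borel K) R D (fun i x => (g i x)%:E) xpredT
    (fun i x _ _ => e0 i x) (fun i _ => gm i).
  by [].
have HI : (\int[mu]_(x in D) H x <= 1)%E.
  rewrite integral_nneseries//; apply: le_trans (epsilon_trick0 xpredT ler01).
  apply: lee_nneseries => [i _ _|i _]; first by apply: integral_ge0.
  have := integrable_fin_num mD (gi i) => /fineK <-.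
  by move: (ga i); rewrite lee_fin /av expr0 invr1 mul1r nball_D.
have Hi : mu.-integrable (D : set (borel K)) H.
  apply/integrableP; split => //.
  by under eq_integral do rewrite gee0_abs//; rewrite (le_lt_trans HI)// ltry.
exists (fun x => fine (H x)); split.
- by move=> x; exact: fine_ge0.
- apply: (le_integrable mD _ _ Hi).
    by apply/measurable_EFinP; exact: measurableT_comp.
  move=> x _; rewrite [leRHS]gee0_abs//= ger0_norm ?fine_ge0//.
  by case: (H x) (H0 x) => [r| |]//= _; rewrite leey.
have [N [mN N0 HN]] := integrable_ae mD Hi; exists N; split => // x nx; apply: HN => fx.
apply: nx => Dx i; rewrite -lee_fin fineK; last exact: fx.
have := @nneseries_lim_ge R (fun i => (g i x)%:E) xpredT 0%N i.+1 (fun i _ _ => e0 i x).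
by apply: le_trans; rewrite big_nat_recr//= leeDr// sume_ge0.
Qed.

Section UniformlyBounded.
Hypothesis S_orbit : forall f, wLp f -> cint f /\ exists B : R, forall n, Nm (S n f) <= B.

(** Otherwise there are balls [B i] and truncations [s i] of the dual weight
    violating the bound badly.  The functions [s i] restricted to [B i] and
    suitably scaled have a common majorant in the weighted space, yet the partial
    sums that average over [B i] blow up. *)
Lemma trunc_bounded : exists2 C : R, 0 < C & forall Q M, node_ok Q ->
  av w Q * av (trunc M) Q `^ (p - 1) <= C.
Proof.
have p0 := p_gt0; have p10 := p1_gt0; apply: contrapT => H.
have bad i : exists QM : (K * nat) * nat, node_ok QM.1 /\
    (4 ^ i.+1)%:R < av w QM.1 * av (trunc QM.2) QM.1 `^ (p - 1).
  apply: contrapT => Hi; apply: H; exists (4 ^ i.+1)%:R; first by rewrite ltr0n expn_gt0.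
  move=> Q M okQ; rewrite leNgt; apply/negP => QM; apply: Hi; by exists (Q, M).
have [QM QMP] := choice bad; pose B i := (QM i).1; pose s i := trunc (QM i).2.
have okB i : node_ok (B i) := (QMP i).1.
have sB i : (4 ^ i.+1)%:R < av w (B i) * av (s i) (B i) `^ (p - 1) := (QMP i).2.
have si i : rint (s i) := trunc_int _.
pose A i := av (s i) (B i).
have A0 i : 0 < A i.
  rewrite lt_neqAle av_ge0 ?andbT; last by move=> x _; exact: trunc_ge0.
  apply/eqP => A00; have := sB i; rewrite -/(A i) -A00 powR0 ?gt_eqF// mulr0.
  by rewrite ltNge ler0n.
pose b i : R := abs varpi ^+ (B i).2.
have b0 i : 0 < b i by rewrite exprn_gt0// abs_varpi_gt0.
(* chosen so that the [i]-th hump has integral [2 ^- i.+1] *)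
pose t i : R := (2 ^ i.+1)%:R^-1 / (b i * A i).
have two0 i : 0 < (2 ^ i.+1)%:R^-1 :> R by rewrite invr_gt0 ltr0n expn_gt0.
have bA i : 0 < b i * A i := mulr_gt0 (b0 i) (A0 i).
have t0 i : 0 < t i := divr_gt0 (two0 i) (bA i).
have tE i : t i * (b i * A i) = (2 ^ i.+1)%:R^-1.
  by rewrite /t divfK// gt_eqF.
pose g i x := t i * (s i x * \1_(nball (B i)) x).
have i0 (X : set K) x : 0 <= \1_X x :> R by rewrite indicE.
have g0 i x : 0 <= g i x 
  by exact: mulr_ge0 (ltW (t0 i)) (mulr_ge0 (trunc_ge0 _ x) (i0 _ x)).
have sBi i : rint (fun x => s i x * \1_(nball (B i)) x).
  by apply: rint_mul_indic => //; exact: measurable_nball.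
have gi i : rint (g i) := rintZ _ (sBi i).
have ga i : av (g i) root <= 1 / (2 ^ i.+1)%:R.
  rewrite /g (avZ _ root_ok (sBi i)) (av_ball_indic _ (okB i)).
  by rewrite -/(b i) -/(A i) tE mul1r.
have [h [h0 hi hg]] := series_dominates g0 gi ga.
(* then [phi ^ p * w = h] is integrable, and [phi] exceeds each scaled [s i] *)
pose phi x : R := (h x / w x) `^ p^-1.
have phi0 x : 0 <= phi x by exact: powR_ge0.
have phip x : phi x `^ p * w x = h x.
  rewrite -powRrM mulVf ?gt_eqF// powRr1 ?divr_ge0// ?(ltW (w0 x))//.
  by rewrite divfK// gt_eqF.
have phim : rmeas phi.
  apply: rmeas_powR; apply: measurable_funM; first exact: rint_meas.
  have -> : (fun x => (w x)^-1) = (fun x => w x `^ (- 1)).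
    by apply/funext => x; rewrite powR_inv1// ltW.
  exact: rmeas_powR.
have fL : wLp (real_to_cplx phi).
  split; first by split => //; exact: measurable_cst.
  by apply: eq_rint hi => x _; rewrite /real_to_cplx normc_real// phip.
have [[phii _] [V SV]] := S_orbit fL.
pose i := Num.bound `|V|.
have := SV (q ^ (B i).2)%N; apply/negP; rewrite -ltNge.
have Vi : V <= i%:R := le_trans (ler_norm V) (ltW (archi_boundP (normr_ge0 V))).
apply: (le_lt_trans Vi).
pose e i : R := t i `^ p^-1.
have e0 i : 0 <= e i := powR_ge0 _ _.
have es0 x : 0 <= e i * s i x := mulr_ge0 (e0 i) (trunc_ge0 _ x).
have phiA : e i * A i <= av phi (B i).
  rewrite -avZ//; apply: ler_ae_av => //.
  - exact: rintZ.
  have [N [mN N0 HN]] := hg; exists N; split => // x nx; apply: HN => hgx; apply: nx => Bx.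
  have Dx : D x := nball_sub (okB i) Bx.
  rewrite -[leLHS](powRr1 (es0 x)).
  have -> : (1 : R) = p * p^-1 by rewrite mulfV// gt_eqF.
  rewrite powRrM; apply: ler_powRl; [by rewrite invr_ge0 ltW|exact: powR_ge0|].
  rewrite (powRM _ (e0 i) (trunc_ge0 _ x)) -powRrM mulVf ?gt_eqF// powRr1 ?(ltW (t0 i))//.
  rewrite ler_pdivlMr// -mulrA; apply: le_trans (hgx Dx i).
  rewrite /g indicE mem_set// mulr1 ler_pM2l//; exact: trunc_pow.
have Slow x : nball (B i) x -> e i * A i <= normc (S (q ^ (B i).2) (real_to_cplx phi) x).
  move=> Bx; have Dx : D x := nball_sub (okB i) Bx.
  rewrite cond_exp_fourier// /real_to_cplx normc_real; last by apply: av_ge0.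
  rewrite /cond_exp; apply: (le_trans phiA).
  by rewrite le_eqVlt /av /=; apply/orP; left; rewrite (nball_eq Bx).
have eA0 : 0 <= e i * A i := mulr_ge0 (e0 i) (ltW (A0 i)).
pose G x := normc (S (q ^ (B i).2) (real_to_cplx phi) x) `^ p * w x.
have Gi : rint G by have [] := wLp_fourier_sum (q ^ (B i).2) (real_to_cplx phi).
have wBi : rint (fun x => w x * \1_(nball (B i)) x).
  by apply: rint_mul_indic => //; exact: measurable_nball.
apply: (@lt_le_trans _ _ (av (fun x => (e i * A i) `^ p * (w x * \1_(nball (B i)) x)) root)).
  rewrite avZ ?av_ball_indic//; last exact: root_ok.
  rewrite -/(b i) (powRM _ (e0 i) (ltW (A0 i))) -powRrM mulVf ?gt_eqF//.
  rewrite powRr1 ?(ltW (t0 i))//.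
  have -> : A i `^ p = A i * A i `^ (p - 1).
    by rewrite -{2}(powRr1 (ltW (A0 i))) powR_mulB// addrC subrK.
  have -> : t i * (A i * A i `^ (p - 1)) * (b i * av w (B i)) =
      t i * (b i * A i) * (av w (B i) * A i `^ (p - 1)) by ring.
  rewrite tE; apply: (@lt_trans _ _ (2 ^ i.+1)%:R).
    by rewrite ltr_nat; apply: (ltn_trans (ltnSn i)); exact: ltn_expl.
  have p24 : (2 ^ i.+1)%:R = (2 ^ i.+1)%:R^-1 * (4 ^ i.+1)%:R :> R.
    rewrite (_ : 4 = 2 * 2)%N// expnMn natrM mulKf// pnatr_eq0 expn_eq0//.
  by rewrite [ltLHS]p24 ltr_pM2l.
apply: ler_av => //; [exact: root_ok|exact: rintZ|].
move=> x _; rewrite indicE; case: (boolP (x \in nball (B i))) => [/set_mem Bx|_].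
  rewrite mulr1 ler_pM2r//; apply: ler_powRl; [exact: ltW|by []|exact: Slow].
by rewrite !mulr0 mulr_ge0 ?powR_ge0// ltW.
Qed.

Lemma bounded_muckenhoupt : muckenhoupt.
Proof.
have p10 := p1_gt0; have [C C0 CP] := trunc_bounded.
pose V Q := (C / av w Q) `^ (p - 1)^-1.
have w0' Q : node_ok Q -> 0 < av w Q by move=> okQ; exact: av_gt0.
have tV Q M : node_ok Q -> av (trunc M) Q <= V Q.
  move=> okQ; have t0 : 0 <= av (trunc M) Q by apply: av_ge0 => x _; exact: trunc_ge0.
  rewrite -[leLHS](powRr1 t0); have -> : (1 : R) = (p - 1) * (p - 1)^-1 by rewrite mulfV// gt_eqF.
  rewrite powRrM; apply: ler_powRl; [by rewrite invr_ge0 ltW|exact: powR_ge0|].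
  by rewrite ler_pdivlMr ?w0'// mulrC; exact: CP.
have sV Q (okQ : node_ok Q) := trunc_cvg okQ (fun M => tV Q M okQ).
have sigma_int : rint sigma.
  apply/integrableP; split; first by apply/measurable_EFinP; exact: dual_weight_meas.
  have -> : (\int[mu]_(x in D) `|(EFin \o (sigma : borel K -> R)) x| =
      \int[mu]_(x in nball root) (sigma x)%:E)%E.
    rewrite nball_D; apply: eq_integral => x _ /=.
    by rewrite ger0_norm// ltW// dual_weight_gt0.
  by apply: (le_lt_trans (sV root root_ok)); rewrite ltry.
split => //; exists C => // Q okQ.
have sQ : av sigma Q <= V Q.
  have := sV Q okQ; have := integrable_fin_num (measurable_nball Q) (rint_nball okQ sigma_int).
  move=> /fineK <-; rewrite lee_fin -ler_pdivrMl ?exprn_gt0 ?abs_varpi_gt0//.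
have s0 : 0 <= av sigma Q by apply: av_ge0 => x _; rewrite ltW// dual_weight_gt0.
rewrite mulrC -ler_pdivlMr ?w0'//.
have -> : C / av w Q = V Q `^ (p - 1).
  by rewrite -powRrM mulVf ?gt_eqF// powRr1// divr_ge0 ?(ltW C0) ?(ltW (w0' Q okQ)).
by apply: ler_powRl => //; exact: ltW.
Qed.

End UniformlyBounded.

(** * The implications *)

Lemma average_nball (g : K -> R) Q : node_ok Q -> rint g ->
  average mu (nball Q) g = (av g Q)%:E.
Proof.
move=> okQ gi; rewrite /average measure_cball EFinM /= -exprnP.
by have := integrable_fin_num (measurable_nball Q) (rint_nball okQ gi) => /fineK <-.
Qed.

Lemma integral_big_ball (g : K -> R) (n : nat) a : measurable_fun [set: borel K] (g : borel K -> R) ->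
  rint g -> (forall m, ball_invariant g (u m)) ->
  (\int[mu]_(x in cball a (- n%:Z)) (g x)%:E = (abs varpi ^- n * av g root)%:E)%E.
Proof.
move=> gm gi gu.
have E0 : (\int[mu]_(x in D) (g x)%:E = (av g root)%:E)%E.
  by have := average_nball root_ok gi; rewrite /average nball_D mu1/= invr1 mul1e.
elim: n a => [|n IH] a.
  have [m Dm] := coset_rep a; rewrite oppr0 expr0 invr1 mul1r -[a](subrK (u m)) gu -E0.
  rewrite integersE (@cball_eq _ 0)//.
  by rewrite subr0 expr0z.
rewrite integral_child; last exact: measurable_funTS.
have -> : - n.+1%:Z + 1 = - n%:Z by rewrite -PoszD1 opprD subrK.
under eq_bigr do rewrite IH.
rewrite sumEFin sumr_const -mulr_natl mulrA; congr (_ * _)%:E.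
by rewrite exprS invfM abs_varpiE invrK.
Qed.

(** By periodicity a small ball has the same averages as a translate of it in [D],
    and a large ball, a union of translates of [D], the same averages as [D]. *)
Lemma average_cball a k : exists2 Q, node_ok Q & forall g : K -> R,
  measurable_fun [set: borel K] (g : borel K -> R) -> rint g ->
  (forall m, ball_invariant g (u m)) -> average mu (cball a k) g = (av g Q)%:E.
Proof.
case: k => n; last rewrite NegzE.
  have [m Dm] := coset_rep a; exists (a - u m, n) => // g gm gi gu.
  rewrite -average_nball// /average /nball/= -[in LHS](subrK (u m) a) gu.
  by rewrite !measure_cball.
exists root; first exact: root_ok.
move=> g gm gi gu; rewrite /average integral_big_ball// measure_cball -EFinM /=.
by rewrite -invr_expz invrK mulrA mulfV ?mul1r// expf_neq0// gt_eqF// abs_varpi_gt0.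
Qed.

Lemma weighted_LpE f : weighted_Lp mu D w p f <-> wLp f.
Proof.
have fw0 x : 0 <= normc (f x) `^ p * w x by rewrite mulr_ge0 ?powR_ge0 ?ltW.
have E : (\int[mu]_(x in D) `|(normc (f x) `^ p * w x)%:E| = weighted_pintegral mu D w p f)%E.
  by apply: eq_integral => x _; rewrite gee0_abs// lee_fin.
split=> -[fm fi]; split => //.
  apply/integrableP; split; last by rewrite -E in fi.
  apply/measurable_EFinP; apply: measurable_funM => //; apply: rmeas_powR.
  exact: rmeas_normc.
by rewrite -E; move/integrableP : fi => [].
Qed.

Lemma weighted_pintegralE f : wLp f -> weighted_pintegral mu D w p f = (Nm f)%:E.
Proof.
move=> [_ fi]; have := average_nball root_ok fi.
by rewrite /average nball_D mu1/= invr1 mul1e.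
Qed.

Lemma muckenhoupt_norm_bound : muckenhoupt -> norm_bound p w.
Proof.
move=> [sigma_int [C _ CP]]; have [C' C'0 SP] := fourier_sum_weighted sigma_int CP.
exists C' => // f /weighted_LpE fL; split; first exact: wLp_cint.
move=> n; rewrite (weighted_pintegralE (wLp_fourier_sum n f)) (weighted_pintegralE fL).
by rewrite -EFinM lee_fin; exact: SP.
Qed.

Lemma norm_bound_convergence : norm_bound p w -> norm_convergence p w.
Proof.
move=> [C C0 CP] f _ /weighted_LpE fL; have p0 := p_gt0.
have SP h : wLp h -> cint h /\ forall n, Nm (S n h) <= C * Nm h.
  move=> hL; have [hi hP] := CP h ((weighted_LpE h).2 hL); split => // n.
  have := hP n; rewrite (weighted_pintegralE (wLp_fourier_sum n h)) (weighted_pintegralE hL).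
  by rewrite -EFinM lee_fin.
split; first by have [] := SP f fL.
have dL n : wLp (fun x => S n f x - f x) by apply: wLpD (wLp_fourier_sum n f) (wLpN fL).
have E n : weighted_Lp_norm mu D w p (fun x => S n f x - f x) =
    ((Nm (fun x => S n f x - f x)) `^ p^-1)%:E.
  by rewrite /weighted_Lp_norm weighted_pintegralE// poweR_EFin.
under eq_fun do rewrite E; apply/fine_cvgP; split; first exact: nearW.
apply/cvgrPdist_le => e e0; have ep0 : 0 < e `^ p by exact: powR_gt0.
have [n0 n0P] := fourier_sum_cvg (ltW C0) SP fL ep0.
exists n0 => // n /= nn0; rewrite sub0r normrN ger0_norm ?powR_ge0//.
rewrite -[leRHS](powRr1 (ltW e0)).
have -> : (1 : R) = p * p^-1 by rewrite mulfV// gt_eqF.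
rewrite powRrM; apply: ler_powRl; [by rewrite invr_ge0 ltW|exact: Nm_ge0|exact: n0P].
Qed.

Section Periodic.
Hypothesis w_measT : measurable_fun [set: borel K] (w : borel K -> R).
Hypothesis w_per : periodic_ae mu u w.

Lemma weight_invariant m : ball_invariant w (u m).
Proof. by apply: periodic_ball_invariant => // x; exact: ltW. Qed.

Lemma dual_weight_measT : measurable_fun [set: borel K] (sigma : borel K -> R).
Proof. by have := measurableT_comp (measurable_powR (- (p - 1)^-1)) w_measT. Qed.

Lemma dual_weight_invariant m : ball_invariant sigma (u m).
Proof.
apply: periodic_ball_invariant; first exact: dual_weight_measT.
  by move=> x; exact/ltW/dual_weight_gt0.
move=> n; have [N [mN N0 h]] := w_per n; exists N; split => // x nx; apply: h => wx.
by apply: nx; rewrite /= /dual_weight wx.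
Qed.

Lemma muckenhoupt_ball_condition : muckenhoupt -> ball_condition p w.
Proof.
move=> [si [C C0 CP]]; exists C => // B /field_ballE[a [k ->]].
have [Q okQ QP] := average_cball a k.
rewrite (QP w w_measT w_int weight_invariant).
rewrite (QP sigma dual_weight_measT si dual_weight_invariant).
by rewrite poweR_EFin -EFinM lee_fin; exact: CP.
Qed.

Lemma ball_condition_muckenhoupt : ball_condition p w -> muckenhoupt.
Proof.
move=> [C C0 CP]; have p10 := p1_gt0.
have CQ Q : node_ok Q -> ((av w Q)%:E * poweR (average mu (nball Q) sigma) (p - 1) <= C%:E)%E.
  move=> okQ; rewrite -(average_nball okQ w_int); apply: CP.
  by apply/field_ballE; exists Q.1, Q.2.
have si : rint sigma.
  apply/integrableP; split; first by apply/measurable_EFinP; exact: dual_weight_meas.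
  have -> : (\int[mu]_(x in D) `|(EFin \o (sigma : borel K -> R)) x| =
      average mu (nball root) sigma)%E.
    rewrite /average nball_D mu1/= invr1 mul1e; apply: eq_integral => x _ /=.
    by rewrite ger0_norm// ltW// dual_weight_gt0.
  rewrite ltNge leye_eq; apply/negP => /eqP E; have := CQ root root_ok.
  rewrite E poweRyr ?gt_eqF// gt0_muley ?leye_eq//.
  by rewrite lte_fin; apply: av_gt0 => //; exact: root_ok.
split => //; exists C => // Q okQ; have := CQ Q okQ.
by rewrite average_nball// poweR_EFin -EFinM lee_fin.
Qed.

(** In equal characteristic the convergence is applied to the periodic extension
    of a function on [D]: the partial sums only depend on its values on [D]. *)
Lemma norm_convergence_muckenhoupt : norm_convergence p w -> muckenhoupt.
Proof.
move=> cv; have p0 := p_gt0; have [l0|l0] := eqVneq (l%:R : K) 0; last first.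
  apply: invariant_muckenhoupt => a b k.
  exact: ball_invariant_dense l0 weight_invariant a b k.
apply: bounded_muckenhoupt => f fL.
pose h := periodization f.
have hf x : D x -> h x = f x by exact: periodizationE.
have hL : wLp h.
  have [[fr fim] fi] := fL; split; last by apply: eq_rint fi => x Dx; rewrite hf.
  split; [apply: eq_measurable_fun fr|apply: eq_measurable_fun fim] => x;
    by rewrite inE => Dx; rewrite hf.
have [hi hc] := cv h (periodization_periodic l0 f) ((weighted_LpE h).2 hL).
have fi : cint f by apply: eq_cint hi.
split => //.
have SE n x : S n h x = S n f x.
  rewrite !fourier_sumE; apply: eq_bigr => k _; congr (_ * _); apply: eq_cav => t.
  by rewrite nball_D => /hf ht; rewrite /modulate ht.
have dL n : wLp (fun x => S n h x - h x) by apply: wLpD (wLp_fourier_sum n h) (wLpN hL).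
have [n0 n0P] : exists n0 : nat, forall n, (n0 <= n)%N -> Nm (fun x => S n h x - h x) <= 1.
  move/fine_cvgP : hc => [_ /cvgrPdist_lt/(_ _ ltr01)[n0 _ n0P]].
  exists n0 => n nn0; have := n0P n nn0.
  rewrite /= sub0r normrN /weighted_Lp_norm weighted_pintegralE// poweR_EFin /=.
  rewrite ger0_norm ?powR_ge0// => N1; rewrite leNgt; apply/negP => N2; move: N1.
  have pow1 : 1 = 1 `^ p^-1 :> R by rewrite powR1.
  apply/negP; rewrite -leNgt [leLHS]pow1; apply: ler_powRl => //.
    by rewrite invr_ge0 ltW.
  exact: ltW.
exists (2 `^ p * (1 + Nm h) + \sum_(i < n0) Nm (S i f)) => n.
have b0 : 0 <= 2 `^ p * (1 + Nm h) by rewrite mulr_ge0 ?powR_ge0// addr_ge0// Nm_ge0.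
have [nn0|nn0] := ltnP n n0.
  rewrite (bigD1 (Ordinal nn0))//= addrCA lerDl addr_ge0//.
  by apply: sumr_ge0 => i _; exact: Nm_ge0.
apply: (@le_trans _ _ (2 `^ p * (1 + Nm h))); last first.
  by rewrite lerDl; apply: sumr_ge0 => i _; exact: Nm_ge0.
have -> : Nm (S n f) = Nm (fun x => (S n h x - h x) + h x).
  by apply: eq_av => x _; rewrite subrK SE.
apply: le_trans (Nm_add (dL n) hL) _.
by rewrite ler_pM2l ?powR_gt0// lerD2r n0P.
Qed.

End Periodic.
End Weighted.

(** The weight may be changed on a null set, and being positive everywhere it
    is easier to divide by. *)
Lemma positive_representative (w : K -> R) : weight mu w -> exists v : K -> R,
  [/\ measurable_fun [set: borel K] (v : borel K -> R), forall x, 0 < v x &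
      {ae mu, forall x, v x = w x}].
Proof.
move=> [wm _ [N [mN N0 wpos]]].
exists (fun x => if 0 < w x then w x else 1); split.
- by apply: measurable_fun_ifT => //; exact: measurable_fun_ltr.
- by move=> x; case: ifP.
by exists N; split => // x nx; apply: wpos => /= wx; apply: nx; rewrite /= wx.
Qed.

Lemma conditions_equivalent (w : K -> R) (p : R) :
  weight mu w -> periodic_ae mu u w -> 1 < p ->
  (ball_condition p w <-> norm_bound p w) /\ (norm_bound p w <-> norm_convergence p w).
Proof.
move=> w_weight w_per p1; have [wm wi _] := w_weight.
have [v [vm v0 vw]] := positive_representative w_weight.
have [N [mN N0 vwN]] := vw.
have wv : {ae mu, forall x, w x = v x}.
  by exists N; split => // x nx; apply: vwN => vwx; apply: nx; rewrite /= vwx.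
have vmD : rmeas v by exact: measurable_funTS.
have vi : rint v.
  apply: ae_eq_rint vmD (wi _ compact_integers) _.
  by exists N; split => // x nx; apply: vwN => vwx; apply: nx.
have v_per : periodic_ae mu u v.
  move=> n; pose M : set (borel K) := [set y | N (y - - u n)].
  have mM : measurable M.
    by have := measurable_shift (- u n) measurableT mN; rewrite setTI.
  have M0 : mu M = 0%E by rewrite -[RHS]N0; exact: measure_shift.
  have [L [mL L0 wL]] := w_per n.
  exists (N `|` M `|` L); split.
  - by apply: measurableU => //; exact: measurableU.
  - by rewrite !measureU0//; exact: measurableU.
  move=> x nx; apply: contrapT => xN; apply: nx => /=.
  have vx y : ~ N y -> v y = w y by move=> yN; apply: contrapT => ne; apply: yN; exact: vwN.
  rewrite !vx; [|by move=> Nx; apply: xN; left; left|].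
    by apply: contrapT => ne; apply: xN; right; exact: wL.
  by move=> Nx; apply: xN; left; right; rewrite /M/= opprK.
have ab : ball_condition p v -> norm_bound p v.
  by move=> Bv; apply: muckenhoupt_norm_bound => //; exact: ball_condition_muckenhoupt.
have bc : norm_bound p v -> norm_convergence p v by exact: norm_bound_convergence.
have ca : norm_convergence p v -> ball_condition p v.
  move=> cv; apply: muckenhoupt_ball_condition => //.
  exact: norm_convergence_muckenhoupt.
have toa := ball_condition_ae (p := p) vm wm vw; have ofa := ball_condition_ae (p := p) wm vm wv.
have tob := norm_bound_ae (p := p) vm wm vw; have ofb := norm_bound_ae (p := p) wm vm wv.
have toc := norm_convergence_ae (p := p) vm wm vw.
have ofc := norm_convergence_ae (p := p) wm vm wv.
split; split => cond.
- exact (tob (ab (ofa cond))).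
- exact (toa (ca (bc (ofb cond)))).
- exact (toc (bc (ofb cond))).
- exact (tob (ab (ca (ofc cond)))).
Qed.

End LocalFieldStructure.

Theorem theorem1p1 (R : realType) (K : localFieldType)
    (mu : {measure set (borel K) -> \bar R}) (haar_mu : haar_measure mu)
    (abs : K -> R) (abs_mu : haar_absolute_value mu abs)
    (mu1 : mu (integers abs) = 1%E)
    (l c : nat) (l_prime : prime l) (c_gt0 : (0 < c)%N)
    (F : finFieldType) (cardF : #|F| = (l ^ c)%N)
    (red : K -> F) (red_residue : residue_map abs red)
    (eps : 'I_c -> K)
    (eps_basis : residue_basis abs red (card_finPcharP cardF l_prime) eps)
    (varpi : K) (varpi_prime : prime_element abs varpi)
    (chi : K -> R[i]) (chi_char : character chi)
    (chi_trivial : forall x, integers abs x -> chi x = 1)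
    (chi_nontrivial : exists2 x, prime_ideal_pow abs varpi (-1) x & chi x <> 1)
    (w : K -> R) (w_weight : weight mu w)
    (w_periodic : periodic_ae mu (u_rep l eps varpi) w)
    (p : R) (p_gt1 : 1 < p) :
  let D := integers abs in
  let u := u_rep l eps varpi in
  let Sf := fourier_sum mu D chi u in
  let condition_a :=
    exists2 C : R, 0 < C &
      forall B : set K, field_ball abs varpi B ->
        (average mu B w *
         poweR (average mu B (fun x => (w x `^ (- (p - 1)^-1))%R)) (p - 1)%R
           <= C%:E)%E in
  let condition_b :=
    exists2 C : R, 0 < C &
      forall f : K -> R[i], weighted_Lp mu D w p f ->
        cintegrable mu D f /\
        forall n : nat,
          (weighted_pintegral mu D w p (Sf n f)
             <= C%:E * weighted_pintegral mu D w p f)%E in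
  let condition_c :=
    forall f : K -> R[i], periodic_ae mu u f -> weighted_Lp mu D w p f ->
      cintegrable mu D f /\
      weighted_Lp_norm mu D w p (fun x => Sf n f x - f x) @[n --> \oo] --> 0%E in
  (condition_a <-> condition_b) /\ (condition_b <-> condition_c).
Proof.
exact (conditions_equivalent haar_mu abs_mu red_residue varpi_prime mu1
  c_gt0 eps_basis chi_char chi_trivial chi_nontrivial w_weight w_periodic p_gt1).
Qed.
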